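(* Let $\mathcal{C}$ be a strongly graded tensor category over a group $G$ and let $X$ be a transitive (left) $G$-set. Let $\mathcal{M}$ and $\mathcal{N}$ be non-zero $X$-graded $\mathcal{C}$-module categories. For $x\in X$ let $H=\operatorname{st}(x)$ be the stabilizer subgroup of $x$, and $\mathcal{C}_H=\bigoplus_{h\in H}\mathcal{C}_h$. Then, for all $x\in X$: (1) $\mathcal{M}\cong\mathcal{C}\boxtimes_{\mathcal{C}_H}\mathcal{M}_x$ as $X$-graded $\mathcal{C}$-module categories. (2) There is a bijective correspondence between isomorphism classes of $X$-graded $\mathcal{C}$-module functors $(F,\eta):\mathcal{M}\to\mathcal{N}$ and isomorphism classes of $\mathcal{C}_H$-module functors $(T,\rho):\mathcal{M}_x\to\mathcal{N}_x$.
   Context: Tensor category over a field $k$: a $k$-linear abelian monoidal category with $k$-bilinear biexact $\otimes$, associativity constraint satisfying the pentagon, strict unit $1$, and $\dim_k\operatorname{End}(1)=1$. It is $G$-graded if $\mathcal{C}=\bigoplus_{\sigma\in G}\mathcal{C}_\sigma$ is a direct sum of full abelian subcategories with $\otimes$ mapping $\mathcal{C}_\sigma\times\mathcal{C}_\tau$ to $\mathcal{C}_{\sigma\tau}$; it is strongly graded if for all $\sigma,\tau$ the inclusion into $\mathcal{C}_{\sigma\tau}$ of the full $k$-linear subcategory with objects the direct sums of objects $V_\sigma\otimes W_\tau$ ($V_\sigma\in\mathcal{C}_\sigma$, $W_\tau\in\mathcal{C}_\tau$) is an equivalence of $k$-linear categories. Left $\mathcal{C}$-module category: a $k$-linear abelian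 category $\mathcal{M}$ with a biexact action $\otimes:\mathcal{C}\times\mathcal{M}\to\mathcal{M}$ and natural isomorphisms $m_{X,Y,M}:(X\otimes Y)\otimes M\to X\otimes(Y\otimes M)$ satisfying the pentagon, with $1\otimes M=M$. A $\mathcal{C}$-module functor $(F,\phi)$ is an exact functor with natural isomorphisms $\phi_{X,M}:F(X\otimes M)\to X\otimes F(M)$ compatible with the associativity constraints; isomorphisms of module functors are natural isomorphisms compatible with the $\phi$'s. A left $X$-graded $\mathcal{C}$-module category is a left $\mathcal{C}$-module category with a decomposition $\mathcal{M}=\bigoplus_{x\in X}\mathcal{M}_x$ into full abelian subcategories such that $\otimes$ maps $\mathcal{C}_\sigma\times\mathcal{M}_x$ to $\mathcal{M}_{\sigma x}$. An $X$-graded $\mathcal{C}$-module functor is a $\mathcal{C}$-module functor mapping $\mathcal{M}_x$ to $\mathcal{N}_x$ for all $x$. For a right $\mathcal{D}$-module category $\mathcal{P}$ and a left $\mathcal{D}$-module category $\mathcal{Q}$, $\mathcal{P}\boxtimes_{\mathcal{D}}\mathcal{Q}$ is the $k$-linear category whose objects are finite sums of symbols $[P,Q]$ and whose morphisms are generated by symbols $[f,g]$ and invertible symbols $\alpha_{P,V,Q}:[P\otimes V,Q]\to[P,V\otimes Q]$, $V\in\mathcal{D}$, subject to bilinearity and functoriality of $[f,g]$, naturality of $\alpha$, and $[\mathrm{id}_P,n_{V,W,Q}]\circ\alpha_{P,V\otimes W,Q}\circ[m_{P,V,W},\mathrm{id}_Q]=\alpha_{P,V,W\otimes Q}\circ\alpha_{P\otimes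 V,W,Q}$, where $m,n$ are the associativity constraints of $\mathcal{P},\mathcal{Q}$. On $\mathcal{C}\boxtimes_{\mathcal{C}_H}\mathcal{M}_x$ the category $\mathcal{C}$ acts by $V\otimes[W,M]=[V\otimes W,M]$, and it is graded by $G/H\cong X$ ($\sigma H\mapsto\sigma x$) with component of degree $\sigma H$ equal to $\bigl(\bigoplus_{\tau\in\sigma H}\mathcal{C}_\tau\bigr)\boxtimes_{\mathcal{C}_H}\mathcal{M}_x$. *)

(* Defs.v *)
From HB Require Import structures.
From mathcomp Require Import all_boot all_algebra boolp.
From mathcomp Require Import monoid generic_quotient.

Set Implicit Arguments.
Unset Strict Implicit.
Unset Printing Implicit Defensive.

Import GRing.Theory.
Local Open Scope ring_scope.

Declare Scope cat_scope.
Delimit Scope cat_scope with cat.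

Reserved Notation "g ∘ f" (at level 40, left associativity).
Reserved Notation "V ⊗ W" (at level 30, right associativity).
Reserved Notation "f ⊗h g" (at level 30, right associativity).
Reserved Notation "V ▷ M" (at level 30, right associativity).
Reserved Notation "f ▷h g" (at level 30, right associativity).
Reserved Notation "P ◁ V" (at level 31, left associativity).
Reserved Notation "f ◁h g" (at level 31, left associativity).

Record klcat (k : fieldType) := KLCat {
  kob :> Type;
  hom : kob -> kob -> lmodType k;
  idm : forall A, hom A A;
  comp : forall A B C, hom B C -> hom A B -> hom A C;
  compA : forall A B C D (h : hom C D) (g : hom B C) (f : hom A B),
    comp h (comp g f) = comp (comp h g) f;
  comp1m : forall A B (f : hom A B), comp (idm B) f = f;
  compm1 : forall A B (f : hom A B), comp f (idm A) = f;
  comp_linl : forall A B C (f : hom A B) c (g g' : hom B C),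
    comp (c *: g + g') f = c *: comp g f + comp g' f;
  comp_linr : forall A B C (g : hom B C) c (f f' : hom A B),
    comp g (c *: f + f') = c *: comp g f + comp g f' }.

Arguments idm {k C} A : rename.
Notation "g ∘ f" := (comp g f) : cat_scope.
Open Scope cat_scope.

Record iso (k : fieldType) (C : klcat k) (A B : C) := Iso {
  ihom :> hom A B;
  iinv : hom B A;
  iKl : iinv ∘ ihom = idm A;
  iKr : ihom ∘ iinv = idm B }.

Definition isomorphic (k : fieldType) (C : klcat k) (A B : C) : Prop :=
  inhabited (iso A B).

(* The identity morphism of A, read along an equality of objects; it is used to
   say that unit constraints are identities. *)
Definition eqhom (k : fieldType) (C : klcat k) (A B : C) (e : A = B) : hom A B :=
  match e in _ = B return hom A B with erefl => idm A end.

Section Abelian.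
Variables (k : fieldType) (C : klcat k).

Definition is_biproduct (I : finType) (A : I -> C) (S : C) : Prop :=
  exists (inj : forall i, hom (A i) S) (prj : forall i, hom S (A i)),
    [/\ forall i, prj i ∘ inj i = idm (A i),
        forall i j, i <> j -> prj j ∘ inj i = 0
      & \sum_i (inj i ∘ prj i) = idm S].

Definition mono (A B : C) (f : hom A B) : Prop :=
  forall Z (g h : hom Z A), f ∘ g = f ∘ h -> g = h.

Definition epi (A B : C) (f : hom A B) : Prop :=
  forall Z (g h : hom B Z), g ∘ f = h ∘ f -> g = h.

Definition is_kernel (A B K : C) (f : hom A B) (i : hom K A) : Prop :=
  f ∘ i = 0 /\
  forall Z (g : hom Z A), f ∘ g = 0 -> exists! u : hom Z K, i ∘ u = g.

Definition is_cokernel (A B Q : C) (f : hom A B) (p : hom B Q) : Prop :=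
  p ∘ f = 0 /\
  forall Z (g : hom B Z), g ∘ f = 0 -> exists! u : hom Q Z, u ∘ p = g.

(* The empty biproduct is a zero object. *)
Definition is_abelian : Prop :=
  [/\ forall (I : finType) (A : I -> C), exists S, is_biproduct A S,
      forall A B (f : hom A B), exists K (i : hom K A), is_kernel f i,
      forall A B (f : hom A B), exists Q (p : hom B Q), is_cokernel f p,
      forall A B (f : hom A B), mono f ->
        exists Z (g : hom B Z), is_kernel g f
    & forall A B (f : hom A B), epi f ->
        exists Z (g : hom Z A), is_cokernel g f].

Definition is_nonzero : Prop := exists A : C, idm A <> 0.

End Abelian.

Record klfun (k : fieldType) (C D : klcat k) := KLFun {
  fob :> C -> D;
  fhom : forall A B, hom A B -> hom (fob A) (fob B);
  fhom_lin : forall A B c (f g : hom A B),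
    fhom (c *: f + g) = c *: fhom f + fhom g;
  fhom1 : forall A, fhom (idm A) = idm (fob A);
  fhomM : forall A B E (g : hom B E) (f : hom A B),
    fhom (g ∘ f) = fhom g ∘ fhom f }.

Definition is_exact (k : fieldType) (C D : klcat k) (F : klfun C D) : Prop :=
  forall (A B E : C) (i : hom A B) (p : hom B E),
    is_kernel p i -> is_cokernel i p ->
    is_kernel (fhom F p) (fhom F i) /\ is_cokernel (fhom F i) (fhom F p).

Definition id_fun (k : fieldType) (C : klcat k) : klfun C C :=
  @KLFun k C C id (fun A B f => f) (fun A B c f g => erefl) (fun A => erefl)
    (fun A B E g f => erefl).

Program Definition comp_fun (k : fieldType) (C D E : klcat k)
    (G : klfun D E) (F : klfun C D) : klfun C E :=
  @KLFun k C E (fun A => G (F A)) (fun A B f => fhom G (fhom F f)) _ _ _.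
Next Obligation. by rewrite !fhom_lin. Qed.
Next Obligation. by rewrite !fhom1. Qed.
Next Obligation. by rewrite !fhomM. Qed.

Definition naturally_isomorphic (k : fieldType) (C D : klcat k)
    (F G : klfun C D) : Prop :=
  exists theta : forall A, iso (F A) (G A),
    forall A B (f : hom A B), theta B ∘ fhom F f = fhom G f ∘ theta A.

Definition is_equivalence (k : fieldType) (C D : klcat k) (F : klfun C D) :
    Prop :=
  exists G : klfun D C,
    naturally_isomorphic (comp_fun G F) (id_fun C) /\
    naturally_isomorphic (comp_fun F G) (id_fun D).

Definition fullsub (k : fieldType) (C : klcat k) (P : C -> Prop) : klcat k :=
  @KLCat k {A : C | P A} (fun A B => hom (sval A) (sval B))
    (fun A => idm (sval A)) (fun A B E g f => g ∘ f)
    (fun A B E F h g f => compA h g f) (fun A B f => comp1m f)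
    (fun A B f => compm1 f) (fun A B E f c g g' => comp_linl f c g g')
    (fun A B E g c f f' => comp_linr g c f f').

Definition fullsub_incl (k : fieldType) (C : klcat k) (P : C -> Prop) :
    klfun (fullsub P) C :=
  @KLFun k (fullsub P) C sval (fun A B f => f) (fun A B c f g => erefl)
    (fun A => erefl) (fun A B E g f => erefl).

Record klbifun (k : fieldType) (A B C : klcat k) := KLBifun {
  bob :> A -> B -> C;
  bhom : forall a a' b b', hom a a' -> hom b b' -> hom (bob a b) (bob a' b');
  bhom1 : forall a b, bhom (idm a) (idm b) = idm (bob a b);
  bhomM : forall a a' a'' b b' b'' (f' : hom a' a'') (f : hom a a')
      (g' : hom b' b'') (g : hom b b'),
    bhom (f' ∘ f) (g' ∘ g) = bhom f' g' ∘ bhom f g;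
  bhom_linl : forall a a' b b' c (f f' : hom a a') (g : hom b b'),
    bhom (c *: f + f') g = c *: bhom f g + bhom f' g;
  bhom_linr : forall a a' b b' c (f : hom a a') (g g' : hom b b'),
    bhom f (c *: g + g') = c *: bhom f g + bhom f g' }.

Program Definition bifun_l (k : fieldType) (A B C : klcat k)
    (F : klbifun A B C) (a : A) : klfun B C :=
  @KLFun k B C (fun b => F a b) (fun b b' g => bhom F (idm a) g) _ _ _.
Next Obligation. by rewrite bhom_linr. Qed.
Next Obligation. by rewrite bhom1. Qed.
Next Obligation. by rewrite -bhomM comp1m. Qed.

Program Definition bifun_r (k : fieldType) (A B C : klcat k)
    (F : klbifun A B C) (b : B) : klfun A C :=
  @KLFun k A C (fun a => F a b) (fun a a' f => bhom F f (idm b)) _ _ _.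
Next Obligation. by rewrite bhom_linl. Qed.
Next Obligation. by rewrite bhom1. Qed.
Next Obligation. by rewrite -bhomM comp1m. Qed.

Definition is_biexact (k : fieldType) (A B C : klcat k) (F : klbifun A B C) :
    Prop :=
  (forall a, is_exact (bifun_l F a)) /\ (forall b, is_exact (bifun_r F b)).

(* Abelianness, biexactness and dim End(1) = 1 are added by the predicate
   [is_tensor_category] below; likewise for module categories.
   The unit is strict: 1 ⊗ V = V = V ⊗ 1, and the identities are natural unit
   constraints satisfying the triangle axiom (i.e. a_{V,1,W} is the identity). *)
Record moncat (k : fieldType) := MonCat {
  mcat :> klcat k;
  mtens : klbifun mcat mcat mcat;
  munit : mcat;
  massoc : forall X Y Z, iso (mtens (mtens X Y) Z) (mtens X (mtens Y Z));
  massoc_nat : forall X X' Y Y' Z Z'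
      (f : hom X X') (g : hom Y Y') (h : hom Z Z'),
    massoc X' Y' Z' ∘ bhom mtens (bhom mtens f g) h =
    bhom mtens f (bhom mtens g h) ∘ massoc X Y Z;
  mpentagon : forall X Y Z W,
    massoc X Y (mtens Z W) ∘ massoc (mtens X Y) Z W =
    bhom mtens (idm X) (massoc Y Z W) ∘ massoc X (mtens Y Z) W
      ∘ bhom mtens (massoc X Y Z) (idm W);
  munitl : forall V, mtens munit V = V;
  munitr : forall V, mtens V munit = V;
  munitl_nat : forall V V' (f : hom V V'),
    eqhom (munitl V') ∘ bhom mtens (idm munit) f = f ∘ eqhom (munitl V);
  munitr_nat : forall V V' (f : hom V V'),
    eqhom (munitr V') ∘ bhom mtens f (idm munit) = f ∘ eqhom (munitr V);
  mtriangle : forall V W,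
    bhom mtens (idm V) (eqhom (munitl W)) ∘ massoc V munit W =
    bhom mtens (eqhom (munitr V)) (idm W) }.

Notation "V ⊗ W" := (bob (mtens _) V W) : cat_scope.
Notation "f ⊗h g" := (bhom (mtens _) f g) : cat_scope.

Definition is_tensor_category (k : fieldType) (C : moncat k) : Prop :=
  [/\ is_abelian C, is_biexact (mtens C)
    & exists e : hom (munit C) (munit C),
        e <> 0 /\ forall f : hom (munit C) (munit C), exists c : k, f = c *: e].

(* The unit acts strictly: 1 ▷ M = M, naturally in M.  No compatibility of these
   identities with [lassoc] (triangle axiom) is required. *)
Record lmodcat (k : fieldType) (D : moncat k) := LModCat {
  lcat :> klcat k;
  lact : klbifun D lcat lcat;
  lassoc : forall X Y M, iso (lact (X ⊗ Y) M) (lact X (lact Y M));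
  lassoc_nat : forall X X' Y Y' M M'
      (f : hom X X') (g : hom Y Y') (h : hom M M'),
    lassoc X' Y' M' ∘ bhom lact (f ⊗h g) h =
    bhom lact f (bhom lact g h) ∘ lassoc X Y M;
  lpentagon : forall X Y Z M,
    lassoc X Y (lact Z M) ∘ lassoc (X ⊗ Y) Z M =
    bhom lact (idm X) (lassoc Y Z M) ∘ lassoc X (Y ⊗ Z) M
      ∘ bhom lact (massoc X Y Z) (idm M);
  lunit : forall M, lact (munit D) M = M;
  lunit_nat : forall M M' (f : hom M M'),
    eqhom (lunit M') ∘ bhom lact (idm (munit D)) f = f ∘ eqhom (lunit M) }.

Notation "V ▷ M" := (bob (lact _) V M) : cat_scope.
Notation "f ▷h g" := (bhom (lact _) f g) : cat_scope.

Record rmodcat (k : fieldType) (D : moncat k) := RModCat {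
  rcat :> klcat k;
  ract : klbifun rcat D rcat;
  rassoc : forall P V W, iso (ract (ract P V) W) (ract P (V ⊗ W));
  rassoc_nat : forall P P' V V' W W'
      (f : hom P P') (g : hom V V') (h : hom W W'),
    rassoc P' V' W' ∘ bhom ract (bhom ract f g) h =
    bhom ract f (g ⊗h h) ∘ rassoc P V W;
  rpentagon : forall P U V W,
    rassoc P U (V ⊗ W) ∘ rassoc (ract P U) V W =
    bhom ract (idm P) (massoc U V W) ∘ rassoc P (U ⊗ V) W
      ∘ bhom ract (rassoc P U V) (idm W);
  runit : forall P, ract P (munit D) = P;
  runit_nat : forall P P' (f : hom P P'),
    eqhom (runit P') ∘ bhom ract f (idm (munit D)) = f ∘ eqhom (runit P) }.

Notation "P ◁ V" := (bob (ract _) P V) : cat_scope.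
Notation "f ◁h g" := (bhom (ract _) f g) : cat_scope.

Definition is_module_category (k : fieldType) (D : moncat k) (M : lmodcat D) :
    Prop :=
  is_abelian M /\ is_biexact (lact M).

Record modfun (k : fieldType) (D : moncat k) (M N : lmodcat D) := ModFun {
  mffun :> klfun M N;
  mfexact : is_exact mffun;
  mfphi : forall X A, iso (mffun (X ▷ A)) (X ▷ mffun A);
  mfphi_nat : forall X X' A A' (f : hom X X') (g : hom A A'),
    mfphi X' A' ∘ fhom mffun (f ▷h g) = (f ▷h fhom mffun g) ∘ mfphi X A;
  mfphi_assoc : forall X Y A,
    lassoc X Y (mffun A) ∘ mfphi (X ⊗ Y) A =
    (idm X ▷h mfphi Y A) ∘ mfphi X (Y ▷ A) ∘ fhom mffun (lassoc X Y A) }.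

Definition modfun_isomorphic (k : fieldType) (D : moncat k) (M N : lmodcat D)
    (F F' : modfun M N) : Prop :=
  exists theta : forall A, iso (F A) (F' A),
    (forall A B (f : hom A B), theta B ∘ fhom F f = fhom F' f ∘ theta A) /\
    (forall X A, mfphi F' X A ∘ theta (X ▷ A) =
                 (idm X ▷h theta A) ∘ mfphi F X A).

Definition isoclasses (T : Type) (R : T -> T -> Prop) : Type :=
  {S : T -> Prop | exists a, S = R a}.

Section CatFacts.
Variables (k : fieldType) (C : klcat k).
Implicit Types A B D : C.

Lemma comp0m A B D (f : hom A B) : (0 : hom B D) ∘ f = 0.
Proof.
have := comp_linl f 1 (0 : hom B D) 0; rewrite !scale1r addr0 => /esym/eqP.
by rewrite -[X in _ == X]addr0 (inj_eq (addrI _)) => /eqP.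
Qed.

Lemma compm0 A B D (g : hom B D) : g ∘ (0 : hom A B) = 0.
Proof.
have := comp_linr g 1 (0 : hom A B) 0; rewrite !scale1r addr0 => /esym/eqP.
by rewrite -[X in _ == X]addr0 (inj_eq (addrI _)) => /eqP.
Qed.

Lemma compDl A B D (f : hom A B) (g g' : hom B D) :
  (g + g') ∘ f = g ∘ f + g' ∘ f.
Proof. by have := comp_linl f 1 g g'; rewrite !scale1r. Qed.

Lemma compDr A B D (g : hom B D) (f f' : hom A B) :
  g ∘ (f + f') = g ∘ f + g ∘ f'.
Proof. by have := comp_linr g 1 f f'; rewrite !scale1r. Qed.

Lemma compZl A B D (f : hom A B) c (g : hom B D) : (c *: g) ∘ f = c *: (g ∘ f).
Proof. by rewrite -[c *: g]addr0 comp_linl comp0m addr0. Qed.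

Lemma compZr A B D (g : hom B D) c (f : hom A B) : g ∘ (c *: f) = c *: (g ∘ f).
Proof. by rewrite -[c *: f]addr0 comp_linr compm0 addr0. Qed.

Lemma comp_suml (I : finType) A B D (f : hom A B) (g : I -> hom B D) :
  (\sum_i g i) ∘ f = \sum_i (g i ∘ f).
Proof.
apply: (big_rec2 (fun x y => x ∘ f = y)); first exact: comp0m.
by move=> i x y _ <-; rewrite compDl.
Qed.

Lemma comp_sumr (I : finType) A B D (g : hom B D) (f : I -> hom A B) :
  g ∘ (\sum_i f i) = \sum_i (g ∘ f i).
Proof.
apply: (big_rec2 (fun x y => g ∘ x = y)); first exact: compm0.
by move=> i x y _ <-; rewrite compDr.
Qed.

Program Definition iso_id A : iso A A := @Iso k C A A (idm A) (idm A) _ _.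
Next Obligation. by rewrite comp1m. Qed.
Next Obligation. by rewrite comp1m. Qed.

Definition iso_sym A B (f : iso A B) : iso B A := Iso (iKr f) (iKl f).

Program Definition iso_comp A B D (g : iso B D) (f : iso A B) : iso A D :=
  @Iso k C A D (g ∘ f) (iinv f ∘ iinv g) _ _.
Next Obligation. by rewrite compA -(compA (iinv f)) iKl compm1 iKl. Qed.
Next Obligation. by rewrite compA -(compA (ihom g)) iKr compm1 iKr. Qed.

Lemma isomorphic_sym A B : isomorphic A B -> isomorphic B A.
Proof. by case=> f; constructor; exact: iso_sym. Qed.

Lemma isomorphic_trans A B D :
  isomorphic A B -> isomorphic B D -> isomorphic A D.
Proof. by move=> [f] [g]; constructor; exact: iso_comp g f. Qed.

Lemma biproduct_isomorphic (I : finType) (A : I -> C) S S' :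
  is_biproduct A S -> is_biproduct A S' -> isomorphic S S'.
Proof.
move=> [i [p [pi p0 ip]]] [i' [p' [pi' p0' ip']]].
have K (T T' : C) (j : forall x, hom (A x) T) (q : forall x, hom T (A x))
   (j' : forall x, hom (A x) T') (q' : forall x, hom T' (A x)) :
   (forall x, q' x ∘ j' x = idm (A x)) ->
   (forall x y, x <> y -> q' y ∘ j' x = 0) -> \sum_x (j x ∘ q x) = idm T ->
   (\sum_x (j x ∘ q' x)) ∘ (\sum_x (j' x ∘ q x)) = idm T.
  move=> h1 h0 <-; rewrite comp_suml; apply: eq_bigr => x _.
  rewrite comp_sumr (bigD1 x) //= big1 ?addr0 => [|y /eqP yx].
    by rewrite compA -(compA (j x)) h1 compm1.
  by rewrite compA -(compA (j x)) h0 // compm0 comp0m.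
constructor; exists (\sum_x (i' x ∘ p x)) (\sum_x (i x ∘ p' x)); exact: K.
Qed.

Lemma biproduct_iso (I : finType) (A : I -> C) S S' :
  isomorphic S S' -> is_biproduct A S -> is_biproduct A S'.
Proof.
move=> [f] [i [p [pi p0 ip]]].
exists (fun x => f ∘ i x), (fun x => p x ∘ iinv f); split.
- by move=> x; rewrite compA -(compA (p x)) iKl compm1 pi.
- by move=> x y xy; rewrite compA -(compA (p y)) iKl compm1 p0.
transitivity (f ∘ (\sum_x (i x ∘ p x)) ∘ iinv f); last by rewrite ip compm1 iKr.
rewrite comp_sumr comp_suml; apply: eq_bigr => x _.
by rewrite !compA.
Qed.

Lemma abelian_biproduct_closed (P : C -> Prop) (I : finType) (A : I -> C) S :
  (forall A B, isomorphic A B -> P A -> P B) -> is_abelian (fullsub P) ->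
  (forall i, P (A i)) -> is_biproduct A S -> P S.
Proof.
move=> repl [sums _ _ _ _] PA bipS.
have [T bipT] := sums I (fun i => exist P (A i) (PA i)).
have bipT' : is_biproduct A (sval T) by [].
exact: repl (biproduct_isomorphic bipT' bipS) (proj2_sig T).
Qed.

Lemma eqhom_trans A B D (e : A = B) (e' : B = D) :
  eqhom e' ∘ eqhom e = eqhom (etrans e e').
Proof. by case: D / e' => /=; rewrite comp1m. Qed.

Lemma eqhom_refl A (e : A = A) : eqhom e = idm A.
Proof. by rewrite (Prop_irrelevance e erefl). Qed.

Lemma eqhom_irr A B (e e' : A = B) : eqhom e = eqhom e'.
Proof. by rewrite (Prop_irrelevance e e'). Qed.

Lemma eqhom_symK A B (e : A = B) : eqhom (esym e) ∘ eqhom e = idm A.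
Proof. by rewrite eqhom_trans eqhom_refl. Qed.

Lemma eqhom_symKr A B (e : A = B) : eqhom e ∘ eqhom (esym e) = idm B.
Proof. by rewrite eqhom_trans eqhom_refl. Qed.

Lemma eqhom_square A A' B B' (d e : A = B) (d' e' : A' = B')
    (h : hom A A') (f : hom B B') :
  eqhom e' ∘ h = f ∘ eqhom e -> eqhom d' ∘ h = f ∘ eqhom d.
Proof. by rewrite (eqhom_irr d e) (eqhom_irr d' e'). Qed.

Lemma eqhom_fullsub (P : C -> Prop) (A B : fullsub P) (e : A = B)
    (e' : sval A = sval B) : eqhom e = eqhom e' :> hom (sval A) (sval B).
Proof. by case: B / e e' => e' /=; rewrite eqhom_refl. Qed.

Lemma eqhom_fullsub_square (P : C -> Prop) (A A' B B' : fullsub P)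
    (d : A = B) (e : sval A = sval B) (d' : A' = B') (e' : sval A' = sval B')
    (h : hom (sval A) (sval A')) (f : hom (sval B) (sval B')) :
  eqhom e' ∘ h = f ∘ eqhom e ->
  (eqhom d' : hom (sval A') (sval B')) ∘ h =
  f ∘ (eqhom d : hom (sval A) (sval B)).
Proof. by rewrite (eqhom_fullsub d e) (eqhom_fullsub d' e'). Qed.

End CatFacts.

Section BifunFacts.
Variables (k : fieldType) (A B C : klcat k) (F : klbifun A B C).

Lemma bhom0m a a' b b' (g : hom b b') : bhom F (0 : hom a a') g = 0.
Proof.
have := bhom_linl F 1 (0 : hom a a') 0 g; rewrite !scale1r addr0 => /esym/eqP.
by rewrite -[X in _ == X]addr0 (inj_eq (addrI _)) => /eqP.
Qed.

Lemma bhomm0 a a' b b' (f : hom a a') : bhom F f (0 : hom b b') = 0.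
Proof.
have := bhom_linr F 1 f (0 : hom b b') 0; rewrite !scale1r addr0 => /esym/eqP.
by rewrite -[X in _ == X]addr0 (inj_eq (addrI _)) => /eqP.
Qed.

Lemma bhom_suml (I : finType) a a' b b' (f : I -> hom a a') (g : hom b b') :
  bhom F (\sum_i f i) g = \sum_i bhom F (f i) g.
Proof.
apply: (big_rec2 (fun x y => bhom F x g = y)); first exact: bhom0m.
by move=> i x y _ <-; have := bhom_linl F 1 (f i) x g; rewrite !scale1r.
Qed.

Lemma bhom_sumr (I : finType) a a' b b' (f : hom a a') (g : I -> hom b b') :
  bhom F f (\sum_i g i) = \sum_i bhom F f (g i).
Proof.
apply: (big_rec2 (fun x y => bhom F f x = y)); first exact: bhomm0.
by move=> i x y _ <-; have := bhom_linr F 1 f (g i) x; rewrite !scale1r.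
Qed.

Lemma bifun_biproduct (I J : finType) (a : I -> A) (b : J -> B) S T :
  is_biproduct a S -> is_biproduct b T ->
  is_biproduct (fun x : I * J => F (a x.1) (b x.2)) (F S T).
Proof.
move=> [i [p [pi p0 ip]]] [j [q [qj q0 jq]]].
exists (fun x => bhom F (i x.1) (j x.2)), (fun x => bhom F (p x.1) (q x.2)).
split.
- by move=> x; rewrite -bhomM pi qj bhom1.
- move=> [x x'] [y y'] /= xy; rewrite -bhomM.
  have [eqx|/eqP nx] := eqVneq x y; last by rewrite p0 // bhom0m.
  by rewrite (q0 x' y') ?bhomm0 // => eqx'; case: xy; rewrite eqx eqx'.
rewrite -bhom1 -ip -jq bhom_suml -(pair_bigA _ (fun x y =>
  bhom F (i x) (j y) ∘ bhom F (p x) (q y))) /=.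
apply: eq_bigr => x _; rewrite bhom_sumr; apply: eq_bigr => y _.
by rewrite bhomM.
Qed.

Program Definition bhom_iso a a' b b' (f : iso a a') (g : iso b b') :
    iso (F a b) (F a' b') :=
  @Iso k C _ _ (bhom F f g) (bhom F (iinv f) (iinv g)) _ _.
Next Obligation. by rewrite -bhomM !iKl bhom1. Qed.
Next Obligation. by rewrite -bhomM !iKr bhom1. Qed.

End BifunFacts.

#[local] Obligation Tactic := idtac.

Program Definition fullsub_bifun (k : fieldType) (A B C : klcat k)
    (F : klbifun A B C) (P : A -> Prop) (Q : B -> Prop) (R : C -> Prop)
    (PQR : forall a b, P a -> Q b -> R (F a b)) :
    klbifun (fullsub P) (fullsub Q) (fullsub R) :=
  @KLBifun k (fullsub P) (fullsub Q) (fullsub R)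
    (fun a b => exist R (F (sval a) (sval b))
                  (PQR _ _ (proj2_sig a) (proj2_sig b)))
    (fun a a' b b' f g => bhom F f g) _ _ _ _.
Next Obligation. move=> *; exact: bhom1. Qed.
Next Obligation. move=> *; exact: bhomM. Qed.
Next Obligation. move=> *; exact: bhom_linl. Qed.
Next Obligation. move=> *; exact: bhom_linr. Qed.

Definition fullsub_iso (k : fieldType) (C : klcat k) (P : C -> Prop)
    (A B : fullsub P) (f : iso (sval A) (sval B)) : iso A B :=
  @Iso k (fullsub P) A B f (iinv f) (iKl f) (iKr f).

Section SubMonCat.
Variables (k : fieldType) (C : moncat k) (P : C -> Prop).
Hypotheses (P1 : P (munit C)) (PM : forall V W, P V -> P W -> P (V ⊗ W)).

Program Definition submoncat : moncat k :=
  @MonCat k (fullsub P) (fullsub_bifun PM) (exist P (munit C) P1)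
    (fun X Y Z => let T := fullsub_bifun PM in
       @fullsub_iso k C P (T (T X Y) Z) (T X (T Y Z))
         (massoc (sval X) (sval Y) (sval Z)))
    _ _ _ _ _ _ _.
Next Obligation.
move=> X X' Y Y' Z Z' f g h.
exact: (@massoc_nat k C (sval X) (sval X') (sval Y) (sval Y') (sval Z) (sval Z')).
Qed.
Next Obligation.
move=> X Y Z W; exact: (mpentagon (sval X) (sval Y) (sval Z) (sval W)).
Qed.
Next Obligation. by case=> V PV; apply: eq_exist; exact: munitl. Qed.
Next Obligation. by case=> V PV; apply: eq_exist; exact: munitr. Qed.
Next Obligation.
move=> V V' f.
refine (@eqhom_fullsub_square k _ P _ _ V V' _ _ _ _ _ _ _).
exact: (@munitl_nat _ _ (sval V) (sval V') f).
Qed.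
Next Obligation.
move=> V V' f.
refine (@eqhom_fullsub_square k _ P _ _ V V' _ _ _ _ _ _ _).
exact: (@munitr_nat _ _ (sval V) (sval V') f).
Qed.
Next Obligation.
move=> V W; pose T := fullsub_bifun PM; pose I := exist P (munit C) P1.
rewrite (@eqhom_fullsub k C P (T I W) W _ (munitl (sval W))).
rewrite (@eqhom_fullsub k C P (T V I) V _ (munitr (sval V))).
exact: mtriangle.
Qed.

Program Definition regular_rmodcat : rmodcat submoncat :=
  @RModCat k submoncat C
    (@KLBifun k C submoncat C (fun V W => V ⊗ sval W)
      (fun V V' W W' f g => bhom (mtens C) f g) _ _ _ _)
    (fun X V W => massoc X (sval V) (sval W)) _ _ _ _.
Next Obligation. move=> *; exact: bhom1. Qed.
Next Obligation. move=> *; exact: bhomM. Qed.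
Next Obligation. move=> *; exact: bhom_linl. Qed.
Next Obligation. move=> *; exact: bhom_linr. Qed.
Next Obligation.
move=> X X' Y Y' Z Z' f g h.
exact: (@massoc_nat k C X X' (sval Y) (sval Y') (sval Z) (sval Z')).
Qed.
Next Obligation.
move=> X Y Z W; exact: (mpentagon X (sval Y) (sval Z) (sval W)).
Qed.
Next Obligation. exact: munitr. Qed.
Next Obligation.
move=> P0 P' f; exact: eqhom_square (munitr_nat _).
Qed.

Section SubModCat.
Variables (M : lmodcat C) (Q : M -> Prop).
Hypothesis PQ : forall V A, P V -> Q A -> Q (V ▷ A).

Program Definition sublmodcat : lmodcat submoncat :=
  @LModCat k submoncat (fullsub Q) (fullsub_bifun PQ)
    (fun X Y A => let T := fullsub_bifun PQ in
       @fullsub_iso k M Q (T (X ⊗ Y) A) (T X (T Y A))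
         (lassoc (sval X) (sval Y) (sval A)))
    _ _ _ _.
Next Obligation.
move=> X X' Y Y' Z Z' f g h.
exact: (@lassoc_nat k C M (sval X) (sval X') (sval Y) (sval Y') (sval Z) (sval Z')).
Qed.
Next Obligation.
move=> X Y Z W; exact: (lpentagon (sval X) (sval Y) (sval Z) (sval W)).
Qed.
Next Obligation. by case=> V PV; apply: eq_exist; exact: lunit. Qed.
Next Obligation.
move=> V V' f.
refine (@eqhom_fullsub_square k _ Q _ _ V V' _ _ _ _ _ _ _).
exact: (@lunit_nat _ _ M (sval V) (sval V') f).
Qed.

End SubModCat.
End SubMonCat.

Section Balanced.
Variables (k : fieldType) (D : moncat k) (P : rmodcat D) (Q : lmodcat D).

(* The objects of P ⊠_D Q: finite formal direct sums of symbols [p, q].  They are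
   bracketed, which is immaterial up to isomorphism. *)
Inductive fsum : Type :=
| Sym (p : P) (q : Q)
| Zero
| Plus (A B : fsum).

(* Formal expressions for morphisms: the symbols [f, g] and alpha^{+-1},
   together with the k-linear category operations and the structure morphisms
   of the direct sums. *)
Inductive term : fsum -> fsum -> Type :=
| TId A : term A A
| TComp A B E : term B E -> term A B -> term A E
| TZero A B : term A B
| TAdd A B : term A B -> term A B -> term A B
| TScale A B : k -> term A B -> term A B
| TInl A B : term A (Plus A B)
| TInr A B : term B (Plus A B)
| TPrl A B : term (Plus A B) A
| TPrr A B : term (Plus A B) B
| TSym p p' q q' : hom p p' -> hom q q' -> term (Sym p q) (Sym p' q')
| TAlpha p V q : term (Sym (p ◁ V) q) (Sym p (V ▷ q))
| TAlphaI p V q : term (Sym p (V ▷ q)) (Sym (p ◁ V) q).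

Arguments TAlpha : clear implicits.
Arguments TAlphaI : clear implicits.

Inductive teq : forall A B, term A B -> term A B -> Prop :=
| teq_refl A B (t : term A B) : teq t t
| teq_sym A B (t u : term A B) : teq t u -> teq u t
| teq_trans A B (t u v : term A B) : teq t u -> teq u v -> teq t v
| teq_comp A B E (t t' : term B E) (u u' : term A B) :
    teq t t' -> teq u u' -> teq (TComp t u) (TComp t' u')
| teq_add A B (t t' u u' : term A B) :
    teq t t' -> teq u u' -> teq (TAdd t u) (TAdd t' u')
| teq_scale A B c (t t' : term A B) : teq t t' -> teq (TScale c t) (TScale c t')
| teq_compA A B E F (t : term E F) (u : term B E) (v : term A B) :
    teq (TComp t (TComp u v)) (TComp (TComp t u) v)
| teq_comp1m A B (t : term A B) : teq (TComp (TId B) t) t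
| teq_compm1 A B (t : term A B) : teq (TComp t (TId A)) t
| teq_addA A B (t u v : term A B) : teq (TAdd t (TAdd u v)) (TAdd (TAdd t u) v)
| teq_addC A B (t u : term A B) : teq (TAdd t u) (TAdd u t)
| teq_add0 A B (t : term A B) : teq (TAdd (TZero A B) t) t
| teq_addN A B (t : term A B) : teq (TAdd (TScale (-1) t) t) (TZero A B)
| teq_scaleA A B c d (t : term A B) :
    teq (TScale c (TScale d t)) (TScale (c * d) t)
| teq_scale1 A B (t : term A B) : teq (TScale 1 t) t
| teq_scaleDr A B c (t u : term A B) :
    teq (TScale c (TAdd t u)) (TAdd (TScale c t) (TScale c u))
| teq_scaleDl A B c d (t : term A B) :
    teq (TScale (c + d) t) (TAdd (TScale c t) (TScale d t))
| teq_comp_linl A B E (u : term A B) c (t t' : term B E) :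
    teq (TComp (TAdd (TScale c t) t') u)
        (TAdd (TScale c (TComp t u)) (TComp t' u))
| teq_comp_linr A B E (t : term B E) c (u u' : term A B) :
    teq (TComp t (TAdd (TScale c u) u'))
        (TAdd (TScale c (TComp t u)) (TComp t u'))
| teq_zero : teq (TId Zero) (TZero Zero Zero)
| teq_prl_inl A B : teq (TComp (TPrl A B) (TInl A B)) (TId A)
| teq_prr_inr A B : teq (TComp (TPrr A B) (TInr A B)) (TId B)
| teq_prl_inr A B : teq (TComp (TPrl A B) (TInr A B)) (TZero B A)
| teq_prr_inl A B : teq (TComp (TPrr A B) (TInl A B)) (TZero A B)
| teq_plus A B :
    teq (TAdd (TComp (TInl A B) (TPrl A B)) (TComp (TInr A B) (TPrr A B)))
        (TId (Plus A B))
| teq_sym1 p q : teq (TSym (idm p) (idm q)) (TId (Sym p q))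
| teq_symM p p' p'' q q' q'' (f' : hom p' p'') (f : hom p p')
      (g' : hom q' q'') (g : hom q q') :
    teq (TSym (f' ∘ f) (g' ∘ g)) (TComp (TSym f' g') (TSym f g))
| teq_sym_linl p p' q q' c (f f' : hom p p') (g : hom q q') :
    teq (TSym (c *: f + f') g) (TAdd (TScale c (TSym f g)) (TSym f' g))
| teq_sym_linr p p' q q' c (f : hom p p') (g g' : hom q q') :
    teq (TSym f (c *: g + g')) (TAdd (TScale c (TSym f g)) (TSym f g'))
| teq_alphaK p V q : teq (TComp (TAlphaI p V q) (TAlpha p V q)) (TId _)
| teq_alphaKr p V q : teq (TComp (TAlpha p V q) (TAlphaI p V q)) (TId _)
| teq_alpha_nat p p' V V' q q' (f : hom p p') (u : hom V V') (g : hom q q') :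
    teq (TComp (TAlpha p' V' q') (TSym (f ◁h u) g))
        (TComp (TSym f (u ▷h g)) (TAlpha p V q))
| teq_alpha_assoc p V W q :
    teq (TComp (TSym (idm p) (lassoc V W q))
          (TComp (TAlpha p (V ⊗ W) q) (TSym (rassoc p V W) (idm q))))
        (TComp (TAlpha p V (W ▷ q)) (TAlpha (p ◁ V) W q)).

Section Quotient.
Variables A B : fsum.

HB.instance Definition _ := gen_eqMixin (term A B).
HB.instance Definition _ := gen_choiceMixin (term A B).

Definition teqb (t u : term A B) : bool := `[< teq t u >].

Lemma teqb_refl : reflexive teqb.
Proof. by move=> t; apply/asboolP; exact: teq_refl. Qed.

Lemma teqb_sym : symmetric teqb.
Proof. by move=> t u; apply/asboolP/asboolP; exact: teq_sym. Qed.

Lemma teqb_trans : transitive teqb.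
Proof. by move=> u t v /asboolP tu /asboolP uv; apply/asboolP/(teq_trans tu). Qed.

Canonical teqb_equiv := EquivRel teqb teqb_refl teqb_sym teqb_trans.

Definition bhomset : Type := {eq_quot teqb_equiv}%qT.
HB.instance Definition _ := Choice.on bhomset.

Definition cls (t : term A B) : bhomset := \pi_({eq_quot teqb_equiv})%qT t.
Definition rep (f : bhomset) : term A B := repr (f : {eq_quot teqb_equiv}%qT).

Lemma repK f : cls (rep f) = f. Proof. exact: reprK. Qed.

Lemma clsP t u : teq t u -> cls t = cls u.
Proof. by move=> tu; apply/eqmodP/asboolP. Qed.

Lemma cls_inj t u : cls t = cls u -> teq t u.
Proof. by move=> /eqmodP /asboolP. Qed.

Lemma rep_cls t : teq (rep (cls t)) t.
Proof. by apply: cls_inj; rewrite repK. Qed.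

Lemma clsW (R : bhomset -> Prop) : (forall t, R (cls t)) -> forall f, R f.
Proof. by move=> H f; rewrite -(repK f). Qed.

Definition badd (f g : bhomset) := cls (TAdd (rep f) (rep g)).
Definition bopp (f : bhomset) := cls (TScale (-1) (rep f)).
Definition bscale c (f : bhomset) := cls (TScale c (rep f)).

Lemma cls_badd t u : badd (cls t) (cls u) = cls (TAdd t u).
Proof. by apply/clsP/teq_add; exact: rep_cls. Qed.

Lemma cls_bscale c t : bscale c (cls t) = cls (TScale c t).
Proof. by apply/clsP/teq_scale; exact: rep_cls. Qed.

Lemma baddA : associative badd.
Proof.
elim/clsW=> t; elim/clsW=> u; elim/clsW=> v.
by rewrite !cls_badd; exact/clsP/teq_addA.
Qed.

Lemma baddC : commutative badd.
Proof.
by elim/clsW=> t; elim/clsW=> u; rewrite !cls_badd; exact/clsP/teq_addC.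
Qed.

Lemma badd0 : left_id (cls (TZero A B)) badd.
Proof. by elim/clsW=> t; rewrite cls_badd; exact/clsP/teq_add0. Qed.

Lemma baddN : left_inverse (cls (TZero A B)) bopp badd.
Proof.
elim/clsW=> t; rewrite -[bopp _]/(bscale _ _) cls_bscale cls_badd.
exact/clsP/teq_addN.
Qed.

HB.instance Definition _ :=
  GRing.isZmodule.Build bhomset baddA baddC badd0 baddN.

Lemma bscaleA c d f : bscale c (bscale d f) = bscale (c * d) f.
Proof. by elim/clsW: f => t; rewrite !cls_bscale; exact/clsP/teq_scaleA. Qed.

Lemma bscale1 : left_id 1 bscale.
Proof. by elim/clsW=> t; rewrite cls_bscale; exact/clsP/teq_scale1. Qed.

Lemma bscaleDr : right_distributive bscale +%R.
Proof.
move=> c; elim/clsW=> t; elim/clsW=> u.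
rewrite -![_ + _]/(badd _ _) cls_badd !cls_bscale cls_badd.
exact/clsP/teq_scaleDr.
Qed.

Lemma bscaleDl f : {morph bscale^~ f : c d / c + d}.
Proof.
move=> c d; elim/clsW: f => t.
rewrite -[RHS]/(badd _ _) !cls_bscale cls_badd.
exact/clsP/teq_scaleDl.
Qed.

HB.instance Definition _ := GRing.Zmodule_isLmodule.Build k bhomset
  bscaleA bscale1 bscaleDr bscaleDl.

Lemma cls0 : cls (TZero A B) = 0. Proof. by []. Qed.

Lemma clsD t u : cls (TAdd t u) = cls t + cls u.
Proof. by rewrite -[RHS]/(badd _ _) cls_badd. Qed.

Lemma clsZ c t : cls (TScale c t) = c *: cls t.
Proof. by rewrite -[RHS]/(bscale _ _) cls_bscale. Qed.

End Quotient.

Definition bcomp A B E (g : bhomset B E) (f : bhomset A B) : bhomset A E :=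
  cls (TComp (rep g) (rep f)).

Lemma clsM A B E (t : term B E) (u : term A B) :
  cls (TComp t u) = bcomp (cls t) (cls u).
Proof. by apply/clsP/teq_comp; apply: teq_sym; exact: rep_cls. Qed.

Program Definition balanced_tensor : klcat k :=
  @KLCat k fsum (fun A B => bhomset A B : lmodType k)
    (fun A => cls (TId A)) bcomp _ _ _ _ _.
Next Obligation.
move=> A B E F h g f; elim/clsW: h => t; elim/clsW: g => u; elim/clsW: f => v.
by rewrite -!clsM; exact/clsP/teq_compA.
Qed.
Next Obligation. by move=> A B f; elim/clsW: f => t; rewrite -clsM; exact/clsP/teq_comp1m. Qed.
Next Obligation. by move=> A B f; elim/clsW: f => t; rewrite -clsM; exact/clsP/teq_compm1. Qed.
Next Obligation.
move=> A B E f c g g'; elim/clsW: f => u; elim/clsW: g => t; elim/clsW: g' => t'.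
by rewrite -clsZ -clsD -!clsM -clsZ -clsD; exact/clsP/teq_comp_linl.
Qed.
Next Obligation.
move=> A B E g c f f'; elim/clsW: g => u; elim/clsW: f => t; elim/clsW: f' => t'.
by rewrite -clsZ -clsD -!clsM -clsZ -clsD; exact/clsP/teq_comp_linr.
Qed.

Fixpoint all_symbols (S : P -> Prop) (A : fsum) : Prop :=
  match A with
  | Sym p q => S p
  | Zero => True
  | Plus A B => all_symbols S A /\ all_symbols S B
  end.

End Balanced.

Arguments TAlpha {k D P Q} p V q.
Arguments TAlphaI {k D P Q} p V q.
Arguments Zero {k D P Q}.
Arguments balanced_tensor : simpl never.

Section BalancedFacts.
Variables (k : fieldType) (D : moncat k) (P : rmodcat D) (Q : lmodcat D).
Local Notation T := (balanced_tensor P Q).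
Local Notation "[cls t ]" := (cls t : hom (_ : T) (_ : T)).

Lemma clsC A B E (t : term B E) (u : term A B) :
  [cls TComp t u] = [cls t] ∘ [cls u].
Proof. exact: clsM. Qed.

Definition sy p p' q q' (f : hom p p') (g : hom q q') :
  hom (Sym p q : T) (Sym p' q' : T) := cls (TSym f g).
Definition al p V q : hom (Sym (p ◁ V) q : T) (Sym p (V ▷ q) : T) :=
  cls (TAlpha p V q).
Definition ali p V q : hom (Sym p (V ▷ q) : T) (Sym (p ◁ V) q : T) :=
  cls (TAlphaI p V q).
Definition inl_ (A B : T) : hom A (Plus A B : T) := cls (TInl A B).
Definition inr_ (A B : T) : hom B (Plus A B : T) := cls (TInr A B).
Definition prl_ (A B : T) : hom (Plus A B : T) A := cls (TPrl A B).
Definition prr_ (A B : T) : hom (Plus A B : T) B := cls (TPrr A B).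

Lemma sy1 p q : sy (idm p) (idm q) = idm _.
Proof. exact/clsP/teq_sym1. Qed.

Lemma syM p p' p'' q q' q'' (f' : hom p' p'') (f : hom p p')
    (g' : hom q' q'') (g : hom q q') :
  sy (f' ∘ f) (g' ∘ g) = sy f' g' ∘ sy f g.
Proof. by rewrite -clsC; exact/clsP/teq_symM. Qed.

Lemma syMl p p' p'' q q' (f' : hom p' p'') (f : hom p p') (g : hom q q') :
  sy (f' ∘ f) g = sy f' (idm _) ∘ sy f g.
Proof. by rewrite -syM comp1m. Qed.

Lemma sy_linl p p' q q' c (f f' : hom p p') (g : hom q q') :
  sy (c *: f + f') g = c *: sy f g + sy f' g.
Proof. by rewrite -clsZ -clsD; exact/clsP/teq_sym_linl. Qed.

Lemma alK p V q : ali p V q ∘ al p V q = idm _.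
Proof. by rewrite -clsC; exact/clsP/teq_alphaK. Qed.

Lemma alKr p V q : al p V q ∘ ali p V q = idm _.
Proof. by rewrite -clsC; exact/clsP/teq_alphaKr. Qed.

Lemma al_nat p p' V V' q q' (f : hom p p') (u : hom V V') (g : hom q q') :
  al p' V' q' ∘ sy (f ◁h u) g = sy f (u ▷h g) ∘ al p V q.
Proof. by rewrite -!clsC; exact/clsP/teq_alpha_nat. Qed.

Lemma al_assoc p V W q :
  sy (idm p) (lassoc V W q) ∘ (al p (V ⊗ W) q ∘ sy (rassoc p V W) (idm q)) =
  al p V (W ▷ q) ∘ al (p ◁ V) W q.
Proof. by have := clsP (teq_alpha_assoc p V W q); rewrite !clsC. Qed.

Lemma prl_inl A B : prl_ A B ∘ inl_ A B = idm _.
Proof. by rewrite -clsC; exact/clsP/teq_prl_inl. Qed.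
Lemma prr_inr A B : prr_ A B ∘ inr_ A B = idm _.
Proof. by rewrite -clsC; exact/clsP/teq_prr_inr. Qed.
Lemma prl_inr A B : prl_ A B ∘ inr_ A B = 0.
Proof. by rewrite -clsC; exact/clsP/teq_prl_inr. Qed.
Lemma prr_inl A B : prr_ A B ∘ inl_ A B = 0.
Proof. by rewrite -clsC; exact/clsP/teq_prr_inl. Qed.
Lemma inl_prl A B :
  inl_ A B ∘ prl_ A B + inr_ A B ∘ prr_ A B = idm (Plus A B : T).
Proof. by rewrite -!clsC -clsD; exact/clsP/teq_plus. Qed.

Lemma idm_zero : idm (Zero : T) = 0.
Proof. exact/clsP/teq_zero. Qed.

Lemma to_zero (A : T) (f : hom A (Zero : T)) : f = 0.
Proof. by rewrite -[f]comp1m idm_zero comp0m. Qed.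

Lemma zero_eq (A : T) (f g : hom A (Zero : T)) : f = g.
Proof. by rewrite (to_zero f) (to_zero g). Qed.

Lemma from_zero (A : T) (f : hom (Zero : T) A) : f = 0.
Proof. by rewrite -[f]compm1 idm_zero compm0. Qed.

Lemma from_zero_eq (A : T) (f g : hom (Zero : T) A) : f = g.
Proof. by rewrite (from_zero f) (from_zero g). Qed.

Definition dsum (A A' B B' : T) (u : hom A A') (v : hom B B') :
    hom (Plus A B : T) (Plus A' B' : T) :=
  inl_ A' B' ∘ u ∘ prl_ A B + inr_ A' B' ∘ v ∘ prr_ A B.

Lemma prl_dsum A A' B B' (u : hom A A') (v : hom B B') :
  prl_ A' B' ∘ dsum u v = u ∘ prl_ A B.
Proof.
by rewrite compDr !compA prl_inl prl_inr !comp0m addr0 comp1m.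
Qed.

Lemma prr_dsum A A' B B' (u : hom A A') (v : hom B B') :
  prr_ A' B' ∘ dsum u v = v ∘ prr_ A B.
Proof.
by rewrite compDr !compA prr_inl prr_inr !comp0m add0r comp1m.
Qed.

Lemma dsum_inl A A' B B' (u : hom A A') (v : hom B B') :
  dsum u v ∘ inl_ A B = inl_ A' B' ∘ u.
Proof.
by rewrite compDl -!compA prl_inl prr_inl !compm0 addr0 compm1.
Qed.

Lemma dsum_inr A A' B B' (u : hom A A') (v : hom B B') :
  dsum u v ∘ inr_ A B = inr_ A' B' ∘ v.
Proof.
by rewrite compDl -!compA prr_inr prl_inr !compm0 add0r compm1.
Qed.

Lemma dsum1 (A B : T) : dsum (idm A) (idm B) = idm _.
Proof. by rewrite /dsum !compm1 inl_prl. Qed.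

Lemma dsumM A A' A'' B B' B'' (u' : hom A' A'') (u : hom A A')
    (v' : hom B' B'') (v : hom B B') :
  dsum (u' ∘ u) (v' ∘ v) = dsum u' v' ∘ dsum u v.
Proof.
rewrite [X in _ = _ ∘ X]/dsum compDr !compA dsum_inl dsum_inr.
by rewrite /dsum !compA.
Qed.

Lemma dsumM3 A A' A'' A3 B B' B'' B3 (f : hom A'' A3) (u' : hom A' A'')
    (u : hom A A') (g : hom B'' B3) (v' : hom B' B'') (v : hom B B') :
  dsum (f ∘ u' ∘ u) (g ∘ v' ∘ v) = dsum f g ∘ dsum u' v' ∘ dsum u v.
Proof. by rewrite !dsumM. Qed.

Lemma dsum_lin A A' B B' c (u u' : hom A A') (v v' : hom B B') :
  dsum (c *: u + u') (c *: v + v') = c *: dsum u v + dsum u' v'.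
Proof.
rewrite /dsum !comp_linr !comp_linl scalerDr !addrA; congr (_ + _).
by rewrite -!addrA; congr (_ + _); rewrite addrC.
Qed.

Lemma eqhom_sym_fsum p p' q (e : p = p') (e' : (Sym p q : T) = Sym p' q) :
  eqhom e' = sy (eqhom e) (idm q).
Proof. by case: p' / e e' => e'; rewrite eqhom_refl sy1. Qed.

Lemma eqhom_dsum (A A' B B' : T) (e : A = A') (e' : B = B')
    (e'' : (Plus A B : T) = Plus A' B') :
  eqhom e'' = dsum (eqhom e) (eqhom e').
Proof.
by case: A' / e e''; case: B' / e' => e''; rewrite eqhom_refl dsum1.
Qed.

End BalancedFacts.

Section MonFacts.
Variables (k : fieldType) (C : moncat k).
Implicit Types X Y Z V W : C.

Local Notation lam V := (eqhom (munitl V)).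
Local Notation rho V := (eqhom (munitr V)).
Local Notation a := (massoc (m := C)).
Local Notation ai X Y Z := (iinv (massoc (m := C) X Y Z)).

Lemma unitl_faithful V W (f g : hom V W) :
  idm (munit C) ⊗h f = idm (munit C) ⊗h g -> f = g.
Proof.
move=> fg; have := munitl_nat f; rewrite fg munitl_nat => /esym.
move=> /(congr1 (fun h => h ∘ eqhom (esym (munitl V)))).
by rewrite -!compA eqhom_symKr !compm1.
Qed.

Lemma iso_epi (B : klcat k) (E F G : B) (f : iso E F) (g h : hom F G) :
  g ∘ f = h ∘ f -> g = h.
Proof.
by move=> /(congr1 (fun u => u ∘ iinv f)); rewrite -!compA iKr !compm1.
Qed.

Lemma iso_mono (B : klcat k) (E F G : B) (f : iso F G) (g h : hom E F) :
  f ∘ g = f ∘ h -> g = h.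
Proof.
by move=> /(congr1 (fun u => iinv f ∘ u)); rewrite !compA iKl !comp1m.
Qed.

Lemma kelly V W : lam (V ⊗ W) ∘ a (munit C) V W = lam V ⊗h idm W.
Proof.
set I := munit C; apply: unitl_faithful.
apply: (iso_epi (f := iso_comp (a I (I ⊗ V) W)
                        (bhom_iso (mtens C) (a I I V) (iso_id W)))) => /=.
rewrite -[X in X ⊗h _](comp1m (idm I)) bhomM !compA.
rewrite -2!(compA (idm I ⊗h lam _)) -mpentagon.
rewrite compA mtriangle -(bhom1 (mtens C) V W) -massoc_nat.
rewrite -mtriangle -[X in _ ⊗h X](comp1m (idm W)) bhomM compA.
by rewrite massoc_nat.
Qed.

Lemma kelly_inv V W : (lam V ⊗h idm W) ∘ ai (munit C) V W = lam (V ⊗ W).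
Proof. by rewrite -kelly -compA iKr compm1. Qed.

Lemma idl_comp X V V' V'' (f' : hom V' V'') (f : hom V V') :
  idm X ⊗h (f' ∘ f) = (idm X ⊗h f') ∘ (idm X ⊗h f).
Proof. by rewrite -bhomM comp1m. Qed.

Lemma massoc_inv_nat X X' Y Y' Z Z'
    (f : hom X X') (g : hom Y Y') (h : hom Z Z') :
  ai X' Y' Z' ∘ (f ⊗h (g ⊗h h)) = ((f ⊗h g) ⊗h h) ∘ ai X Y Z.
Proof.
apply: (iso_mono (f := a X' Y' Z')); rewrite !compA massoc_nat.
by rewrite iKr comp1m -compA iKr compm1.
Qed.

Lemma pentagon_inv X Y V W :
  a (X ⊗ Y) V W ∘ ((ai X Y V ⊗h idm W) ∘ ai X (Y ⊗ V) W) =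
  ai X Y (V ⊗ W) ∘ (idm X ⊗h a Y V W).
Proof.
apply: (iso_mono (f := a X Y (V ⊗ W))); rewrite !compA mpentagon iKr comp1m.
rewrite -2!compA (compA (_ ⊗h _) (_ ⊗h _)) -bhomM iKr comp1m bhom1 comp1m.
by rewrite -compA iKr compm1.
Qed.

Lemma pentagon_inv2 X Y V W :
  (a X Y V ⊗h idm W) ∘ ai (X ⊗ Y) V W =
  ai X (Y ⊗ V) W ∘ ((idm X ⊗h ai Y V W) ∘ a X Y (V ⊗ W)).
Proof.
apply: (iso_mono (f := a X (Y ⊗ V) W)); rewrite compA [RHS]compA iKr comp1m.
apply: (iso_mono (f := bhom_iso (mtens C) (iso_id X) (a Y V W))) => /=.
rewrite !compA -bhomM iKr !comp1m bhom1 comp1m -mpentagon.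
by rewrite -compA iKr compm1.
Qed.

End MonFacts.

Section InducedAction.
Variables (k : fieldType) (C : moncat k) (P : C -> Prop).
Variables (P1 : P (munit C)) (PM : forall V W, P V -> P W -> P (V ⊗ W)).
Local Notation D := (submoncat P1 PM).
Local Notation R := (regular_rmodcat P1 PM).
Variable Q : lmodcat D.
Local Notation T := (balanced_tensor R Q).
Local Notation a := (massoc (m := C)).
Local Notation ai X Y Z := (iinv (massoc (m := C) X Y Z)).
Implicit Types X Y Z : C.

(* V ⊗ [W, q] = [V ⊗ W, q] *)
Fixpoint act_ob X (A : T) : T :=
  match A with
  | Sym W q => Sym (X ⊗ W : R) q
  | Zero => Zero
  | Plus A B => Plus (act_ob X A) (act_ob X B)
  end.

Fixpoint act_term X (A B : T) (t : term A B) :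
    term (act_ob X A) (act_ob X B) :=
  match t in term A B return term (act_ob X A) (act_ob X B) with
  | TId A => TId _
  | TComp A B E t u => TComp (act_term X t) (act_term X u)
  | TZero A B => TZero _ _
  | TAdd A B t u => TAdd (act_term X t) (act_term X u)
  | TScale A B c t => TScale c (act_term X t)
  | TInl A B => TInl _ _
  | TInr A B => TInr _ _
  | TPrl A B => TPrl _ _
  | TPrr A B => TPrr _ _
  | TSym p p' q q' f g =>
      @TSym k D R Q (X ⊗ p) (X ⊗ p') q q' (idm X ⊗h f) g
  | TAlpha p V q =>
      TComp (@TAlpha k D R Q (X ⊗ p) V q)
        (@TSym k D R Q (X ⊗ (p ⊗ sval V)) ((X ⊗ p) ⊗ sval V) q q
           (ai X p (sval V)) (idm q))
  | TAlphaI p V q =>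
      TComp (@TSym k D R Q ((X ⊗ p) ⊗ sval V) (X ⊗ (p ⊗ sval V)) q q
               (a X p (sval V)) (idm q))
        (@TAlphaI k D R Q (X ⊗ p) V q)
  end.

Definition sx (p p' : C) (q q' : Q) (f : hom p p') (g : hom q q') :
  hom (Sym (p : R) q : T) (Sym (p' : R) q' : T) := @sy k D R Q p p' q q' f g.
Definition ax (p : C) (V : D) (q : Q) :
  hom (Sym (p ⊗ sval V : R) q : T) (Sym (p : R) (V ▷ q) : T) :=
  @al k D R Q p V q.
Definition axi (p : C) (V : D) (q : Q) :
  hom (Sym (p : R) (V ▷ q) : T) (Sym (p ⊗ sval V : R) q : T) :=
  @ali k D R Q p V q.

Lemma sx1 p (q : Q) : sx (idm (p : C)) (idm q) = idm _.
Proof. exact: sy1. Qed.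

Lemma sxM (p p' p'' : C) (q q' q'' : Q) (f' : hom p' p'') (f : hom p p')
    (g' : hom q' q'') (g : hom q q') :
  sx (f' ∘ f) (g' ∘ g) = sx f' g' ∘ sx f g.
Proof. exact: syM. Qed.

Lemma sxMl (p p' p'' : C) (q : Q) (f' : hom p' p'') (f : hom p p') :
  sx (f' ∘ f) (idm q) = sx f' (idm q) ∘ sx f (idm q).
Proof. by rewrite -sxM comp1m. Qed.

Lemma sxMl3 (p p' p'' p3 : C) (q : Q) (h : hom p'' p3) (f' : hom p' p'')
    (f : hom p p') :
  sx (h ∘ f' ∘ f) (idm q) = sx h (idm q) ∘ sx f' (idm q) ∘ sx f (idm q).
Proof. by rewrite !sxMl. Qed.

Lemma sx_linl (p p' : C) (q q' : Q) c (f f' : hom p p') (g : hom q q') :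
  sx (c *: f + f') g = c *: sx f g + sx f' g.
Proof. exact: sy_linl. Qed.

Lemma axK (p : C) V q : axi p V q ∘ ax p V q = idm _.
Proof. exact: alK. Qed.

Lemma axKr (p : C) V q : ax p V q ∘ axi p V q = idm _.
Proof. exact: alKr. Qed.

Lemma ax_nat (p p' : C) (V V' : D) (q q' : Q) (f : hom p p')
    (u : hom (sval V) (sval V')) (g : hom q q') :
  ax p' V' q' ∘ sx (f ⊗h u) g = sx f ((u : hom V V') ▷h g) ∘ ax p V q.
Proof. exact: (@al_nat k D R Q). Qed.

Lemma ax_natl (p p' : C) (V : D) (q : Q) (f : hom p p') :
  ax p' V q ∘ sx (f ⊗h idm (sval V)) (idm q) = sx f (idm _) ∘ ax p V q.
Proof. by rewrite ax_nat; congr (sx _ _ ∘ _); exact: bhom1. Qed.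

Lemma ax_assoc (p : C) (V W : D) (q : Q) :
  sx (idm p) (lassoc V W q) ∘
    (ax p (V ⊗ W) q ∘ sx (a p (sval V) (sval W)) (idm q)) =
  ax p V (W ▷ q) ∘ ax (p ⊗ sval V) W q.
Proof. exact: (@al_assoc k D R Q). Qed.

Definition xal X (p : C) (V : D) q := ax (X ⊗ p) V q ∘ sx (ai X p (sval V)) (idm q).
Definition xali X (p : C) (V : D) q := sx (a X p (sval V)) (idm q) ∘ axi (X ⊗ p) V q.

Lemma xalK X p V q : xali X p V q ∘ xal X p V q = idm _.
Proof.
by rewrite /xali /xal -compA (compA (axi _ _ _)) axK comp1m -sxM iKr comp1m sx1.
Qed.

Lemma xalKr X p V q : xal X p V q ∘ xali X p V q = idm _.
Proof.
rewrite /xali /xal -compA (compA (sx _ _)) -sxM iKl comp1m sx1 comp1m.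
exact: axKr.
Qed.

Lemma xal_nat X (p p' : C) (V V' : D) (q q' : Q) (f : hom p p')
    (u : hom (sval V) (sval V')) (g : hom q q') :
  xal X p' V' q' ∘ sx (idm X ⊗h (f ⊗h u)) g =
  sx (idm X ⊗h f) ((u : hom V V') ▷h g) ∘ xal X p V q.
Proof.
rewrite /xal -compA -sxM comp1m massoc_inv_nat.
by rewrite -[X in sx _ X]compm1 sxM !compA ax_nat.
Qed.

Lemma xal_assoc X (p : C) (V W : D) (q : Q) :
  sx (idm X ⊗h idm p) (lassoc V W q) ∘
    (xal X p (V ⊗ W) q ∘ sx (idm X ⊗h a p (sval V) (sval W)) (idm q)) =
  xal X p V (W ▷ q) ∘ xal X (p ⊗ sval V) W q.
Proof.
rewrite /xal -!compA (compA (sx (ai X p (sval V)) _)) -ax_natl.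
rewrite !compA -ax_assoc bhom1.
rewrite -!compA -!sxMl; congr (_ ∘ (_ ∘ _)); congr (sx _ _).
by rewrite pentagon_inv.
Qed.

Lemma act_teq X (A B : T) (t u : term A B) :
  teq t u -> teq (act_term X t) (act_term X u).
Proof.
elim=> {A B t u} /=; try by [constructor].
- by move=> A B t u v _ tu _ uv; exact: teq_trans tu uv.
- by move=> p q; rewrite bhom1; exact: teq_sym1.
- move=> p p' p'' q q' q'' f' f g' g.
  by rewrite (idl_comp X f' f); exact: teq_symM.
- by move=> *; rewrite bhom_linr; exact: teq_sym_linl.
- by move=> p V q; apply: cls_inj; rewrite !clsC; exact: xalK.
- by move=> p V q; apply: cls_inj; rewrite !clsC; exact: xalKr.
- move=> p p' V V' q q' f u g; apply: cls_inj; rewrite !clsC.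
  exact: (xal_nat X f u g).
- move=> p V W q; apply: cls_inj; rewrite !clsC; exact: (xal_assoc X p V W q).
Qed.

Definition act_hom X (A B : T) (f : hom A B) : hom (act_ob X A) (act_ob X B) :=
  cls (act_term X (rep f)).

Lemma act_cls X (A B : T) (t : term A B) :
  act_hom X (cls t : hom A B) = cls (act_term X t).
Proof. by apply/clsP/act_teq; exact: rep_cls. Qed.

Lemma act_hom1 X (A : T) : act_hom X (idm A) = idm (act_ob X A).
Proof. exact: act_cls. Qed.

Lemma act_homM X (A B E : T) (g : hom B E) (f : hom A B) :
  act_hom X (g ∘ f) = act_hom X g ∘ act_hom X f.
Proof.
elim/clsW: g => t; elim/clsW: f => u.
rewrite -clsC !act_cls; exact: clsC.
Qed.

Lemma act_hom_lin X (A B : T) c (f g : hom A B) :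
  act_hom X (c *: f + g) = c *: act_hom X f + act_hom X g.
Proof.
elim/clsW: g => t; elim/clsW: f => u.
by rewrite -clsZ -clsD !act_cls /= clsD clsZ.
Qed.

Lemma act_inl X A B : act_hom X (inl_ A B) = inl_ _ _.
Proof. exact: act_cls. Qed.
Lemma act_inr X A B : act_hom X (inr_ A B) = inr_ _ _.
Proof. exact: act_cls. Qed.
Lemma act_prl X A B : act_hom X (prl_ A B) = prl_ _ _.
Proof. exact: act_cls. Qed.
Lemma act_prr X A B : act_hom X (prr_ A B) = prr_ _ _.
Proof. exact: act_cls. Qed.
Lemma act_sx X (p p' : C) (q q' : Q) (f : hom p p') (g : hom q q') :
  act_hom X (sx f g) = sx (idm X ⊗h f) g.
Proof. exact: act_cls. Qed.
Lemma act_ax X (p : C) V q : act_hom X (ax p V q) = xal X p V q.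
Proof. by rewrite act_cls /= clsC. Qed.

Lemma act_dsum X (A A' B B' : T) (u : hom A A') (v : hom B B') :
  act_hom X (dsum u v) = dsum (act_hom X u) (act_hom X v).
Proof.
rewrite /dsum -[inl_ _ _ ∘ u ∘ _]scale1r act_hom_lin scale1r !act_homM.
by rewrite act_inl act_inr act_prl act_prr.
Qed.

Fixpoint act_mor X X' (f : hom X X') (A : T) : hom (act_ob X A) (act_ob X' A) :=
  match A with
  | Sym p q => sx (f ⊗h idm (p : C)) (idm q)
  | Zero => 0
  | Plus A B => dsum (act_mor f A) (act_mor f B)
  end.

Lemma act_mor1 X (A : T) : act_mor (idm X) A = idm (act_ob X A).
Proof.
elim: A => [p q||A IHA B IHB] /=; first by rewrite bhom1 sx1.
  exact: zero_eq.
by rewrite IHA IHB dsum1.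
Qed.

Lemma act_morM X X' X'' (f' : hom X' X'') (f : hom X X') (A : T) :
  act_mor (f' ∘ f) A = act_mor f' A ∘ act_mor f A.
Proof.
elim: A => [p q||A IHA B IHB] /=; last by rewrite IHA IHB dsumM.
  by rewrite -[RHS]sxMl -bhomM comp1m.
exact: zero_eq.
Qed.

Lemma act_mor_lin X X' c (f f' : hom X X') (A : T) :
  act_mor (c *: f + f') A = c *: act_mor f A + act_mor f' A.
Proof.
elim: A => [p q||A IHA B IHB] /=; last by rewrite IHA IHB dsum_lin.
  by rewrite bhom_linl sx_linl.
exact: zero_eq.
Qed.

(* Families of morphisms indexed by the objects of T and compatible with formal
   sums are natural as soon as they are so with respect to the generators. *)
Section NatInd.
Variables (F G : T -> T) (Fh : forall A B : T, hom A B -> hom (F A) (F B))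
  (Gh : forall A B : T, hom A B -> hom (G A) (G B)).
Variable theta : forall A : T, hom (F A) (G A).
Hypotheses
  (Fh1 : forall A, Fh (idm A) = idm _) (Gh1 : forall A, Gh (idm A) = idm _)
  (FhM : forall (A B E : T) (g : hom B E) (f : hom A B), Fh (g ∘ f) = Fh g ∘ Fh f)
  (GhM : forall (A B E : T) (g : hom B E) (f : hom A B), Gh (g ∘ f) = Gh g ∘ Gh f)
  (Fhl : forall (A B : T) c (f g : hom A B), Fh (c *: f + g) = c *: Fh f + Fh g)
  (Ghl : forall (A B : T) c (f g : hom A B), Gh (c *: f + g) = c *: Gh f + Gh g).
Local Notation nat A B f := (theta B ∘ Fh (f : hom A B) = Gh f ∘ theta A).
Hypotheses
  (nl : forall A B : T, nat A (Plus A B : T) (inl_ A B))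
  (nr : forall A B : T, nat B (Plus A B : T) (inr_ A B))
  (npl : forall A B : T, nat (Plus A B : T) A (prl_ A B))
  (npr : forall A B : T, nat (Plus A B : T) B (prr_ A B))
  (nsy : forall (p p' : C) (q q' : Q) (f : hom p p') (g : hom q q'),
     nat _ _ (sx f g))
  (nal : forall (p : C) V q, nat _ _ (ax p V q)).

Lemma nat_ind_cls (A B : T) (f : hom A B) : nat A B f.
Proof.
elim/clsW: f.
have F0 (E E' : T) : Fh (0 : hom E E') = 0.
  have := Fhl 1 (0 : hom E E') 0; rewrite !scale1r addr0 => /esym/eqP.
  by rewrite -[X in _ == X]addr0 (inj_eq (addrI _)) => /eqP.
have G0 (E E' : T) : Gh (0 : hom E E') = 0.
  have := Ghl 1 (0 : hom E E') 0; rewrite !scale1r addr0 => /esym/eqP.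
  by rewrite -[X in _ == X]addr0 (inj_eq (addrI _)) => /eqP.
elim=> {A B}.
- by move=> A; rewrite -[cls _]/(idm (A : T)) Fh1 Gh1 comp1m compm1.
- move=> A B E t IHt u IHu.
  by rewrite clsC FhM GhM compA IHt -compA IHu compA.
- by move=> A B; rewrite cls0 F0 G0 compm0 comp0m.
- move=> A B t IHt u IHu; rewrite clsD -[cls t]scale1r Fhl Ghl comp_linr.
  by rewrite comp_linl IHt IHu.
- move=> A B c t IHt; rewrite clsZ -[c *: _]addr0 Fhl Ghl F0 G0 !addr0.
  by rewrite compZr compZl IHt.
- exact: nl.
- exact: nr.
- exact: npl.
- exact: npr.
- exact: nsy.
- exact: nal.
- move=> p V q.
  rewrite -[cls _]/(axi p V q).
  rewrite -[LHS]comp1m -(Gh1 (Sym (p ⊗ sval V : R) q)) -axK GhM.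
  rewrite -!compA (compA (Gh (ax _ _ _))) -nal -!compA -FhM axKr Fh1.
  by rewrite compm1.
Qed.
End NatInd.

Lemma act_mor_nat X X' (f : hom X X') (A B : T) (g : hom A B) :
  act_mor f B ∘ act_hom X g = act_hom X' g ∘ act_mor f A.
Proof.
pose th (A : T) := act_mor f A.
apply: (@nat_ind_cls (act_ob X) (act_ob X') (act_hom X) (act_hom X') th);
  rewrite {}/th => //.
- exact: act_hom1.
- exact: act_hom1.
- exact: act_homM.
- exact: act_homM.
- exact: act_hom_lin.
- exact: act_hom_lin.
- by move=> E F; rewrite !act_inl; exact: dsum_inl.
- by move=> E F; rewrite !act_inr; exact: dsum_inr.
- by move=> E F; rewrite !act_prl; symmetry; exact: prl_dsum.
- by move=> E F; rewrite !act_prr; symmetry; exact: prr_dsum.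
- move=> p p' q q' h g'; rewrite !act_sx.
  by rewrite -[LHS]sxM -[RHS]sxM -!bhomM !comp1m !compm1.
- move=> p V q; rewrite !act_ax /xal.
  rewrite -[act_mor f _]/(sx (f ⊗h idm (p : C)) (idm (V ▷ q))).
  rewrite -[act_mor f _]/(sx (f ⊗h idm (p ⊗ sval V : C)) (idm q)).
  rewrite -[RHS]compA -sxMl.
  by rewrite -(bhom1 (mtens C) p (sval V)) massoc_inv_nat sxMl [RHS]compA ax_natl compA.
Qed.

Program Definition induced_bifun : klbifun C T T :=
  @KLBifun k C T T act_ob
    (fun X X' A B f g => act_mor f B ∘ act_hom X g) _ _ _ _.
Next Obligation. by move=> X A; cbv beta; rewrite act_mor1 act_hom1 comp1m. Qed.
Next Obligation.
move=> X X' X'' A B E f' f g' g; cbv beta.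
rewrite act_morM act_homM -!compA; congr (_ ∘ _).
by rewrite !compA act_mor_nat.
Qed.
Next Obligation. by move=> *; cbv beta; rewrite act_mor_lin comp_linl. Qed.
Next Obligation. by move=> *; cbv beta; rewrite act_hom_lin comp_linr. Qed.

Fixpoint act_assoc X Y (A : T) :
    hom (act_ob (X ⊗ Y) A) (act_ob X (act_ob Y A)) :=
  match A with
  | Sym p q => sx (a X Y (p : C)) (idm q)
  | Zero => 0
  | Plus A B => dsum (act_assoc X Y A) (act_assoc X Y B)
  end.

Fixpoint act_associ X Y (A : T) :
    hom (act_ob X (act_ob Y A)) (act_ob (X ⊗ Y) A) :=
  match A with
  | Sym p q => sx (ai X Y (p : C)) (idm q)
  | Zero => 0
  | Plus A B => dsum (act_associ X Y A) (act_associ X Y B)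
  end.

Lemma act_assocK X Y A : act_associ X Y A ∘ act_assoc X Y A = idm _.
Proof.
elim: A => [p q||A IHA B IHB]; last by rewrite -[LHS]dsumM IHA IHB dsum1.
  by rewrite -[LHS]sxMl iKl sx1.
exact: zero_eq.
Qed.

Lemma act_assocKr X Y A : act_assoc X Y A ∘ act_associ X Y A = idm _.
Proof.
elim: A => [p q||A IHA B IHB]; last by rewrite -[LHS]dsumM IHA IHB dsum1.
  by rewrite -[LHS]sxMl iKr sx1.
exact: zero_eq.
Qed.

Definition induced_assoc X Y A :=
  Iso (act_assocK X Y A) (act_assocKr X Y A).

Lemma act_assoc_natr X Y (A B : T) (h : hom A B) :
  act_assoc X Y B ∘ act_hom (X ⊗ Y) h =
  act_hom X (act_hom Y h) ∘ act_assoc X Y A.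
Proof.
pose th A := act_assoc X Y A.
apply: (@nat_ind_cls (act_ob (X ⊗ Y)) (fun A => act_ob X (act_ob Y A))
  (act_hom (X ⊗ Y)) (fun A B h => act_hom X (act_hom Y h)) th);
  rewrite {}/th.
- exact: act_hom1.
- by move=> E; rewrite !act_hom1.
- exact: act_homM.
- by move=> *; rewrite !act_homM.
- exact: act_hom_lin.
- by move=> *; rewrite !act_hom_lin.
- by move=> E F; rewrite !act_inl; exact: dsum_inl.
- by move=> E F; rewrite !act_inr; exact: dsum_inr.
- by move=> E F; rewrite !act_prl; symmetry; exact: prl_dsum.
- by move=> E F; rewrite !act_prr; symmetry; exact: prr_dsum.
- move=> p p' q q' f g; rewrite !act_sx.
  rewrite -[LHS]sxM -[RHS]sxM comp1m compm1 -(bhom1 (mtens C)).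
  by rewrite massoc_nat.
- move=> p V q; rewrite !act_ax act_homM act_ax act_sx /xal.
  rewrite -[act_assoc X Y _]/(sx (a X Y (p : C)) (idm (V ▷ q))).
  rewrite -[act_assoc X Y _]/(sx (a X Y (p ⊗ sval V : C)) (idm q)).
  rewrite [LHS]compA -ax_natl -[LHS]compA -sxMl pentagon_inv2.
  by rewrite !sxMl !compA.
Qed.

Lemma act_assoc_natl X X' Y Y' (f : hom X X') (g : hom Y Y') (A : T) :
  act_assoc X' Y' A ∘ act_mor (f ⊗h g) A =
  act_mor f (act_ob Y' A) ∘ act_hom X (act_mor g A) ∘ act_assoc X Y A.
Proof.
elim: A => [p q||A IHA B IHB].
- rewrite -[act_mor g _]/(sx (g ⊗h idm (p : C)) (idm q)) act_sx.
  rewrite -[LHS]sxMl -[RHS]sxMl3 massoc_nat.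
  by rewrite -bhomM comp1m compm1.
- exact: from_zero_eq.
- rewrite -[act_mor g _]/(dsum (act_mor g A) (act_mor g B)) act_dsum.
  by rewrite -[LHS]dsumM -[RHS]dsumM3 IHA IHB.
Qed.

Lemma act_pentagon X Y Z (A : T) :
  act_assoc X Y (act_ob Z A) ∘ act_assoc (X ⊗ Y) Z A =
  act_hom X (act_assoc Y Z A) ∘ act_assoc X (Y ⊗ Z) A
    ∘ act_mor (a X Y Z) A.
Proof.
elim: A => [p q||A IHA B IHB].
- rewrite -[act_assoc Y Z _]/(sx (a Y Z (p : C)) (idm q)) act_sx.
  by rewrite -[LHS]sxMl -[RHS]sxMl3 mpentagon.
- exact: from_zero_eq.
- rewrite -[act_assoc Y Z _]/(dsum (act_assoc Y Z A) (act_assoc Y Z B)) act_dsum.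
  by rewrite -[LHS]dsumM -[RHS]dsumM3 IHA IHB.
Qed.

Lemma act_unit (A : T) : act_ob (munit C) A = A.
Proof.
by elim: A => [p q||A IHA B IHB] //=; [rewrite munitl | rewrite IHA IHB].
Qed.

Lemma act_unit_nat (A B : T) (h : hom A B) :
  eqhom (act_unit B) ∘ act_hom (munit C) h = h ∘ eqhom (act_unit A).
Proof.
have e1 (p : C) q : eqhom (act_unit (Sym (p : R) q)) =
    sx (eqhom (munitl p)) (idm q).
  exact: (@eqhom_sym_fsum k D R Q).
have e2 A1 A2 : eqhom (act_unit (Plus A1 A2)) =
    dsum (eqhom (act_unit A1)) (eqhom (act_unit A2)).
  exact: eqhom_dsum.
apply: (@nat_ind_cls (act_ob (munit C)) id (act_hom (munit C)) (fun A B h => h)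
  (fun A => eqhom (act_unit A))) => //.
- exact: act_hom1.
- exact: act_homM.
- exact: act_hom_lin.
- by move=> E F; rewrite e2 act_inl; exact: dsum_inl.
- by move=> E F; rewrite e2 act_inr; exact: dsum_inr.
- by move=> E F; rewrite e2 act_prl; symmetry; exact: prl_dsum.
- by move=> E F; rewrite e2 act_prr; symmetry; exact: prr_dsum.
- move=> p p' q q' f g; rewrite !e1 act_sx.
  by rewrite -[LHS]sxM -[RHS]sxM comp1m compm1 munitl_nat.
- move=> p V q; rewrite !e1 act_ax /xal.
  by rewrite [LHS]compA -ax_natl -[LHS]compA -sxMl kelly_inv.
Qed.

Program Definition induced_lmodcat : lmodcat C :=
  @LModCat k C T induced_bifun induced_assoc _ _ act_unit _.
Next Obligation.
move=> X X' Y Y' A B f g h.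
rewrite -[X in _ ∘ X]/(act_mor (f ⊗h g) B ∘ act_hom (X ⊗ Y) h).
rewrite -[X in _ = X ∘ _]/(act_mor f (act_ob Y' B) ∘
  act_hom X (act_mor g B ∘ act_hom Y h)).
rewrite -[ihom (induced_assoc X' Y' B)]/(act_assoc X' Y' B).
rewrite -[ihom (induced_assoc X Y A)]/(act_assoc X Y A).
by rewrite [LHS]compA act_assoc_natl act_homM -!compA act_assoc_natr.
Qed.
Next Obligation.
move=> X Y Z A.
rewrite -[bhom induced_bifun (a X Y Z) _]/(act_mor (a X Y Z) A ∘ act_hom _ _).
rewrite -[bhom induced_bifun (idm X) _]/(act_mor (idm X) _ ∘
  act_hom X (act_assoc Y Z A)).
rewrite act_hom1 compm1 act_mor1 comp1m; exact: act_pentagon.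
Qed.
Next Obligation.
move=> A B f; rewrite -[bhom _ _ _]/(act_mor (idm _) B ∘ act_hom _ f).
by rewrite act_mor1 comp1m; exact: act_unit_nat.
Qed.

End InducedAction.

(* The full subcategory ⊕_{i ∈ S} C_i. *)
Definition graded_sum (k : fieldType) (C : klcat k) (I : Type)
    (deg : I -> C -> Prop) (S : I -> Prop) (V : C) : Prop :=
  exists (J : finType) (A : J -> C),
    (forall j, exists i, S i /\ deg i (A j)) /\ is_biproduct A V.

(* C is the direct sum of the full abelian subcategories C_i; as usual, these
   are taken to be closed under isomorphism. *)
Definition is_grading (k : fieldType) (C : klcat k) (I : Type)
    (deg : I -> C -> Prop) : Prop :=
  [/\ forall i A B, isomorphic A B -> deg i A -> deg i B,
      forall i, is_abelian (fullsub (deg i)),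
      forall i j A B, i <> j -> deg i A -> deg j B -> forall f : hom A B, f = 0
    & forall V, graded_sum deg (fun=> True) V].

Record graded_tensor_category (k : fieldType) (G : groupType) :=
    GradedTensorCategory {
  gt_cat :> moncat k;
  gt_tensor : is_tensor_category gt_cat;
  gt_deg : G -> gt_cat -> Prop;
  gt_grading : is_grading gt_deg;
  gt_mul : forall s t V W,
    gt_deg s V -> gt_deg t W -> gt_deg (s * t)%g (V ⊗ W) }.

(* Objects of C_{st} which are direct sums of objects V ⊗ W with V in C_s and
   W in C_t. *)
Definition sum_of_products (k : fieldType) (G : groupType)
    (C : graded_tensor_category k G) (s t : G)
    (U : fullsub (gt_deg (g := C) (s * t)%g)) : Prop :=
  exists (J : finType) (V W : J -> C),
    (forall j, gt_deg s (V j) /\ gt_deg t (W j)) /\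
    is_biproduct (fun j => V j ⊗ W j) (sval U).

Definition is_strongly_graded (k : fieldType) (G : groupType)
    (C : graded_tensor_category k G) : Prop :=
  forall s t : G, is_equivalence (fullsub_incl (@sum_of_products k G C s t)).

Record gset (G : groupType) := GSet {
  gs_set :> Type;
  gs_act : G -> gs_set -> gs_set;
  gs_act1 : forall x, gs_act 1%g x = x;
  gs_actM : forall s t x, gs_act (s * t)%g x = gs_act s (gs_act t x) }.

Definition is_transitive (G : groupType) (X : gset G) : Prop :=
  forall x y : X, exists s, gs_act s x = y.

Definition stab (G : groupType) (X : gset G) (x : X) (s : G) : Prop :=
  gs_act s x = x.

Definition lcoset_stab (G : groupType) (X : gset G) (x : X) (s t : G) : Prop :=
  exists h, stab x h /\ t = (s * h)%g.

Record graded_lmodcat (k : fieldType) (G : groupType)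
    (C : graded_tensor_category k G) (X : gset G) := GradedLModCat {
  gl_mod :> lmodcat C;
  gl_deg : X -> gl_mod -> Prop }.

Definition is_graded_module_category (k : fieldType) (G : groupType)
    (C : graded_tensor_category k G) (X : gset G) (M : graded_lmodcat C X) :
    Prop :=
  [/\ is_module_category M, is_grading (gl_deg (g := M))
    & forall s x V A, gt_deg s V -> gl_deg x A ->
        gl_deg (g := M) (gs_act s x) (V ▷ A)].

Record graded_module_category (k : fieldType) (G : groupType)
    (C : graded_tensor_category k G) (X : gset G) := GradedModuleCategory {
  gm_data :> graded_lmodcat C X;
  gm_axioms : is_graded_module_category gm_data }.

Record graded_modfun (k : fieldType) (G : groupType)
    (C : graded_tensor_category k G) (X : gset G) (M N : graded_lmodcat C X) :=
    GradedModFun {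
  gf_fun :> modfun M N;
  gf_deg : forall (x : X) (A : M), gl_deg x A -> gl_deg x (gf_fun A) }.

Definition graded_equivalent (k : fieldType) (G : groupType)
    (C : graded_tensor_category k G) (X : gset G) (M N : graded_lmodcat C X) :
    Prop :=
  exists F : graded_modfun M N, is_equivalence F.

Section Stabilizer.
Variables (k : fieldType) (G : groupType) (C : graded_tensor_category k G).

Lemma unit_deg : gt_deg (g := C) 1%g (munit C).
Proof.
have [repl _ hom0 dec] := gt_grading C.
have [_ _ [e [e0 eP]]] := gt_tensor C.
have [I [A [degA [i [p [pi _ ip]]]]]] := dec (munit C).
have id0 : idm (munit C) <> 0.
  by move=> id0; apply: e0; rewrite -[e]comp1m id0 comp0m.
have [j ij0] : exists j, i j ∘ p j <> 0.
  apply: contrapT => /forallNP ij; apply: id0; rewrite -ip big1 // => j _.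
  exact: contrapT (ij j).
have [u uP] : exists u, i j ∘ p j = u *: idm (munit C).
  have [c idE] := eP (idm _); have [d ijE] := eP (i j ∘ p j).
  exists (d / c); rewrite ijE idE scalerA divfK //.
  by apply: contra_notN id0 => /eqP c0; rewrite idE c0 scale0r.
have u0 : u != 0.
  by apply: contra_notN ij0 => /eqP u0; rewrite uP u0 scale0r.
have ijK : i j ∘ p j = idm _.
  have : (i j ∘ p j) ∘ (i j ∘ p j) = i j ∘ p j.
    by rewrite compA -(compA (i j)) pi compm1.
  by rewrite {1}uP compZl comp1m [X in _ = X]uP => /(scalerI u0).
have [s [_ degs]] := degA j.
have deg1 : gt_deg s (munit C).
  by apply: repl degs; constructor; exists (i j) (p j).
have deg2 : gt_deg (s * s)%g (munit C).
  by have := gt_mul deg1 deg1; rewrite munitl.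
suff <- : s = 1%g by [].
apply: contrapT => s1; apply: id0.
apply: (hom0 (s * s)%g s) => // ss; apply: s1.
by apply: (mulgI s); rewrite mulg1.
Qed.

Lemma graded_sum_iso (D : klcat k) (I : Type) (deg : I -> D -> Prop) S A B :
  isomorphic A B -> graded_sum deg S A -> graded_sum deg S B.
Proof.
by move=> AB [J [E [h bip]]]; exists J, E; split => //; exact: biproduct_iso bip.
Qed.

Lemma graded_sum1 (D : klcat k) (I : Type) (deg : I -> D -> Prop)
    (S : I -> Prop) i A :
  S i -> deg i A -> graded_sum deg S A.
Proof.
move=> Si Ai; exists unit, (fun=> A); split; first by move=> _; exists i.
exists (fun=> idm A), (fun=> idm A); split; first by move=> _; exact: comp1m.
  by move=> [] [].
by rewrite big_const card_unit /= comp1m addr0.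
Qed.

Variables (X : gset G) (x : X).

Lemma stab_unit : graded_sum (gt_deg (g := C)) (stab x) (munit C).
Proof. by apply: graded_sum1 unit_deg; exact: gs_act1. Qed.

Lemma stab_tensor (V W : C) :
  graded_sum (gt_deg (g := C)) (stab x) V ->
  graded_sum (gt_deg (g := C)) (stab x) W ->
  graded_sum (gt_deg (g := C)) (stab x) (V ⊗ W).
Proof.
move=> [I [A [hA bA]]] [J [B [hB bB]]].
exists (I * J)%type, (fun y => A y.1 ⊗ B y.2); split; last exact: bifun_biproduct.
move=> [i j] /=; have [s [sx sA]] := hA i; have [t [tx tB]] := hB j.
exists (s * t)%g; split; last exact: gt_mul.
by rewrite /stab gs_actM tx sx.
Qed.

(* C_H, for H = st(x). *)
Definition stab_cat : moncat k := submoncat stab_unit stab_tensor.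

Variable M : graded_module_category C X.

Lemma stab_act (V : C) (A : M) :
  graded_sum (gt_deg (g := C)) (stab x) V -> gl_deg x A -> gl_deg x (V ▷ A).
Proof.
move=> [I [B [hB bB]]] xA; have [_ [repl ab _ _] mul] := gm_axioms M.
apply: (abelian_biproduct_closed (P := gl_deg x)
  (A := fun y : I * unit => B y.1 ▷ A)).
- exact: repl.
- exact: ab.
- move=> [i []] /=; have [s [sx sB]] := hB i.
  by rewrite -sx; exact: mul.
- apply: (bifun_biproduct (lact M) bB (b := fun=> A)).
  exists (fun=> idm A), (fun=> idm A); split; first by move=> _; exact: comp1m.
    by move=> [] [].
  by rewrite big_const card_unit /= comp1m addr0.
Qed.

Definition component : lmodcat stab_cat :=
  sublmodcat stab_unit stab_tensor stab_act.

(* C ⊠_{C_H} M_x; its component of degree s x is (⊕_{t ∈ sH} C_t) ⊠_{C_H} M_x,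
   the (replete) full subcategory of the formal sums of symbols [V, A] with V in
   ⊕_{t ∈ sH} C_t. *)
Definition induced : graded_lmodcat C X :=
  @GradedLModCat k G C X (induced_lmodcat component)
    (fun y A => exists s, gs_act s x = y /\
       exists B : induced_lmodcat component,
         isomorphic A B /\
         all_symbols (P := regular_rmodcat stab_unit stab_tensor)
           (graded_sum (gt_deg (g := C)) (lcoset_stab x s)) B).

End Stabilizer.

(* Main.v *)
(* Write [U, A] for the symbols of C ⊠_{C_H} M_x and let Φ be the functor to M
   sending [U, A] to U ⊗ A.  Strong grading and End(1) = k give, for every s in
   G, objects V in C_s and W in C_{s^-1} with V ⊗ W ≅ 1: the unit is a direct sum
   of such products, and it is indecomposable.  With e the idempotent of an
   object U cutting out its part in C_H, and π the projection of M to M_x,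
       [U, A] -> [U_H, A] ≅ [1, U_H ⊗ A] ≅ [1, π(U ⊗ A)]
   is natural and has a section, the composite being [e, id].  Conjugating with
   X ≅ V ⊗ (W ⊗ X), for V and W of degrees carrying x to y and back, one gets
   natural maps a_y, b_y between X and V ⊗ [1, π(W ⊗ Φ X)] such that b_y a_y is
   the projection to the part of degree y.  As the identity of X is a finite sum
   of the b_y a_y and V ⊗ [1, π(W ⊗ -)] is defined on M, Φ is fully faithful; it
   is essentially surjective because B ≅ V ⊗ (W ⊗ B).  All properties of M
   transfer along Φ, and a quasi-inverse E of Φ is a module functor.

   For (2), restriction of graded module functors to M_x is inverted, up to
   isomorphism, by T |-> Ψ ∘ E where Ψ [U, A] = U ⊗ T A.  The functor Ψ ∘ E is a
   locally finite retract of the exact functors V ⊗ T(π(W ⊗ -)), hence exact.  A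
   module functor F on M is determined by its restriction since F Φ [U, A] is
   naturally U ⊗ F A. *)

From mathcomp Require Import all_boot all_algebra monoid boolp.
Require Import Defs.

Set Implicit Arguments.
Unset Strict Implicit.
Unset Printing Implicit Defensive.

Import GRing.Theory.
Local Open Scope ring_scope.

(** * Functors, kernels and exactness *)

(** Morphisms of C ⊠_{C_H} M_x are classes of formal terms without a normal form, so full
    faithfulness of Φ cannot be read off from the presentation. It comes from one formula: f = Σ_y
    b_y ∘ K_y(Φ f) ∘ a_y for f : A → B, where K_y = V ⊗ [1, π(W ⊗ -)] starts from M. Faithfulness is
    immediate. For fullness an arbitrary g : Φ A → Φ B takes the place of Φ f, and then Φ(b_y) has
    to be natural for every such g. It is, because Φ carries the section of [U, A] -> [1, π(U ⊗ A)]
    to the inclusion of π, up to a unit constraint, and both are natural on all of M. Three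
    obstacles shape the rest. The unit constraint of a module category is not assumed to satisfy the
    triangle axiom, and is corrected before X ≅ V ⊗ (W ⊗ X) is built. X may be infinite, so the sums
    run over finite sets of y that depend on the object. Nothing says in advance that C ⊠_{C_H} M_x
    is abelian, so functors out of it are first built without exactness. *)

Section LinearFunctors.
Variables (k : fieldType) (A B : klcat k) (F : klfun A B).

Lemma fhom0 (a b : A) : fhom F (0 : hom a b) = 0.
Proof.
have := fhom_lin F 1 (0 : hom a b) 0; rewrite !scale1r addr0 => /esym/eqP.
by rewrite -[X in _ == X]addr0 (inj_eq (addrI _)) => /eqP.
Qed.

Lemma fhomD (a b : A) (f g : hom a b) : fhom F (f + g) = fhom F f + fhom F g.
Proof. by have := fhom_lin F 1 f g; rewrite !scale1r. Qed.

Lemma fhomZ (a b : A) c (f : hom a b) : fhom F (c *: f) = c *: fhom F f.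
Proof. by rewrite -[c *: f]addr0 fhom_lin fhom0 addr0. Qed.

Lemma fhom_sum (I : Type) (r : seq I) (a b : A) (f : I -> hom a b) :
  fhom F (\sum_(i <- r) f i) = \sum_(i <- r) fhom F (f i).
Proof.
apply: (big_rec2 (fun x y => fhom F x = y)); first exact: fhom0.
by move=> i x y _ <-; rewrite fhomD.
Qed.

Definition fhom_iso (a b : A) (f : iso a b) : iso (F a) (F b).
Proof.
by exists (fhom F f) (fhom F (iinv f)); rewrite -fhomM ?iKl ?iKr fhom1.
Defined.

Definition is_full := forall a b (g : hom (F a) (F b)), exists f, fhom F f = g.
Definition is_faithful :=
  forall a b (f f' : hom a b), fhom F f = fhom F f' -> f = f'.
Definition is_esurj := forall b, exists a, isomorphic (F a) b.

Lemma fhom_kernel_reflect (a b c : A) (p : hom b c) (i : hom a b) :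
  is_full -> is_faithful -> is_kernel (fhom F p) (fhom F i) -> is_kernel p i.
Proof.
move=> full faith [pi0 uni]; split.
  by apply: faith; rewrite fhomM pi0 fhom0.
move=> z g pg0; have /uni[u [iu uu]] : fhom F p ∘ fhom F g = 0.
  by rewrite -fhomM pg0 fhom0.
have [v vu] := full _ _ u; exists v; split.
  by apply: faith; rewrite fhomM vu.
move=> w iw; apply: faith; rewrite vu; apply: uu.
by rewrite -fhomM iw.
Qed.

(** Essential surjectivity replaces an arbitrary test object by one in the image of [F], and
    fullness then lifts the test morphism. *)
Lemma fhom_kernel (a b c : A) (p : hom b c) (i : hom a b) :
  is_full -> is_faithful -> is_esurj -> is_kernel p i ->
  is_kernel (fhom F p) (fhom F i).
Proof.
move=> full faith esurj [pi0 uni]; split; first by rewrite -fhomM pi0 fhom0.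
move=> z g pg0; have [z0 [t]] := esurj z.
have [g0 g0E] := full _ _ (g ∘ t).
have /uni[u [iu uu]] : p ∘ g0 = 0.
  by apply: faith; rewrite fhomM g0E compA pg0 comp0m fhom0.
exists (fhom F u ∘ iinv t); split.
  by rewrite compA -fhomM iu g0E -compA iKr compm1.
move=> w iw; have [w0 w0E] := full _ _ (w ∘ t).
rewrite (uu w0); first by rewrite w0E -compA iKr compm1.
by apply: faith; rewrite fhomM w0E compA iw g0E.
Qed.

Lemma biproduct_reflect (I : finType) (a : I -> A) (s : A) :
  is_full -> is_faithful -> is_biproduct (fun i => F (a i)) (F s) ->
  is_biproduct a s.
Proof.
move=> full faith [i [p [pi p0 ip]]].
pose i' j := projT1 (cid (full _ _ (i j))).
pose p' j := projT1 (cid (full _ _ (p j))).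
have i'E j : fhom F (i' j) = i j := projT2 (cid (full _ _ (i j))).
have p'E j : fhom F (p' j) = p j := projT2 (cid (full _ _ (p j))).
exists i', p'; split.
- by move=> j; apply: faith; rewrite fhomM i'E p'E pi fhom1.
- by move=> j l jl; apply: faith; rewrite fhomM i'E p'E p0 // fhom0.
- apply: faith; rewrite fhom_sum fhom1 -ip; apply: eq_bigr => j _.
  by rewrite fhomM i'E p'E.
Qed.

(** The equation belongs to the conclusion because the lifted isomorphisms are later computed with
    only through their images under [F]. *)
Lemma fhom_iso_lift (a b : A) (t : iso (F a) (F b)) :
  is_full -> is_faithful -> exists t' : iso a b, fhom F t' = t.
Proof.
move=> full faith; have [f fE] := full _ _ t; have [g gE] := full _ _ (iinv t).
have gf : g ∘ f = idm a by apply: faith; rewrite fhomM fE gE iKl fhom1.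
have fg : f ∘ g = idm b by apply: faith; rewrite fhomM fE gE iKr fhom1.
by exists (Iso gf fg).
Qed.

Lemma isomorphic_reflect (a b : A) :
  is_full -> is_faithful -> isomorphic (F a) (F b) -> isomorphic a b.
Proof. by move=> full faith [t]; have [t' _] := fhom_iso_lift t full faith. Qed.

End LinearFunctors.

(* Kernels in the opposite category are cokernels, by conversion. *)
Section Opposite.
Variable k : fieldType.

Definition opcat (A : klcat k) : klcat k.
Proof.
exists A (fun a b => hom b a) (fun a => idm a) (fun a b c g f => f ∘ g).
- by move=> a b c d h g f; rewrite compA.
- by move=> a b f; exact: compm1.
- by move=> a b f; exact: comp1m.
- by move=> a b c f l g g'; exact: comp_linr.
- by move=> a b c g l f f'; exact: comp_linl.
Defined.

Variables (A B : klcat k) (F : klfun A B).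

Definition opfun : klfun (opcat A) (opcat B).
Proof.
exists (fun a : opcat A => F a : opcat B) (fun a b f => fhom F f).
- by move=> a b c f g; exact: fhom_lin.
- by move=> a; exact: fhom1.
- by move=> a b c g f; exact: fhomM.
Defined.

Definition op_iso (E : klcat k) (a b : E) (t : iso a b) :
  iso (b : opcat E) (a : opcat E).
Proof. exact: (@Iso k (opcat E) b a (ihom t) (iinv t) (iKr t) (iKl t)). Defined.

Lemma op_esurj : is_esurj F -> is_esurj opfun.
Proof.
move=> esurj b; have [a [t]] := esurj b; exists a.
by constructor; exact: (op_iso (iso_sym t)).
Qed.

Lemma op_full : is_full F -> is_full opfun.
Proof. by move=> full a b g; exact: full. Qed.

Lemma op_faithful : is_faithful F -> is_faithful opfun.
Proof. by move=> faith a b f g; exact: faith. Qed.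

Lemma fhom_cokernel_reflect (a b c : A) (i : hom a b) (p : hom b c) :
  is_full F -> is_faithful F ->
  is_cokernel (fhom F i) (fhom F p) -> is_cokernel i p.
Proof.
move=> full faith ker.
exact: (fhom_kernel_reflect (op_full full) (op_faithful faith) ker).
Qed.

Lemma fhom_cokernel (a b c : A) (i : hom a b) (p : hom b c) :
  is_full F -> is_faithful F -> is_esurj F ->
  is_cokernel i p -> is_cokernel (fhom F i) (fhom F p).
Proof.
move=> full faith esurj.
exact: (fhom_kernel (op_full full) (op_faithful faith) (op_esurj esurj)).
Qed.

End Opposite.

Section AbelianTransfer.
Variables (k : fieldType) (A B : klcat k) (F : klfun A B).
Hypotheses (full : is_full F) (faith : is_faithful F) (esurj : is_esurj F).

Lemma equiv_exact : is_exact F.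
Proof.
move=> a b c i p ker coker.
by split; [exact: fhom_kernel | exact: fhom_cokernel].
Qed.

Lemma mono_fhom (a b : A) (f : hom a b) : mono f -> mono (fhom F f).
Proof.
move=> monof z g h; have [z0 [t]] := esurj z.
have [g0 g0E] := full (g ∘ t); have [h0 h0E] := full (h ∘ t).
move=> fgh; apply: (iso_epi (f := t)); rewrite -g0E -h0E; congr fhom.
by apply: monof; apply: faith; rewrite !fhomM g0E h0E !compA fgh.
Qed.

Lemma kernel_precomp_iso (a b c d : B) (f : hom b c) (i : hom a b)
    (t : iso d a) : is_kernel f i -> is_kernel f (i ∘ t).
Proof.
move=> [fi uni]; split; first by rewrite compA fi comp0m.
move=> z g /uni[u [iu uu]]; exists (iinv t ∘ u); split.
  by rewrite -compA (compA (ihom t)) iKr comp1m.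
move=> w iw; rewrite (uu (t ∘ w)) ?compA ?iKl ?comp1m //.
Qed.

Lemma kernel_postcomp_iso (a b c d : B) (f : hom b c) (i : hom a b)
    (t : iso c d) : is_kernel f i -> is_kernel (t ∘ f) i.
Proof.
move=> [fi uni]; split; first by rewrite -compA fi compm0.
move=> z g tfg; apply: uni; apply: (iso_mono (f := t)).
by rewrite compm0 compA.
Qed.

Lemma kernel_transfer :
  (forall a b (f : hom (a : B) b), exists c (i : hom c a), is_kernel f i) ->
  forall a b (f : hom (a : A) b), exists c (i : hom c a), is_kernel f i.
Proof.
move=> kers a b f; have [c [i keri]] := kers _ _ (fhom F f).
have [c0 [t]] := esurj c; have [i0 i0E] := full (i ∘ t).
exists c0, i0; apply: (fhom_kernel_reflect full faith); rewrite i0E.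
exact: kernel_precomp_iso.
Qed.

Lemma mono_kernel_transfer :
  (forall a b (f : hom (a : B) b), mono f ->
     exists c (g : hom b c), is_kernel g f) ->
  forall a b (f : hom (a : A) b), mono f ->
     exists c (g : hom b c), is_kernel g f.
Proof.
move=> monoker a b f /mono_fhom /monoker[c [g kerg]].
have [c0 [t]] := esurj c; have [g0 g0E] := full (iso_sym t ∘ g).
exists c0, g0; apply: (fhom_kernel_reflect full faith); rewrite g0E.
exact: kernel_postcomp_iso.
Qed.

End AbelianTransfer.

Lemma abelian_transfer (k : fieldType) (A B : klcat k) (F : klfun A B) :
  is_full F -> is_faithful F -> is_esurj F -> is_abelian B -> is_abelian A.
Proof.
move=> full faith esurj [sums kers cokers monos epis]; split.
- move=> I a; have [s bips] := sums I (fun i => F (a i)).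
  have [s0 [t]] := esurj s; exists s0; apply: (biproduct_reflect full faith).
  by apply: biproduct_iso bips; constructor; exact: iso_sym.
- exact: (kernel_transfer full faith esurj).
- move=> a b f.
  have := kernel_transfer (op_full full) (op_faithful faith) (op_esurj esurj).
  by move=> /(_ (fun a b f => cokers b a f) b a f).
- exact: (mono_kernel_transfer full faith esurj).
- move=> a b f epif.
  have := mono_kernel_transfer (op_full full) (op_faithful faith)
    (op_esurj esurj).
  by move=> /(_ (fun a b f => epis b a f) b a f epif).
Qed.

Section Exactness.
Variable k : fieldType.

Lemma kernel_square (A : klcat k) (a b c a' b' c' : A) (p : hom b c)
    (i : hom a b) (p' : hom b' c') (i' : hom a' b')
    (ta : iso a a') (tb : iso b b') (tc : iso c c') :
  tc ∘ p = p' ∘ tb -> tb ∘ i = i' ∘ ta -> is_kernel p i -> is_kernel p' i'.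
Proof.
move=> sp si [pi uni]; split.
  apply: (iso_epi (f := ta)); rewrite -compA -si compA -sp -compA pi.
  by rewrite compm0 comp0m.
move=> z g p'g; have /uni[u [iu uu]] : p ∘ (iinv tb ∘ g) = 0.
  apply: (iso_mono (f := tc)).
  by rewrite !compA sp -(compA p') iKr compm1 p'g compm0.
exists (ta ∘ u); split.
  by rewrite compA -si -compA iu compA iKr comp1m.
move=> w i'w; rewrite (uu (iinv ta ∘ w)) ?compA ?iKr ?comp1m //.
apply: (iso_mono (f := tb)); rewrite !compA si iKr comp1m -i'w.
by rewrite -(compA i') iKr compm1.
Qed.

Lemma cokernel_square (A : klcat k) (a b c a' b' c' : A) (p : hom b c)
    (i : hom a b) (p' : hom b' c') (i' : hom a' b')
    (ta : iso a a') (tb : iso b b') (tc : iso c c') :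
  tc ∘ p = p' ∘ tb -> tb ∘ i = i' ∘ ta -> is_cokernel i p -> is_cokernel i' p'.
Proof.
move=> sp si.
apply: (@kernel_square (opcat A) c b a c' b' a' i p i' p' (op_iso (iso_sym tc))
  (op_iso (iso_sym tb)) (op_iso (iso_sym ta))) => /=.
  apply: (iso_mono (f := tb)); rewrite !compA iKr comp1m.
  by rewrite si -compA iKr compm1.
apply: (iso_mono (f := tc)); rewrite !compA iKr comp1m.
by rewrite sp -compA iKr compm1.
Qed.

Lemma exact_natural_iso (A B : klcat k) (F F' : klfun A B) :
  naturally_isomorphic F F' -> is_exact F -> is_exact F'.
Proof.
move=> [th nat] exF a b c i p ker coker.
have [Fker Fcoker] := exF _ _ _ _ _ ker coker.
by split; [apply: kernel_square Fker | apply: cokernel_square Fcoker];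
  exact: nat.
Qed.

Lemma comp_exact (A B E : klcat k) (G : klfun B E) (F : klfun A B) :
  is_exact F -> is_exact G -> is_exact (comp_fun G F).
Proof.
by move=> exF exG a b c i p ker /(exF _ _ _ _ _ ker)[]; exact: exG.
Qed.

(** Exactness in an induced category or in a component is tested through this lemma, after a fully
    faithful functor to the ambient module category. *)
Lemma exact_reflect (A B E : klcat k) (G : klfun B E) (F : klfun A B) :
  is_full G -> is_faithful G -> is_exact (comp_fun G F) -> is_exact F.
Proof.
move=> full faith exGF a b c i p ker coker.
have [kGF cGF] := exGF _ _ _ _ _ ker coker.
split; first exact: (fhom_kernel_reflect full faith).
exact: (fhom_cokernel_reflect full faith).
Qed.

End Exactness.

Section Reassociation.
Variables (k : fieldType) (C : klcat k).

(** A form of [f ∘ g = r] that can be rewritten inside a longer composite nested to the right. *)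
Lemma rea2 (a b c z : C) (f : hom b c) (g : hom a b) (r : hom a c) :
  f ∘ g = r -> forall h : hom z a, f ∘ (g ∘ h) = r ∘ h.
Proof. by move=> <- h; rewrite compA. Qed.

Lemma rea3 (a b c d z : C) (f : hom c d) (g : hom b c) (g' : hom a b)
    (r : hom a d) :
  f ∘ (g ∘ g') = r -> forall h : hom z a, f ∘ (g ∘ (g' ∘ h)) = r ∘ h.
Proof. by move=> <- h; rewrite !compA. Qed.

End Reassociation.

(** * Module functors *)

Ltac funE := cbn [fob fhom comp_fun bifun_l bifun_r id_fun].

Section ModuleUnit.
Variables (k : fieldType) (D : moncat k) (N : lmodcat D).
Local Notation one := (munit D).

(** By [lunit_nat], the equalities [lunit] conjugate 1 ▷ - to the identity functor; the preimage of
    [g] is its conjugate. *)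
Lemma lunit_full : is_full (bifun_l (lact N) one).
Proof.
move=> A B g; exists (eqhom (lunit B) ∘ g ∘ eqhom (esym (lunit A))).
have := lunit_nat (eqhom (lunit B) ∘ g ∘ eqhom (esym (lunit A))).
rewrite -[RHS]compA eqhom_symK compm1.
move=> /(congr1 (fun h => eqhom (esym (lunit B)) ∘ h)).
by rewrite !compA eqhom_symK !comp1m.
Qed.

Lemma lunit_faithful : is_faithful (bifun_l (lact N) one).
Proof.
move=> A B f g /= fg; have := lunit_nat f; rewrite fg lunit_nat => /esym.
move=> /(congr1 (fun h => h ∘ eqhom (esym (lunit A)))).
by rewrite -!compA eqhom_symKr !compm1.
Qed.

Definition eqiso (E : klcat k) (A B : E) (e : A = B) : iso A B :=
  Iso (eqhom_symK e) (eqhom_symKr e).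

Lemma lam_rho_unit :
  eqhom (munitl one) = eqhom (munitr one) :> hom (one ⊗ one) one.
Proof. exact: eqhom_irr. Qed.

Definition unitor_data (A : N) :
  {t : iso (one ▷ A) A |
   idm one ▷h t = (eqhom (munitl one) ▷h idm A) ∘ iinv (lassoc one one A)}.
Proof.
apply: cid.
exact: (@fhom_iso_lift _ _ _ (bifun_l (lact N) one) (one ▷ A) A (iso_comp
  (bhom_iso (lact N) (eqiso (munitl one)) (iso_id A))
  (iso_sym (lassoc one one A))) lunit_full lunit_faithful).
Qed.

(* The constraint [lunit] need not satisfy the triangle axiom.  As 1 ▷ - is
   fully faithful, there is a unique unitor that does. *)
Definition unitor (A : N) : iso (one ▷ A) A := projT1 (unitor_data A).

Lemma unitorE A :
  (idm one ▷h unitor A) ∘ lassoc one one A = eqhom (munitl one) ▷h idm A.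
Proof. by rewrite (projT2 (unitor_data A)) -compA iKl compm1. Qed.

Lemma unitor_nat (A B : N) (f : hom A B) :
  unitor B ∘ (idm one ▷h f) = f ∘ unitor A.
Proof.
apply: lunit_faithful => /=; apply: (iso_epi (f := lassoc one one A)).
rewrite -[X in bhom _ X _](comp1m (idm one)) bhomM -compA -lassoc_nat compA.
rewrite unitorE -[X in _ = bhom _ X _ ∘ _](comp1m (idm one)) bhomM -compA.
by rewrite unitorE bhom1 -!bhomM !comp1m !compm1.
Qed.

Lemma lactM (X X' X'' : D) (A A' A'' : N) (f' : hom X' X'') (f : hom X X')
    (g' : hom A' A'') (g : hom A A') :
  (f' ∘ f) ▷h (g' ∘ g) = (f' ▷h g') ∘ (f ▷h g).
Proof. exact: bhomM. Qed.

Lemma lact_compr (X : D) (A A' A'' : N) (g' : hom A' A'') (g : hom A A') :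
  idm X ▷h (g' ∘ g) = (idm X ▷h g') ∘ (idm X ▷h g).
Proof. by rewrite -lactM comp1m. Qed.

Lemma lact_compl (X X' X'' : D) (A : N) (f' : hom X' X'') (f : hom X X') :
  (f' ∘ f) ▷h idm A = (f' ▷h idm A) ∘ (f ▷h idm A).
Proof. by rewrite -lactM comp1m. Qed.

(** With V ⊗ 1 in place of V, the pentagon at V, 1, 1 reduces the claim to the defining equation of
    [unitor] and the triangle axiom of D. Naturality along V ⊗ 1 ≅ V then removes the extra
    factor. *)
Lemma unitor_triangle (V : D) (A : N) :
  (idm V ▷h unitor A) ∘ lassoc V one A = eqhom (munitr V) ▷h idm A.
Proof.
pose rho := eqiso (munitr V).
have tri : (idm (V ⊗ one) ▷h unitor A) ∘ lassoc (V ⊗ one) one A =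
    (rho ⊗h idm one) ▷h idm A.
  apply: (iso_mono (f := lassoc V one A)).
  rewrite compA -(bhom1 (mtens D)) lassoc_nat -compA lpentagon !compA.
  rewrite -lact_compr unitorE -lassoc_nat -compA -lact_compl.
  by rewrite lam_rho_unit (eqhom_irr _ (munitl one)) mtriangle.
apply: (iso_epi (f := bhom_iso (lact N) (bhom_iso (mtens D) rho (iso_id one))
  (iso_id A))) => /=.
rewrite -[LHS]compA lassoc_nat bhom1 compA -lactM comp1m compm1.
have -> : eqhom (munitr V) ▷h unitor A =
    (eqhom (munitr V) ▷h idm A) ∘ (idm (V ⊗ one) ▷h unitor A) :> hom _ (V ▷ A).
  by rewrite -lactM comp1m compm1.
by rewrite -compA tri.
Qed.

(** The module form of [kelly]: after applying the faithful functor 1 ▷ - it follows from the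
    pentagon and [unitor_triangle]. *)
Lemma unitor_lact (V : D) (A : N) :
  unitor (V ▷ A) ∘ lassoc one V A = eqhom (munitl V) ▷h idm A.
Proof.
apply: lunit_faithful => /=.
apply: (iso_epi (f := iso_comp (lassoc one (one ⊗ V) A)
  (bhom_iso (lact N) (massoc one one V) (iso_id A)))) => /=.
rewrite lact_compr !compA -2!(compA (idm one ▷h unitor _)).
rewrite -lpentagon compA unitor_triangle -(bhom1 (lact N)) -lassoc_nat.
by rewrite -mtriangle lact_compl compA lassoc_nat.
Qed.

End ModuleUnit.

(* Exactness is left out: for functors out of an induced category it is proved
   separately. *)
Record pmodfun (k : fieldType) (D : moncat k) (M N : lmodcat D) := PModFun {
  pmfun :> klfun M N;
  pmphi : forall X A, iso (pmfun (X ▷ A)) (X ▷ pmfun A);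
  pmphi_nat : forall X X' A A' (f : hom X X') (g : hom A A'),
    pmphi X' A' ∘ fhom pmfun (f ▷h g) = (f ▷h fhom pmfun g) ∘ pmphi X A;
  pmphi_assoc : forall X Y A,
    lassoc X Y (pmfun A) ∘ pmphi (X ⊗ Y) A =
    (idm X ▷h pmphi Y A) ∘ pmphi X (Y ▷ A) ∘ fhom pmfun (lassoc X Y A) }.

Section ModuleFunctors.
Variables (k : fieldType) (D : moncat k).

Definition pm_iso (M N : lmodcat D) (F F' : pmodfun M N) : Prop :=
  exists theta : forall A, iso (F A) (F' A),
    (forall A B (f : hom A B), theta B ∘ fhom F f = fhom F' f ∘ theta A) /\
    (forall X A, pmphi F' X A ∘ theta (X ▷ A) =
                 (idm X ▷h theta A) ∘ pmphi F X A).

Definition pm_of_mf (M N : lmodcat D) (F : modfun M N) : pmodfun M N :=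
  PModFun (@mfphi_nat _ _ _ _ F) (@mfphi_assoc _ _ _ _ F).

Definition mf_of_pm (M N : lmodcat D) (F : pmodfun M N) (ex : is_exact F) :
    modfun M N :=
  ModFun ex (@pmphi_nat _ _ _ _ F) (@pmphi_assoc _ _ _ _ F).

Definition pm_id (M : lmodcat D) : pmodfun M M.
Proof.
exists (id_fun M) (fun X A => iso_id (X ▷ A)).
- by move=> X X' A A' f g /=; rewrite comp1m compm1.
- by move=> X Y A /=; rewrite bhom1 !comp1m compm1.
Defined.

Definition pm_comp (M N L : lmodcat D) (G : pmodfun N L) (F : pmodfun M N) :
    pmodfun M L.
Proof.
exists (comp_fun G F)
  (fun X A => iso_comp (pmphi G X (F A)) (fhom_iso G (pmphi F X A))).
- move=> X X' A A' f g /=.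
  by rewrite -compA -fhomM pmphi_nat fhomM !compA pmphi_nat.
- move=> X Y A /=.
  rewrite lact_compr compA pmphi_assoc -!compA; congr (_ ∘ _).
  by rewrite -fhomM pmphi_assoc !fhomM !compA pmphi_nat.
Defined.

(** The isomorphism is F ≅ F G E ≅ F' G E ≅ F'. It reduces comparing module functors on a category
    to comparing them after an equivalence onto it. *)
Lemma pm_iso_cancel (M N L : lmodcat D) (F F' : pmodfun N L)
    (G : pmodfun M N) (E : pmodfun N M) :
  pm_iso (pm_comp G E) (pm_id N) -> pm_iso (pm_comp F G) (pm_comp F' G) ->
  pm_iso F F'.
Proof.
move=> [e [enat emod]] [t [tnat tmod]].
exists (fun A => iso_comp (fhom_iso F' (e A))
  (iso_comp (t (E A)) (fhom_iso F (iso_sym (e A))))); split => /=.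
- move=> A B f; apply: (iso_epi (f := fhom_iso F (e A))) => /=.
  rewrite -!compA -!fhomM iKl fhom1 compm1.
  have -> : iinv (e B) ∘ (f ∘ e A) = fhom G (fhom E f).
    apply: (iso_mono (f := e B)); rewrite !compA iKr comp1m.
    by rewrite [RHS]enat.
  by rewrite tnat /= !compA -!fhomM [e B ∘ _]enat.
- move=> X A; apply: (iso_epi (f := fhom_iso F (e (X ▷ A)))) => /=.
  have := emod X A; rewrite /= comp1m => emodE.
  rewrite -!compA -!fhomM iKl fhom1 compm1 [in RHS]emodE.
  rewrite [in LHS]emodE !fhomM !compA pmphi_nat -!compA.
  rewrite -[fhom F' (fhom G _) ∘ _](tnat (E (X ▷ A))) /=.
  have tmodE := tmod X (E A); rewrite /= -!compA in tmodE.
  rewrite (rea3 tmodE) -!compA !lact_compr -!compA; do 2!congr (_ ∘ _).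
  rewrite (rea2 (esym (pmphi_nat F _ _))) -compA -!fhomM.
  by rewrite (rea2 (esym (lactM _ _ _ _))) iKl comp1m bhom1 comp1m.
Qed.

End ModuleFunctors.

(** * Quasi-inverses of module functors *)

Section QuasiInverse.
Variables (k : fieldType) (D : moncat k) (M N : lmodcat D) (F : pmodfun M N).
Hypotheses (full : is_full F) (faith : is_faithful F) (esurj : is_esurj F).

Let pre_data B : {A & iso (F A) B}.
Proof. by have [A /inhabited_witness] := cid (esurj B); exists A. Qed.
Let pre B := projT1 (pre_data B).
Let e B : iso (F (pre B)) B := projT2 (pre_data B).
Let lift A A' (g : hom (F A) (F A')) : hom A A' := projT1 (cid (full g)).
Let liftE A A' (g : hom (F A) (F A')) : fhom F (lift g) = g.
Proof. exact: projT2 (cid (full g)). Qed.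

Definition inv_fun : klfun N M.
Proof.
exists pre (fun A B f => lift (iinv (e B) ∘ f ∘ e A)).
- move=> A B c f g; apply: faith.
  by rewrite fhom_lin !liftE comp_linr comp_linl.
- by move=> A; apply: faith; rewrite liftE compm1 iKl fhom1.
- move=> A B E g f; apply: faith; rewrite fhomM !liftE !compA.
  by rewrite -(compA _ (ihom _) (iinv _)) iKr compm1.
Defined.

Let invE A B (f : hom A B) : e B ∘ fhom F (fhom inv_fun f) = f ∘ e A.
Proof. by rewrite /= liftE !compA iKr comp1m. Qed.

(** The constraint of the quasi-inverse is forced by requiring [e] to be an isomorphism of module
    functors; [phiE] is that requirement. *)
Let phi_data X A : {t : iso (pre (X ▷ A)) (X ▷ pre A) |
  fhom F t =
  iinv (pmphi F X (pre A)) ∘ ((idm X ▷h iinv (e A)) ∘ e (X ▷ A))}.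
Proof.
apply: cid.
exact: (fhom_iso_lift (iso_comp (iso_sym (pmphi F X (pre A)))
  (iso_comp (bhom_iso (lact N) (iso_id X) (iso_sym (e A))) (e (X ▷ A))))
  full faith).
Qed.
Let phi X A := projT1 (phi_data X A).

Let phiE X A :
  (idm X ▷h e A) ∘ (pmphi F X (pre A) ∘ fhom F (phi X A)) = e (X ▷ A).
Proof.
rewrite (projT2 (phi_data X A)) (compA (ihom _)) iKr comp1m.
by rewrite compA -lact_compr iKr bhom1 comp1m.
Qed.

Definition inv_pm : pmodfun N M.
Proof.
exists inv_fun phi.
- move=> X X' A A' f g; apply: faith; rewrite !fhomM.
  apply: (iso_mono (f := iso_comp (bhom_iso (lact N) (iso_id X') (e A'))
    (pmphi F X' (pre A')))) => /=.
  rewrite -compA (compA (ihom (pmphi _ _ _)) (fhom F (phi _ _))).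
  rewrite (compA (bhom _ _ _) (_ ∘ _)) phiE -[fhom F (lift _)]/(fhom F (fhom inv_fun _)) invE.
  rewrite -compA (compA (ihom (pmphi _ _ _))) pmphi_nat.
  rewrite -(compA (bhom _ _ _) (ihom _)) compA -lactM comp1m.
  rewrite -[lift _]/(fhom inv_fun _) invE -(phiE X A) compA -lactM.
  by rewrite compm1.
- move=> X Y A; apply: faith; rewrite !fhomM.
  apply: (iso_mono (f := pmphi F X (Y ▷ pre A))).
  apply: (iso_mono (f := bhom_iso (lact N) (iso_id X)
    (iso_comp (bhom_iso (lact N) (iso_id Y) (e A)) (pmphi F Y (pre A))))) => /=.
  have -> : (idm X ▷h ((idm Y ▷h e A) ∘ pmphi F Y (pre A))) ∘
      (pmphi F X (Y ▷ pre A) ∘ (fhom F (lassoc X Y (pre A)) ∘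
         fhom F (phi (X ⊗ Y) A))) =
      lassoc X Y A ∘ e ((X ⊗ Y) ▷ A).
    rewrite lact_compr -!compA (compA (ihom (pmphi _ X _))).
    rewrite (compA (_ ▷h pmphi _ _ _)) (compA (_ ▷h pmphi _ _ _)).
    rewrite -pmphi_assoc -(compA (ihom (lassoc _ _ _))) compA -lassoc_nat.
    by rewrite bhom1 -(phiE (X ⊗ Y) A) !compA.
  rewrite -[fhom F (lift _)]/(fhom F (fhom inv_fun (lassoc X Y A))) -!compA.
  rewrite (compA (ihom (pmphi F X _))) pmphi_nat -!compA.
  rewrite (compA (idm X ▷h (_ ∘ _))) -lact_compr -(compA _ (ihom (pmphi F Y _))).
  by rewrite phiE (compA (ihom (pmphi F X _))) (compA (idm X ▷h _)) phiE invE.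
Defined.

Lemma inv_pm_r : pm_iso (pm_comp F inv_pm) (pm_id N).
Proof.
exists e; split; first by move=> A B f; exact: invE.
by move=> X A /=; rewrite comp1m phiE.
Qed.

Lemma inv_natl : naturally_isomorphic (comp_fun inv_fun F) (id_fun M).
Proof.
have liftI A : exists t : iso (inv_fun (F A)) A, fhom F t = e (F A).
  exact: (fhom_iso_lift (e (F A)) full faith).
exists (fun A => projT1 (cid (liftI A))) => A B f /=; apply: faith.
rewrite !fhomM (projT2 (cid (liftI A))) (projT2 (cid (liftI B))).
exact: invE.
Qed.

Lemma inv_natr : naturally_isomorphic (comp_fun F inv_fun) (id_fun N).
Proof. by exists e => A B f; exact: invE. Qed.

Lemma inv_equivalence : is_equivalence inv_fun.
Proof. by exists F; split; [exact: inv_natr | exact: inv_natl]. Qed.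

End QuasiInverse.

(** * The universal property of the balanced tensor product *)

Section SymbolwiseNatural.
Variables (k : fieldType) (D : moncat k) (P : rmodcat D) (Q : lmodcat D).
Local Notation T := (balanced_tensor P Q).
Variable (K : klcat k).

Section Uniqueness.
Variables (F G : klfun T K) (th th' : forall A : T, hom (F A) (G A)).
Hypotheses
  (nat : forall (A B : T) (f : hom A B), th B ∘ fhom F f = fhom G f ∘ th A)
  (nat' : forall (A B : T) (f : hom A B), th' B ∘ fhom F f = fhom G f ∘ th' A)
  (eqth : forall p q, th (Sym p q : T) = th' (Sym p q : T)).

(** By [inl_prl] the identity of a formal sum factors through its summands, so naturality determines
    both families there; at [Zero] the source is a zero object. *)
Lemma eq_on_symbols (A : T) : th A = th' A.
Proof.
elim: A => [//||A IHA B IHB].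
  by rewrite -[LHS]compm1 -[RHS]compm1 -fhom1 idm_zero fhom0 !compm0.
rewrite -[LHS]compm1 -[RHS]compm1 -(fhom1 F (Plus A B : T)) -inl_prl.
by rewrite fhomD !compDr !fhomM !compA !nat !nat' IHA IHB.
Qed.

End Uniqueness.

Section Extension.
Variables (F G : klfun T K).
Variable th : forall (p : P) (q : Q), hom (F (Sym p q : T)) (G (Sym p q : T)).
Hypotheses
  (nsy : forall p p' q q' (f : hom p p') (g : hom q q'),
     th p' q' ∘ fhom F (sy f g) = fhom G (sy f g) ∘ th p q)
  (nal : forall p V q,
     th p (V ▷ q) ∘ fhom F (al p V q) = fhom G (al p V q) ∘ th (p ◁ V) q).

Fixpoint sym_ext (A : T) : hom (F A) (G A) :=
  match A with
  | Sym p q => th p q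
  | Zero => 0
  | Plus A B => fhom G (inl_ A B) ∘ sym_ext A ∘ fhom F (prl_ A B) +
                fhom G (inr_ A B) ∘ sym_ext B ∘ fhom F (prr_ A B)
  end.

(** Induction on formal terms. The projections and injections hold by construction, and the inverse
    of alpha needs no hypothesis: naturality at an invertible morphism gives naturality at its
    inverse. *)
Lemma sym_ext_nat (A B : T) (f : hom A B) :
  sym_ext B ∘ fhom F f = fhom G f ∘ sym_ext A.
Proof.
elim/clsW: f; elim=> {A B}.
- by move=> A; rewrite -[cls _]/(idm (A : T)) !fhom1 comp1m compm1.
- move=> A B E t IHt u IHu.
  by rewrite clsC !fhomM compA IHt -compA IHu compA.
- by move=> A B; rewrite cls0 !fhom0 compm0 comp0m.
- by move=> A B t IHt u IHu; rewrite clsD !fhomD compDr compDl IHt IHu.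
- by move=> A B c t IHt; rewrite clsZ !fhomZ compZr compZl IHt.
- move=> A B; rewrite -[cls _]/(inl_ A B) /= compDl -!compA -!fhomM.
  by rewrite prl_inl prr_inl fhom1 fhom0 compm1 !compm0 addr0.
- move=> A B; rewrite -[cls _]/(inr_ A B) /= compDl -!compA -!fhomM.
  by rewrite prl_inr prr_inr fhom1 fhom0 compm1 !compm0 add0r.
- move=> A B; rewrite -[cls _]/(prl_ A B) /= compDr !compA -!fhomM.
  by rewrite prl_inl prl_inr fhom1 fhom0 comp1m !comp0m addr0.
- move=> A B; rewrite -[cls _]/(prr_ A B) /= compDr !compA -!fhomM.
  by rewrite prr_inl prr_inr fhom1 fhom0 comp1m !comp0m add0r.
- exact: nsy.
- exact: nal.
- move=> p V q; rewrite -[cls _]/(ali p V q).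
  have aliK : fhom G (ali p V q) ∘ fhom G (al p V q) = idm _.
    by rewrite -fhomM alK fhom1.
  have alKi : fhom F (al p V q) ∘ fhom F (ali p V q) = idm _.
    by rewrite -fhomM alKr fhom1.
  rewrite -[LHS]comp1m -aliK -!compA (compA (fhom G (al _ _ _))) /= -nal.
  by rewrite -(compA (th _ _)) alKi compm1.
Qed.

End Extension.

(** The inverse is the extension of the inverses; both composites are identities by [eq_on_symbols].
    The values on symbols are recorded because they determine the transformation. *)
Lemma sym_iso (F G : klfun T K)
    (th : forall (p : P) (q : Q), iso (F (Sym p q : T)) (G (Sym p q : T))) :
  (forall p p' q q' (f : hom p p') (g : hom q q'),
     th p' q' ∘ fhom F (sy f g) = fhom G (sy f g) ∘ th p q) ->
  (forall p V q,
     th p (V ▷ q) ∘ fhom F (al p V q) = fhom G (al p V q) ∘ th (p ◁ V) q) ->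
  exists t : forall A : T, iso (F A) (G A),
    (forall (A B : T) (f : hom A B), t B ∘ fhom F f = fhom G f ∘ t A) /\
    (forall p q, ihom (t (Sym p q : T)) = th p q).
Proof.
move=> nsy nal; pose th' p q := ihom (iso_sym (th p q)).
have nsy' p p' q q' (f : hom p p') (g : hom q q') :
    th' p' q' ∘ fhom G (sy f g) = fhom F (sy f g) ∘ th' p q.
  apply: (iso_mono (f := th p' q')); apply: (iso_epi (f := th p q)).
  by rewrite /th' /= !compA iKr comp1m nsy -!compA iKl compm1.
have nal' p V q :
    th' p (V ▷ q) ∘ fhom G (al p V q) = fhom F (al p V q) ∘ th' (p ◁ V) q.
  apply: (iso_mono (f := th p (V ▷ q))); apply: (iso_epi (f := th (p ◁ V) q)).
  by rewrite /th' /= !compA iKr comp1m nal -!compA iKl compm1.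
pose e := sym_ext (fun p q => ihom (th p q)); pose e' := sym_ext th'.
have en := sym_ext_nat nsy nal; have en' := sym_ext_nat nsy' nal'.
have K1 A : e' A ∘ e A = idm _.
  apply: (eq_on_symbols (th := fun A => e' A ∘ e A)
    (th' := fun A => idm (F A))) => {A}.
  - by move=> A B f; rewrite -compA en compA en' compA.
  - by move=> A B f; rewrite comp1m compm1.
  - by move=> p q; exact: iKl.
have K2 A : e A ∘ e' A = idm _.
  apply: (eq_on_symbols (th := fun A => e A ∘ e' A)
    (th' := fun A => idm (G A))) => {A}.
  - by move=> A B f; rewrite -compA en' compA en compA.
  - by move=> A B f; rewrite comp1m compm1.
  - by move=> p q; exact: iKr.
by exists (fun A => Iso (K1 A) (K2 A)).
Qed.

End SymbolwiseNatural.

Section BalancedUniversal.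
Variables (k : fieldType) (D : moncat k) (P : rmodcat D) (Q : lmodcat D).
Local Notation T := (balanced_tensor P Q).
Variables (N : klcat k) (S : klbifun P Q N).
Variable b : forall p V q, iso (S (p ◁ V) q) (S p (V ▷ q)).
Hypothesis b_nat : forall p p' V V' q q' (f : hom p p') (u : hom V V')
    (g : hom q q'),
  b p' V' q' ∘ bhom S (f ◁h u) g = bhom S f (u ▷h g) ∘ b p V q.
Hypothesis b_assoc : forall p V W q,
  bhom S (idm p) (lassoc V W q) ∘
    (b p (V ⊗ W) q ∘ bhom S (rassoc p V W) (idm q)) =
  b p V (W ▷ q) ∘ b (p ◁ V) W q.

(** Abelianness only asserts that biproducts exist, while [bal_term] needs one chosen biproduct per
    pair, with its maps available as data. *)
Record sumdata (A B : N) := SumData {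
  sd_ob : N;
  sd_inl : hom A sd_ob;
  sd_inr : hom B sd_ob;
  sd_prl : hom sd_ob A;
  sd_prr : hom sd_ob B;
  sd_ll : sd_prl ∘ sd_inl = idm A;
  sd_rr : sd_prr ∘ sd_inr = idm B;
  sd_lr : sd_prl ∘ sd_inr = 0;
  sd_rl : sd_prr ∘ sd_inl = 0;
  sd_id : sd_inl ∘ sd_prl + sd_inr ∘ sd_prr = idm sd_ob }.

Hypothesis abN : is_abelian N.

Definition sum_data (A B : N) : sumdata A B.
Proof.
have [/(_ bool (fun i => if i then A else B)) sums _ _ _ _] := abN.
have [s /cid[i /cid[p H]]] := cid sums.
have [pi p0 ip] := H.
exists s (i true) (i false) (p true) (p false).
- exact: pi true.
- exact: pi false.
- by apply: (p0 false true).
- by apply: (p0 true false).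
- by rewrite -ip big_bool.
Defined.

Definition zero_data : {z : N | idm z = 0}.
Proof.
have [/(_ void (fun i => match i with end)) sums _ _ _ _] := abN.
have [s /cid[i /cid[p H]]] := cid sums.
by exists s; have [_ _ <-] := H; rewrite big1 // => -[].
Defined.

Fixpoint bal_ob (A : fsum P Q) : N :=
  match A with
  | Sym p q => S p q
  | Zero => sval zero_data
  | Plus A B => sd_ob (sum_data (bal_ob A) (bal_ob B))
  end.

Fixpoint bal_term (A B : fsum P Q) (t : term A B) :
    hom (bal_ob A) (bal_ob B) :=
  match t in term A B return hom (bal_ob A) (bal_ob B) with
  | TId A => idm _
  | TComp A B E t u => bal_term t ∘ bal_term u
  | TZero A B => 0
  | TAdd A B t u => bal_term t + bal_term u
  | TScale A B c t => c *: bal_term t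
  | TInl A B => sd_inl _
  | TInr A B => sd_inr _
  | TPrl A B => sd_prl _
  | TPrr A B => sd_prr _
  | TSym p p' q q' f g => bhom S f g
  | TAlpha p V q => ihom (b p V q)
  | TAlphaI p V q => iinv (b p V q)
  end.

(** Every relation of the presentation becomes an identity in [N]; the two relations on alpha are
    the hypotheses [b_nat] and [b_assoc]. *)
Lemma bal_teq (A B : fsum P Q) (t u : term A B) :
  teq t u -> bal_term t = bal_term u.
Proof.
elim=> {A B t u} //=.
- by move=> A B t u v _ -> _ ->.
- by move=> A B E t t' u u' _ -> _ ->.
- by move=> A B t t' u u' _ -> _ ->.
- by move=> A B c t t' _ ->.
- by move=> *; rewrite compA.
- by move=> *; rewrite comp1m.
- by move=> *; rewrite compm1.
- by move=> *; rewrite addrA.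
- by move=> *; rewrite addrC.
- by move=> *; rewrite add0r.
- by move=> *; rewrite scaleN1r addNr.
- by move=> *; rewrite scalerA.
- by move=> *; rewrite scale1r.
- by move=> *; rewrite scalerDr.
- by move=> *; rewrite scalerDl.
- by move=> *; rewrite comp_linl.
- by move=> *; rewrite comp_linr.
- exact: (svalP zero_data).
- by move=> *; exact: sd_ll.
- by move=> *; exact: sd_rr.
- by move=> *; exact: sd_lr.
- by move=> *; exact: sd_rl.
- by move=> *; exact: sd_id.
- by move=> *; exact: bhom1.
- by move=> *; exact: bhomM.
- by move=> *; exact: bhom_linl.
- by move=> *; exact: bhom_linr.
- by move=> *; exact: iKl.
- by move=> *; exact: iKr.
Qed.

Definition bal_hom (A B : T) (f : hom A B) : hom (bal_ob A) (bal_ob B) :=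
  bal_term (rep f).

Lemma bal_cls (A B : T) (t : term A B) :
  bal_hom (cls t : hom A B) = bal_term t.
Proof. by apply: bal_teq; exact: rep_cls. Qed.

Definition bal_fun : klfun T N.
Proof.
exists (bal_ob : T -> N) bal_hom.
- move=> A B c; elim/clsW=> t; elim/clsW=> u.
  by rewrite -clsZ -clsD !bal_cls.
- by move=> A; exact: bal_cls.
- move=> A B E; elim/clsW=> t; elim/clsW=> u.
  by rewrite -clsC !bal_cls.
Defined.

Lemma bal_sy p p' q q' (f : hom p p') (g : hom q q') :
  fhom bal_fun (sy f g) = bhom S f g.
Proof. exact: bal_cls. Qed.

Lemma bal_al p V q : fhom bal_fun (al p V q) = b p V q.
Proof. exact: bal_cls. Qed.

End BalancedUniversal.

(** * Extension of a functor on Q to a module functor on the induced category *)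

Section InducedFunctor.
Variables (k : fieldType) (C : moncat k) (P : C -> Prop).
Variables (P1 : P (munit C)) (PM : forall V W, P V -> P W -> P (V ⊗ W)).
Local Notation D := (submoncat P1 PM).
Local Notation R := (regular_rmodcat P1 PM).
Variables (Q : lmodcat D) (N : lmodcat C).
Local Notation T := (balanced_tensor R Q).
Local Notation ind := (induced_lmodcat Q).

Definition res_lmodcat : lmodcat D.
Proof.
exists (N : klcat k) (@KLBifun k D N N (fun V A => sval V ▷ A)
  (fun V V' A A' f g => bhom (lact N) f g)
  (fun V A => bhom1 (lact N) (sval V) A)
  (fun V V' V'' A A' A'' f' f g' g => @bhomM _ _ _ _ (lact N) (sval V) _ _ _ _ _ f' f g' g)
  (fun V V' A A' c f f' g => @bhom_linl _ _ _ _ (lact N) (sval V) _ _ _ c f f' g)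
  (fun V V' A A' c f g g' => @bhom_linr _ _ _ _ (lact N) (sval V) _ _ _ c f g g'))
  (fun X Y A => lassoc (sval X) (sval Y) A) (fun A => lunit A).
- move=> X X' Y Y' A A' f g h.
  exact: (@lassoc_nat _ _ N (sval X) _ (sval Y) _ _ _ f g h).
- by move=> X Y Z A; exact: (lpentagon (sval X) (sval Y) (sval Z) A).
- by move=> A A' f; exact: lunit_nat.
Defined.

Variable S : pmodfun Q res_lmodcat.
Hypothesis abN : is_abelian N.

Let phi (V : D) (q : Q) : iso (S (V ▷ q) : N) (sval V ▷ (S q : N)) :=
  @Iso k N _ _ (pmphi S V q) (iinv (pmphi S V q))
    (iKl (pmphi S V q)) (iKr (pmphi S V q)).

Lemma pmphi_inv_nat (V V' : D) (q q' : Q) (u : hom V V') (g : hom q q') :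
  (iinv (phi V' q') : hom (_ : N) (_ : N)) ∘ bhom (lact N) u (fhom S g) =
  fhom S (u ▷h g) ∘ iinv (phi V q).
Proof.
apply: (iso_mono (f := phi V' q')); rewrite !compA iKr comp1m.
have -> : phi V' q' ∘ fhom S (u ▷h g) = bhom (lact N) u (fhom S g) ∘ phi V q.
  exact: (pmphi_nat S u g).
by rewrite -compA iKr compm1.
Qed.

Lemma pmphi_inv_assoc (V W : D) (q : Q) :
  (fhom S (lassoc V W q) : hom (_ : N) (_ : N)) ∘ iinv (phi (V ⊗ W) q) =
  iinv (phi V (W ▷ q)) ∘ (idm (sval V) ▷h iinv (phi W q)) ∘
    lassoc (sval V) (sval W) (S q : N).
Proof.
apply: (iso_epi (f := phi (V ⊗ W) q)); rewrite -compA iKl compm1 -!compA.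
have -> : lassoc (sval V) (sval W) (S q : N) ∘ phi (V ⊗ W) q =
  (idm (sval V) ▷h phi W q) ∘ phi V (W ▷ q) ∘ fhom S (lassoc V W q).
  exact: (pmphi_assoc S V W q).
rewrite !compA -(compA (iinv (phi V _))) -lact_compr iKl bhom1.
by rewrite compm1 iKl comp1m.
Qed.

Definition ind_bifun : klbifun R Q N.
Proof.
exists (fun (p : R) q => (p : C) ▷ (S q : N))
  (fun (p p' : R) q q' (f : hom p p') g => bhom (lact N) (f : hom (p : C) p') (fhom S g)).
- by move=> p q; rewrite fhom1; exact: bhom1.
- by move=> p p' p'' q q' q'' f' f g' g; rewrite fhomM; exact: bhomM.
- by move=> *; exact: bhom_linl.
- by move=> *; rewrite fhom_lin; exact: bhom_linr.
Defined.

(** The module constraint of [S] is what makes p ▷ S q balanced; it enters inverted, since alpha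
    moves V from the left slot into the argument of [S]. *)
Definition ind_bal (p : R) (V : D) (q : Q) :
    iso (ind_bifun (p ◁ V) q) (ind_bifun p (V ▷ q)) :=
  iso_comp (bhom_iso (lact N) (iso_id (p : C)) (iso_sym (phi V q)))
    (lassoc (p : C) (sval V) (S q : N)).

Lemma ind_bal_nat (p p' : R) (V V' : D) q q' (f : hom p p') (u : hom V V')
    (g : hom q q') :
  ind_bal p' V' q' ∘ bhom ind_bifun (f ◁h u) g =
  bhom ind_bifun f (u ▷h g) ∘ ind_bal p V q.
Proof.
rewrite /= -compA.
rewrite (@lassoc_nat _ _ N p p' (sval V) (sval V') _ _ f u (fhom S g)).
rewrite !compA; congr (_ ∘ _).
rewrite -[LHS]lactM -[RHS]lactM comp1m compm1; congr bhom.
exact: pmphi_inv_nat.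
Qed.

Lemma ind_bal_assoc (p : R) (V W : D) q :
  bhom ind_bifun (idm p) (lassoc V W q) ∘
    (ind_bal p (V ⊗ W) q ∘ bhom ind_bifun (rassoc p V W) (idm q)) =
  ind_bal p V (W ▷ q) ∘ ind_bal (p ◁ V) W q.
Proof.
rewrite /= fhom1 -!compA.
rewrite [X in _ = _ ∘ X]compA -(bhom1 (mtens C) (p : C) (sval V)).
rewrite (lassoc_nat (l := N)) -[X in _ = _ ∘ X]compA.
have -> := @lpentagon _ _ N p (sval V) (sval W) (S q).
rewrite !compA; congr (_ ∘ _ ∘ _).
rewrite -!lact_compr; congr bhom.
exact: (pmphi_inv_assoc V W q).
Qed.

Definition ind_fun : klfun T N := bal_fun ind_bal_nat ind_bal_assoc abN.

Lemma ind_sx (p p' : C) (q q' : Q) (f : hom p p') (g : hom q q') :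
  fhom ind_fun (sx f g) = f ▷h (fhom S g : hom (S q : N) (S q')).
Proof. exact: bal_sy. Qed.

Lemma ind_ax (p : C) (V : D) (q : Q) :
  fhom ind_fun (ax p V q) =
  (idm p ▷h iinv (phi V q)) ∘ lassoc p (sval V) (S q : N).
Proof. exact: bal_al. Qed.

Lemma ind_actE X (A B : T) (f : hom A B) :
  (idm X ▷h (f : hom (A : ind) B)) = act_hom X f.
Proof.
by rewrite -[LHS]/(act_mor (idm X) B ∘ act_hom X f) act_mor1 comp1m.
Qed.

Lemma ind_act_morE X X' (f : hom X X') (A : T) :
  f ▷h (idm (A : ind)) = act_mor f A.
Proof.
by rewrite -[LHS]/(act_mor f A ∘ act_hom X (idm A)) act_hom1 compm1.
Qed.

Local Notation lact_fun X := (bifun_l (lact ind) X : klfun T T).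

(** The constraint is prescribed on symbols as the associativity of [N]; its compatibility with
    alpha is the pentagon of [N]. *)
Lemma ind_phi_data (X : C) :
  exists t : forall A : T, iso (comp_fun ind_fun (lact_fun X) A)
                         (comp_fun (bifun_l (lact N) X) ind_fun A),
    (forall (A B : T) (f : hom A B),
       t B ∘ fhom (comp_fun ind_fun (lact_fun X)) f =
       fhom (comp_fun (bifun_l (lact N) X) ind_fun) f ∘ t A) /\
    (forall p q, ihom (t (Sym p q : T)) = lassoc X (p : C) (S q : N)).
Proof.
apply: (@sym_iso k D R Q N (comp_fun ind_fun (lact_fun X))
  (comp_fun (bifun_l (lact N) X) ind_fun)
  (fun (p : R) q => lassoc X (p : C) (S q : N))).
- move=> p p' q q' f g; funE; rewrite ind_actE act_sx !ind_sx.
  exact: (@lassoc_nat _ _ N _ _ p p' _ _ (idm X) f (fhom S g)).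
- move=> p V q; funE; rewrite ind_actE (act_ax X p V q) fhomM ind_sx ind_ax.
  rewrite fhom1 !compA -(bhom1 (mtens C)).
  rewrite (@lassoc_nat _ _ N _ _ p p _ _ (idm X) (idm (p : C)) (iinv (phi V q))).
  rewrite -[fhom ind_fun _]/(fhom ind_fun (ax p V q)) ind_ax.
  rewrite lact_compr -!compA.
  congr (_ ∘ _).
  rewrite !compA lpentagon -!compA -lact_compl iKr bhom1 compm1.
  by [].
Qed.

Definition ind_phi X A := projT1 (cid (ind_phi_data X)) A.

Lemma ind_phi_natr X (A B : T) (f : hom A B) :
  ind_phi X B ∘ fhom ind_fun (idm X ▷h (f : hom (A : ind) B)) =
  (idm X ▷h fhom ind_fun f) ∘ ind_phi X A.
Proof. exact: (projT2 (cid (ind_phi_data X))).1. Qed.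

Lemma ind_phi_sym X (p : C) q :
  ihom (ind_phi X (Sym (p : R) q : T)) = lassoc X p (S q : N).
Proof. exact: (projT2 (cid (ind_phi_data X))).2. Qed.

Lemma ind_phi_natl X X' (f : hom X X') (A : T) :
  ind_phi X' A ∘ fhom ind_fun (f ▷h idm (A : ind)) =
  (f ▷h idm (ind_fun A)) ∘ ind_phi X A.
Proof.
apply: (@eq_on_symbols k D R Q N (comp_fun ind_fun (lact_fun X))
  (comp_fun (bifun_l (lact N) X') ind_fun)
  (fun A => ind_phi X' A ∘ fhom ind_fun (f ▷h idm (A : ind)))
  (fun A => (f ▷h idm (ind_fun A)) ∘ ind_phi X A)) => {A}.
- move=> A B g; funE; rewrite -compA -fhomM -(lactM (N := ind)).
  rewrite compm1 comp1m compA -ind_phi_natr -compA -fhomM.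
  by rewrite -(lactM (N := ind)) compm1 comp1m.
- move=> A B g; funE; rewrite -compA ind_phi_natr !compA -!lactM.
  by rewrite !compm1 !comp1m.
- move=> p q; rewrite !ind_phi_sym ind_act_morE ind_sx fhom1.
  by rewrite lassoc_nat bhom1.
Qed.

(** The associativity axiom compares two natural transformations out of [T], so it is checked on
    symbols, where it is again the pentagon of [N]. *)
Definition ind_pm : pmodfun ind N.
Proof.
exists ind_fun ind_phi.
- move=> X X' A A' f g.
  have -> : f ▷h g = (f ▷h idm A') ∘ (idm X ▷h g).
    by rewrite -lactM comp1m compm1.
  rewrite fhomM compA ind_phi_natl -compA ind_phi_natr compA.
  by rewrite -lactM comp1m compm1.
- move=> X Y A.
  apply: (@eq_on_symbols k D R Q N (comp_fun ind_fun (lact_fun (X ⊗ Y)))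
    (comp_fun (bifun_l (lact N) X) (comp_fun (bifun_l (lact N) Y) ind_fun))
    (fun A => lassoc X Y (ind_fun A) ∘ ind_phi (X ⊗ Y) A)
    (fun A => (idm X ▷h ind_phi Y A) ∘ ind_phi X (Y ▷ (A : ind)) ∘
                fhom ind_fun (lassoc X Y (A : ind)))) => {A}.
  + move=> A B f; funE; rewrite -compA ind_phi_natr !compA; congr (_ ∘ _).
    by rewrite -(bhom1 (mtens C)) lassoc_nat.
  + move=> A B f; funE; rewrite -!compA -fhomM -(bhom1 (mtens C)).
    rewrite (lassoc_nat (l := ind)) fhomM (rea2 (ind_phi_natr _ _)) -!compA.
    rewrite [LHS]compA [RHS]compA; congr (_ ∘ _).
    by rewrite -[LHS]lactM -[RHS]lactM !comp1m ind_phi_natr.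
  + move=> p q; rewrite ind_phi_sym.
    rewrite -[Y ▷ (Sym p q : ind)]/(Sym (Y ⊗ (p : C) : R) q : T).
    rewrite !ind_phi_sym.
    have -> : fhom ind_fun (lassoc X Y (Sym p q : ind)) =
        massoc X Y (p : C) ▷h idm (S q : N).
      by rewrite -[idm _](fhom1 S) -ind_sx.
    exact: lpentagon.
Defined.

End InducedFunctor.

(** * Projections and gradings *)

Section Projections.
Variables (k : fieldType) (K : klcat k) (P : K -> Prop).

(** A functor onto P encoded as a natural idempotent with a chosen splitting. The action on
    morphisms is not data: it is recovered as [proj_hom]. *)
Record projection := Projection {
  pob : K -> K;
  pobP : forall V, P (pob V);
  pin : forall V, hom (pob V) V;
  pout : forall V, hom V (pob V);
  pout_in : forall V, pout V ∘ pin V = idm (pob V);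
  pnat : forall V V' (f : hom V V'),
    pin V' ∘ pout V' ∘ f = f ∘ (pin V ∘ pout V) }.

Variable p : projection.

Definition pie V := pin p V ∘ pout p V.

Lemma pie_in V : pie V ∘ pin p V = pin p V.
Proof. by rewrite -compA pout_in compm1. Qed.

Lemma pout_pie V : pout p V ∘ pie V = pout p V.
Proof. by rewrite compA pout_in comp1m. Qed.

Lemma pie_nat V V' (f : hom V V') : pie V' ∘ f = f ∘ pie V.
Proof. exact: pnat. Qed.

Definition proj_hom V V' (f : hom V V') : hom (pob p V) (pob p V') :=
  pout p V' ∘ f ∘ pin p V.

Lemma pout_nat V V' (f : hom V V') : pout p V' ∘ f = proj_hom f ∘ pout p V.
Proof. by rewrite /proj_hom -!compA -/(pie V) -pie_nat compA pout_pie. Qed.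

Lemma pin_nat V V' (f : hom V V') : f ∘ pin p V = pin p V' ∘ proj_hom f.
Proof. by rewrite /proj_hom !compA -/(pie V') pie_nat -compA pie_in. Qed.

Lemma proj_hom_exact (a b c : K) (i : hom a b) (f : hom b c) :
  is_kernel f i -> is_kernel (proj_hom f) (proj_hom i).
Proof.
move=> [fi uni]; split.
  rewrite {1}/proj_hom -!compA -pin_nat (compA f) fi comp0m compm0 //.
move=> z g fg; have /uni[u [iu uu]] : f ∘ (pin p b ∘ g) = 0.
  by rewrite compA pin_nat -compA fg compm0.
exists (pout p a ∘ u); split.
  by rewrite compA -pout_nat -compA iu compA pout_in comp1m.
move=> w iw; rewrite (uu (pin p a ∘ w)) ?compA ?pout_in ?comp1m //.
by rewrite pin_nat -compA iw.
Qed.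

End Projections.

Definition op_projection (k : fieldType) (K : klcat k) (P : K -> Prop)
  (p : projection P) : @projection k (opcat K) P.
Proof.
apply: (@Projection k (opcat K) P (pob p) (@pobP _ _ _ p) (@pout _ _ _ p)
  (@pin _ _ _ p)).
- by move=> V; exact: (pout_in p V).
- by move=> V V' f; symmetry; exact: (@pnat _ _ _ p V' V f).
Defined.

Section ProjectionFunctor.
Variables (k : fieldType) (K : klcat k) (P : K -> Prop) (p : projection P).

Definition proj_fun : klfun K (fullsub P).
Proof.
exists (fun V => exist P (pob p V) (pobP p V)) (proj_hom p).
- by move=> A B c f g; rewrite /proj_hom comp_linr comp_linl.
- by move=> A; rewrite /proj_hom compm1 pout_in.
- move=> A B E g f; change (proj_hom p (g ∘ f) = proj_hom p g ∘ proj_hom p f).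
  by rewrite [proj_hom p f]/proj_hom !compA -pout_nat /proj_hom !compA.
Defined.

Lemma proj_fun_exact : is_exact (comp_fun (fullsub_incl P) proj_fun).
Proof.
move=> a b c i f ker coker; split; first exact: proj_hom_exact.
have := @proj_hom_exact _ _ _ (op_projection p) c b a f i coker.
by rewrite /proj_hom /= !compA.
Qed.

End ProjectionFunctor.

Section ExactFullsub.
Variables (k : fieldType) (K : klcat k) (P : K -> Prop) (p : projection P).
Hypothesis pieP : forall V, P V -> pie p V = idm V.

(** The idempotent is the identity on [b], so by naturality every map z → b factors through the
    projection of z; hence test objects in P suffice. *)
Lemma kernel_within (a b c : K) (i : hom a b) (f : hom b c) :
  P a -> P b -> f ∘ i = 0 ->
  (forall z, P z -> forall g : hom z b, f ∘ g = 0 -> exists! u, i ∘ u = g) ->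
  is_kernel f i.
Proof.
move=> Pa Pb fi uni; split=> // z g fg.
have pg : g = (g ∘ pin p z) ∘ pout p z.
  by rewrite -compA -/(pie p z) -pie_nat pieP ?comp1m.
have [|u [iu uu]] := uni _ (pobP p z) (g ∘ pin p z).
  by rewrite compA fg comp0m.
exists (u ∘ pout p z); split; first by rewrite [RHS]pg -iu compA.
move=> w iw; rewrite (uu (w ∘ pin p z)); last by rewrite compA iw.
by rewrite -compA -/(pie p z) -pie_nat pieP ?comp1m.
Qed.

Lemma fullsub_kernel (a b c : fullsub P) (i : hom a b) (f : hom b c) :
  is_kernel f i ->
  @is_kernel k K (sval b) (sval c) (sval a) f i.
Proof.
move=> [fi uni]; apply: (kernel_within (svalP a) (svalP b) fi) => z Pz g.
exact: (uni (exist P z Pz) g).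
Qed.

End ExactFullsub.

Section FullsubExact.
Variables (k : fieldType) (K : klcat k) (P : K -> Prop) (p : projection P).
Hypothesis pieP : forall V, P V -> pie p V = idm V.

(** A full subcategory that is abelian need not be exactly embedded; the projection is what forces
    its kernels and cokernels to be those of K. *)
Lemma fullsub_incl_exact : is_exact (fullsub_incl P).
Proof.
move=> a b c i f ker coker; split; first exact: (fullsub_kernel pieP ker).
exact: (@fullsub_kernel k (opcat K) P (op_projection p) pieP c b a f i coker).
Qed.

End FullsubExact.

(** * The projection of the induced category to its component at x *)

Section ModuleFunctorUnit.
Variables (k : fieldType) (D : moncat k).
Local Notation one := (munit D).

(** Module functors carry no unit axiom; this one follows from associativity at X = Y = 1 because 1
    ▷ - is faithful. *)
Lemma pm_unitor (M N : lmodcat D) (F : pmodfun M N) (A : M) :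
  unitor (F A) ∘ pmphi F one A = fhom F (unitor A).
Proof.
apply: lunit_faithful => /=.
apply: (iso_epi (f := iso_comp (pmphi F one (one ▷ A))
  (fhom_iso F (lassoc one one A)))) => /=.
rewrite lact_compr -!compA (compA (idm one ▷h pmphi _ _ _)) -pmphi_assoc.
rewrite compA unitorE -(fhom1 F) -pmphi_nat -unitorE fhomM.
by rewrite !compA pmphi_nat.
Qed.

Variables (V W : D) (kappa : iso (V ⊗ W) one).

(** The isomorphism A ≅ 1 ▷ A ≅ (V ⊗ W) ▷ A ≅ V ▷ W ▷ A. It is kept opaque, so that its forward map
    is known only through [coevE]. *)
Lemma coev_data (N : lmodcat D) (A : N) :
  {t : iso A (V ▷ W ▷ A) |
   ihom t = lassoc V W A ∘ ((iinv kappa ▷h idm A) ∘ iinv (unitor A))}.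
Proof.
by exists (iso_comp (lassoc V W A)
  (iso_comp (bhom_iso (lact N) (iso_sym kappa) (iso_id A))
            (iso_sym (unitor A)))).
Qed.

Definition coev (N : lmodcat D) (A : N) := projT1 (coev_data A).

Lemma coevE (N : lmodcat D) (A : N) :
  ihom (coev A) = lassoc V W A ∘ ((iinv kappa ▷h idm A) ∘ iinv (unitor A)).
Proof. exact: projT2 (coev_data A). Qed.

Lemma unitor_inv_nat (N : lmodcat D) (A B : N) (f : hom A B) :
  iinv (unitor B) ∘ f = (idm one ▷h f) ∘ iinv (unitor A).
Proof.
apply: (iso_mono (f := unitor B)); apply: (iso_epi (f := unitor A)).
by rewrite !compA iKr comp1m unitor_nat -!compA iKl compm1.
Qed.

Lemma coev_nat (N : lmodcat D) (A B : N) (f : hom A B) :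
  coev B ∘ f = (idm V ▷h idm W ▷h f) ∘ coev A.
Proof.
rewrite !coevE -!compA unitor_inv_nat (compA (iinv kappa ▷h _)) -lactM.
rewrite comp1m compm1 (rea2 (esym (lassoc_nat _ _ _))) bhom1 -compA; congr (_ ∘ _).
by rewrite compA -lactM comp1m compm1.
Qed.

Lemma pm_coev (M N : lmodcat D) (F : pmodfun M N) (A : M) :
  (idm V ▷h pmphi F W A) ∘ (pmphi F V (W ▷ A) ∘ fhom F (coev A)) =
  coev (F A).
Proof.
rewrite !coevE !fhomM !compA -pmphi_assoc -(compA (ihom (lassoc _ _ _))).
rewrite pmphi_nat fhom1 -!compA; congr (_ ∘ (_ ∘ _)).
apply: (iso_epi (f := fhom_iso F (unitor A))) => /=.
rewrite -compA -fhomM iKl fhom1 compm1 -pm_unitor.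
by rewrite compA iKl comp1m.
Qed.

End ModuleFunctorUnit.

Section InducedPart.
Variables (k : fieldType) (C : moncat k) (P : C -> Prop).
Variables (P1 : P (munit C)) (PM : forall V W, P V -> P W -> P (V ⊗ W)).
Variables (M : lmodcat C) (PMd : M -> Prop).
Hypothesis PQ : forall V A, P V -> PMd A -> PMd (V ▷ A).
Local Notation D := (submoncat P1 PM).
Local Notation R := (regular_rmodcat P1 PM).
Local Notation Q := (sublmodcat P1 PM PQ).
Local Notation T := (balanced_tensor R Q).
Local Notation ind := (induced_lmodcat Q).
Local Notation one := (munit C).

Definition incl_pm : pmodfun Q (res_lmodcat P1 PM M).
Proof.
exists (@KLFun k Q (res_lmodcat P1 PM M) (fun A => sval A) (fun A B f => f)
  (fun A B c f g => erefl) (fun A => erefl) (fun A B E g f => erefl))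
  (fun X A => @iso_id k M (sval X ▷ sval A)).
- by move=> X X' A A' f g; rewrite [LHS]comp1m [RHS]compm1.
- move=> X Y A.
  change (lassoc (sval X) (sval Y) (sval A) ∘ idm _ =
    (idm (sval X) ▷h idm (sval Y ▷ sval A)) ∘ idm _ ∘
      lassoc (sval X) (sval Y) (sval A)).
  by rewrite bhom1 !comp1m compm1.
Defined.

Hypothesis abM : is_abelian M.
Let Phi := ind_pm incl_pm abM.

Lemma Phi_sx (p p' : C) (q q' : Q) (f : hom p p') (g : hom q q') :
  fhom Phi (sx f g) = f ▷h (g : hom (sval q) (sval q')).
Proof. exact: ind_sx. Qed.

Lemma Phi_ax (p : C) (V : D) (q : Q) :
  fhom Phi (ax p V q) = lassoc p (sval V) (sval q).
Proof.
apply: etrans (ind_ax incl_pm abM p V q) _.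
by rewrite [X in X ∘ _]bhom1 [LHS]comp1m.
Qed.

Variables (pC : projection P) (pM : projection PMd).
Hypotheses
  (eact : forall U A, PMd A -> pie pM (U ▷ A) = pie pC U ▷h idm A)
  (eten : forall U V, P V -> pie pC (U ⊗ V) = pie pC U ⊗h idm V).

(* A |-> [1, π A] *)
Definition sym1_fun : klfun M T.
Proof.
exists (fun A => Sym (one : R) (proj_fun pM A : Q) : T)
  (fun A B f => sx (idm one) (fhom (proj_fun pM) f : hom (_ : Q) _)).
- move=> A B c f g; rewrite fhom_lin.
  by rewrite -[sx _ _]/(cls _) -clsZ -clsD; exact/clsP/teq_sym_linr.
- by move=> A; rewrite fhom1; exact: sx1.
- by move=> A B E g f; rewrite fhomM -[in LHS](comp1m (idm one)); exact: sxM.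
Defined.

Let pobD (U : C) : D := exist P (pob pC U) (pobP pC U).

(** By [eact], the C_H-part of U acting on q and the projection of U ▷ q split the same idempotent
    of U ▷ q, so [qm] and [qmi] are mutually inverse. *)
Let qm U (q : Q) : hom (pobD U ▷ q : Q) (proj_fun pM (U ▷ sval q) : Q) :=
  pout pM (U ▷ sval q) ∘ (pin pC U ▷h idm (sval q)).
Let qmi U (q : Q) : hom (proj_fun pM (U ▷ sval q) : Q) (pobD U ▷ q : Q) :=
  (pout pC U ▷h idm (sval q)) ∘ pin pM (U ▷ sval q).

Let qmK U q : qmi U q ∘ qm U q = idm _.
Proof.
rewrite [LHS]compA -[X in X ∘ _]compA [X in _ ∘ X ∘ _](eact U (svalP q)).
by rewrite -!lactM pout_pie pout_in !comp1m bhom1.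
Qed.

Let qmKr U q : qm U q ∘ qmi U q = idm _.
Proof.
rewrite [LHS]compA -[X in X ∘ _]compA -[X in _ ∘ X ∘ _]lactM comp1m.
by rewrite -/(pie pC U) -(eact U (svalP q)) pout_pie pout_in.
Qed.

Let lam (V : C) := eqiso (munitl V).

Definition part_out0 (U : C) (q : Q) :
    hom (Sym (U : R) q : T) (sym1_fun (U ▷ sval q)) :=
  sx (idm one) (qm U q) ∘ (ax one (pobD U) q ∘
    sx (iinv (lam (pob pC U)) ∘ pout pC U) (idm q)).

Definition part_in0 (U : C) (q : Q) :
    hom (sym1_fun (U ▷ sval q)) (Sym (U : R) q : T) :=
  sx (pin pC U ∘ lam (pob pC U)) (idm q) ∘ (axi one (pobD U) q ∘
    sx (idm one) (qmi U q)).

Lemma part_in_out0 U q : part_in0 U q ∘ part_out0 U q = sx (pie pC U) (idm q).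
Proof.
rewrite /part_in0 /part_out0 -!compA (rea2 (esym (sxM _ _ _ _))) comp1m qmK sx1.
rewrite comp1m (rea2 (axK _ _ _)) comp1m -sxM comp1m; congr sx.
by rewrite -compA (rea2 (iKr _)) comp1m.
Qed.

Lemma part_out_in0 U q : part_out0 U q ∘ part_in0 U q = idm _.
Proof.
rewrite /part_in0 /part_out0 -!compA (rea2 (esym (sxM _ _ _ _))) comp1m.
have -> : iinv (lam (pob pC U)) ∘ pout pC U ∘ (pin pC U ∘ lam (pob pC U)) =
    idm _.
  by rewrite -compA (rea2 (pout_in _ _)) comp1m iKl.
rewrite sx1 comp1m (rea2 (axKr _ _ _)) comp1m -sxM comp1m qmKr.
exact: sx1.
Qed.

Let pC_hom U U' (f : hom U U') : hom (pobD U) (pobD U') := proj_hom pC f.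

Lemma part_out0_sx U U' q q' (f : hom U U') (g : hom q q') :
  part_out0 U' q' ∘ sx f g =
  fhom sym1_fun (f ▷h (g : hom (sval q) (sval q'))) ∘ part_out0 U q.
Proof.
have lamE : iinv (lam (pob pC U')) ∘ proj_hom pC f =
    (idm one ⊗h proj_hom pC f) ∘ iinv (lam (pob pC U)).
  apply: (iso_mono (f := lam (pob pC U'))).
  apply: (iso_epi (f := lam (pob pC U))).
  rewrite !compA iKr comp1m munitl_nat -!compA.
  by rewrite eqhom_symK compm1.
have E : iinv (lam (pob pC U')) ∘ pout pC U' ∘ f =
    (idm one ⊗h proj_hom pC f) ∘ (iinv (lam (pob pC U)) ∘ pout pC U).
  by rewrite -compA pout_nat compA lamE compA.
rewrite /part_out0 -!compA -sxM comp1m E -[g in LHS]compm1 sxM.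
rewrite (rea2 (ax_nat (idm one) (pC_hom f) g)) -!compA.
rewrite !(rea2 (esym (sxM _ _ _ _))) comp1m.
congr (sx _ _ ∘ _).
change (pout pM (U' ▷ sval q') ∘ (pin pC U' ▷h idm _) ∘
    (proj_hom pC f ▷h (g : hom (sval q) (sval q'))) =
  proj_hom pM (f ▷h (g : hom (sval q) (sval q'))) ∘
  (pout pM (U ▷ sval q) ∘ (pin pC U ▷h idm (sval q)))).
rewrite [RHS]compA -pout_nat -!compA -!lactM comp1m compm1.
by rewrite -pin_nat.
Qed.

(** This compatibility with alpha lets the map descend to the balanced tensor product. It combines
    [eten], the relation [ax_assoc] and Kelly's lemma for the unit. *)
Lemma part_out0_ax U (V : D) q :
  part_out0 U (V ▷ q) ∘ ax U V q =
  fhom sym1_fun (lassoc U (sval V) (sval q)) ∘ part_out0 (U ⊗ sval V) q.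
Proof.
(* [r] compares (part of U) ⊗ V with the part of U ⊗ V, which split the same idempotent by
   [eten]. *)
pose r : hom (pob pC U ⊗ sval V) (pob pC (U ⊗ sval V)) :=
  pout pC (U ⊗ sval V) ∘ (pin pC U ⊗h idm (sval V)).
have rE : r ∘ (pout pC U ⊗h idm (sval V)) = pout pC (U ⊗ sval V).
  rewrite /r -compA -bhomM comp1m -/(pie pC U) -eten ?pout_pie //.
  exact: svalP V.
have pinr : pin pC (U ⊗ sval V) ∘ r = pin pC U ⊗h idm (sval V).
  rewrite /r compA -/(pie pC _) eten; last exact: svalP V.
  by rewrite -bhomM comp1m pie_in.
have lamE : iinv (lam (pob pC (U ⊗ sval V))) ∘ r =
    (idm one ⊗h r) ∘ iinv (lam (pob pC U ⊗ sval V)).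
  apply: (iso_mono (f := lam (pob pC (U ⊗ sval V)))).
  apply: (iso_epi (f := lam (pob pC U ⊗ sval V))).
  rewrite !compA iKr comp1m munitl_nat -!compA.
  by rewrite eqhom_symK compm1.
have kellyE : massoc one (pob pC U) (sval V) ∘
    (iinv (lam (pob pC U)) ⊗h idm (sval V)) =
    iinv (lam (pob pC U ⊗ sval V)).
  apply: (iso_mono (f := lam (pob pC U ⊗ sval V))).
  rewrite iKr compA kelly -bhomM comp1m eqhom_symKr.
  exact: bhom1.
(* Alpha is natural in its middle argument only for morphisms of D, so [r] is read there. *)
pose rD : hom (pobD U ⊗ V : D) (pobD (U ⊗ sval V)) := r.
have E1 : massoc one (pob pC U) (sval V) ∘
    ((iinv (lam (pob pC U)) ∘ pout pC U) ⊗h idm (sval V)) =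
    iinv (lam (pob pC U ⊗ sval V)) ∘ (pout pC U ⊗h idm (sval V)).
  by rewrite -kellyE -compA -bhomM comp1m.
have E2 : iinv (lam (pob pC (U ⊗ sval V))) ∘ pout pC (U ⊗ sval V) =
    (idm one ⊗h r) ∘
    (iinv (lam (pob pC U ⊗ sval V)) ∘ (pout pC U ⊗h idm (sval V))).
  by rewrite -rE compA lamE compA.
rewrite /part_out0 -!compA -ax_natl.
rewrite (rea2 (esym (ax_assoc one (pobD U) V q))) -!compA.
rewrite -(sxMl _ (massoc one _ _)) E1 E2 sxMl.
rewrite (rea2 (ax_nat (idm one) rD (idm q))) -!compA.
rewrite (rea2 (esym (sxM _ _ _ _))) comp1m.
rewrite (rea2 (esym (sxM _ _ _ _))) (rea2 (esym (sxM _ _ _ _))) !comp1m.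
congr (sx _ _ ∘ _).
change (pout pM (U ▷ sval V ▷ sval q) ∘ (pin pC U ▷h idm (sval V ▷ sval q)) ∘
  lassoc (pob pC U) (sval V) (sval q) =
  proj_hom pM (lassoc U (sval V) (sval q)) ∘
  ((pout pM ((U ⊗ sval V) ▷ sval q) ∘ (pin pC (U ⊗ sval V) ▷h idm (sval q)))
    ∘ (r ▷h idm (sval q)))).
rewrite -(compA _ _ (r ▷h _)) -lactM pinr comp1m [RHS]compA -pout_nat -!compA.
by rewrite lassoc_nat bhom1.
Qed.

Definition part_out (A : T) : hom A (sym1_fun (Phi A)) :=
  sym_ext (F := id_fun T) (G := comp_fun sym1_fun Phi)
    (part_out0 : forall (p : R) q, hom (Sym p q : T) _) A.

Lemma part_out_nat (A B : T) (f : hom A B) :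
  part_out B ∘ f = fhom sym1_fun (fhom Phi f) ∘ part_out A.
Proof.
apply: (sym_ext_nat (F := id_fun T) (G := comp_fun sym1_fun Phi)).
- move=> p p' q q' f1 g.
  have Ef : fhom Phi (sy f1 g) = (f1 : hom (p : C) p') ▷h (g : hom (sval q) (sval q')).
    exact: Phi_sx.
  by funE; rewrite Ef; exact: part_out0_sx.
- move=> p V q.
  have Ef : fhom Phi (al p V q) = lassoc (p : C) (sval V) (sval q).
    exact: Phi_ax.
  by funE; rewrite Ef; exact: part_out0_ax.
Qed.

(** Naturality of the section is formal: [part_out0] is a natural split epimorphism, and the
    idempotent [part_in0 ∘ part_out0] commutes with [f] by assumption. *)
Lemma part_in0_nat (p p' : C) q q' (f : hom (Sym (p : R) q : T) (Sym (p' : R) q' : T)) :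
  f ∘ sx (pie pC p) (idm q) = sx (pie pC p') (idm q') ∘ f ->
  part_out0 p' q' ∘ f = fhom sym1_fun (fhom Phi f) ∘ part_out0 p q ->
  part_in0 p' q' ∘ fhom sym1_fun (fhom Phi f) = f ∘ part_in0 p q.
Proof.
move=> fe fp.
transitivity (part_in0 p' q' ∘ (part_out0 p' q' ∘ f) ∘ part_in0 p q).
  rewrite fp -(compA (part_in0 _ _)) -(compA (fhom sym1_fun _)).
  by rewrite part_out_in0 compm1.
rewrite (compA (part_in0 _ _)) part_in_out0 -fe -part_in_out0 -!(compA f).
by rewrite -(compA (part_in0 _ _)) part_out_in0 compm1.
Qed.

Lemma part_in0_sx (p p' : C) q q' (f : hom p p') (g : hom q q') :
  part_in0 p' q' ∘ fhom sym1_fun (fhom Phi (sx f g)) = sx f g ∘ part_in0 p q.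
Proof.
apply: part_in0_nat; last by rewrite Phi_sx; exact: part_out0_sx.
by rewrite -!sxM pie_nat compm1 comp1m.
Qed.

Lemma part_in0_ax (p : C) (V : D) q :
  part_in0 p (V ▷ q) ∘ fhom sym1_fun (fhom Phi (ax p V q)) =
  ax p V q ∘ part_in0 (p ⊗ sval V) q.
Proof.
apply: part_in0_nat; last by rewrite Phi_ax; exact: part_out0_ax.
by rewrite eten ?ax_natl //; exact: svalP V.
Qed.

Let F := comp_fun sym1_fun Phi.
Let i0 (p : R) (q : Q) : hom (F (Sym p q : T)) (id_fun T (Sym p q : T)) :=
  part_in0 (p : C) q.

Lemma part_in0_sy (p p' : R) q q' (f : hom p p') (g : hom q q') :
  i0 p' q' ∘ fhom F (sy f g) = fhom (id_fun T) (sy f g) ∘ i0 p q.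
Proof. exact: (part_in0_sx (f : hom (p : C) p') g). Qed.

Lemma part_in0_al (p : R) (V : D) q :
  i0 p (V ▷ q) ∘ fhom F (al p V q) = fhom (id_fun T) (al p V q) ∘ i0 (p ◁ V) q.
Proof. exact: (part_in0_ax (p : C) V q). Qed.

Definition part_in (A : T) : hom (F A) (id_fun T A) :=
  @sym_ext k D R Q T F (id_fun T) i0 A.

Lemma part_in_natF (A B : T) (f : hom A B) :
  part_in B ∘ fhom F f = fhom (id_fun T) f ∘ part_in A.
Proof.
exact: (@sym_ext_nat k D R Q T F (id_fun T) i0 part_in0_sy part_in0_al A B f).
Qed.

Lemma part_in_nat (A B : T) (f : hom A B) :
  part_in B ∘ fhom sym1_fun (fhom Phi f) = f ∘ part_in A.
Proof. exact: part_in_natF. Qed.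

Lemma part_in_out (U : C) (q : Q) :
  part_in (Sym (U : R) q : T) ∘ part_out (Sym (U : R) q : T) =
  sx (pie pC U) (idm q).
Proof. exact: part_in_out0. Qed.

(** The right-hand side is natural for all morphisms of [M] between objects Φ A, not only for those
    in the image of Φ. Fullness depends on this. *)
Lemma Phi_part_in (A : T) :
  fhom Phi (part_in A) = pin pM (Phi A) ∘ unitor (pob pM (Phi A)).
Proof.
pose G := comp_fun (comp_fun (bifun_l (lact M) one)
  (comp_fun (fullsub_incl PMd) (proj_fun pM))) Phi.
have Phi1 (A1 B : M) (f : hom A1 B) :
    fhom Phi (fhom sym1_fun f) = idm one ▷h proj_hom pM f by exact: Phi_sx.
apply: (@eq_on_symbols k D R Q M (comp_fun Phi (comp_fun sym1_fun Phi)) Phi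
  (fun A => fhom Phi (part_in A))
  (fun A => pin pM (Phi A) ∘ unitor (pob pM (Phi A)))) => {A}.
- by move=> A B f; funE; rewrite -[LHS]fhomM part_in_nat fhomM.
- move=> A B f; funE; rewrite Phi1 -compA unitor_nat [RHS]compA pin_nat.
  by rewrite compA.
- move=> U q; rewrite -[part_in _]/(part_in0 U q).
  have Phi_axi : fhom Phi (axi one (pobD U) q) =
      iinv (lassoc one (pob pC U) (sval q)).
    apply: (iso_mono (f := lassoc one (pob pC U) (sval q))).
    transitivity (fhom Phi (ax one (pobD U) q) ∘ fhom Phi (axi one (pobD U) q)).
      by rewrite Phi_ax.
    by rewrite iKr -[LHS]fhomM axKr; exact: fhom1.
  have Phi_qm : fhom Phi (sx (idm one) (qmi U q)) =
      idm one ▷h ((pout pC U ▷h idm (sval q)) ∘ pin pM (U ▷ sval q)).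
    exact: Phi_sx.
  rewrite /part_in0 !fhomM Phi_axi Phi_qm Phi_sx.
  change (((pin pC U ∘ lam (pob pC U)) ▷h idm (sval q)) ∘
    (iinv (lassoc one (pob pC U) (sval q)) ∘
      (idm one ▷h ((pout pC U ▷h idm (sval q)) ∘ pin pM (U ▷ sval q)))) =
    pin pM (U ▷ sval q) ∘ unitor (pob pM (U ▷ sval q))).
  rewrite lact_compl -compA -unitor_lact -compA (rea2 (iKr _)) comp1m.
  rewrite unitor_nat !compA -lactM comp1m -/(pie pC U) -eact ?pie_in //.
  exact: svalP q.
Qed.

Section Shift.
Variables (V W : C) (kappa : iso (V ⊗ W) one).
Local Notation phi X A := (pmphi Phi X (A : ind)).

(* A |-> V ▷ [1, π(W ▷ A)] *)
Definition shift_fun : klfun M T :=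
  comp_fun (bifun_l (lact ind) V) (comp_fun sym1_fun (bifun_l (lact M) W)).

Definition shift_a (A : T) : hom A (shift_fun (Phi A)) :=
  (idm V ▷h (fhom sym1_fun (phi W A) ∘ part_out (W ▷ (A : ind)) : hom (_ : ind) _))
    ∘ coev kappa (A : ind).

Definition shift_b (A : T) : hom (shift_fun (Phi A)) A :=
  iinv (coev kappa (A : ind)) ∘
  (idm V ▷h (part_in (W ▷ (A : ind)) ∘ fhom sym1_fun (iinv (phi W A)) :
    hom (_ : ind) _)).

Lemma coev_inv_nat (N : lmodcat C) (A B : N) (f : hom A B) :
  iinv (coev kappa B) ∘ (idm V ▷h idm W ▷h f) = f ∘ iinv (coev kappa A).
Proof.
apply: (iso_mono (f := coev kappa B)); apply: (iso_epi (f := coev kappa A)).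
by rewrite (rea2 (iKr (coev kappa B))) comp1m -!compA iKl compm1 coev_nat.
Qed.

Lemma phi_inv_nat (A B : T) (f : hom A B) :
  iinv (phi W B) ∘ (idm W ▷h fhom Phi f) =
  fhom Phi (idm W ▷h (f : hom (A : ind) B)) ∘ iinv (phi W A).
Proof.
apply: (iso_mono (f := phi W B)); apply: (iso_epi (f := phi W A)).
by rewrite !compA iKr comp1m pmphi_nat -!compA iKl compm1.
Qed.

Lemma shift_a_nat (A B : T) (f : hom A B) :
  shift_a B ∘ f = fhom shift_fun (fhom Phi f) ∘ shift_a A.
Proof.
rewrite /shift_a /shift_fun; funE.
rewrite -[LHS]compA (coev_nat kappa (f : hom (A : ind) B)) [LHS]compA [RHS]compA.
congr (_ ∘ _); rewrite -[LHS](lactM (N := ind)) -[RHS](lactM (N := ind)) !comp1m; congr bhom.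
rewrite -[LHS]compA part_out_nat [LHS]compA [RHS]compA; congr (_ ∘ _).
by rewrite -[LHS]fhomM -[RHS]fhomM pmphi_nat.
Qed.

Lemma shift_b_nat (A B : T) (f : hom A B) :
  shift_b B ∘ fhom shift_fun (fhom Phi f) = f ∘ shift_b A.
Proof.
rewrite /shift_b /shift_fun; funE.
rewrite [RHS]compA -(coev_inv_nat (f : hom (A : ind) B)) -[LHS]compA -[RHS]compA.
congr (_ ∘ _); rewrite -[LHS](lactM (N := ind)) -[RHS](lactM (N := ind)) !comp1m; congr bhom.
rewrite -[LHS]compA [RHS]compA -part_in_nat -[RHS]compA; congr (_ ∘ _).
by rewrite -[LHS]fhomM -[RHS]fhomM phi_inv_nat.
Qed.

Lemma shift_ba (A : T) :
  shift_b A ∘ shift_a A =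
  iinv (coev kappa (A : ind)) ∘
    ((idm V ▷h (part_in (W ▷ (A : ind)) ∘ part_out (W ▷ (A : ind)) :
        hom (_ : ind) _)) ∘ coev kappa (A : ind)).
Proof.
rewrite -[LHS]compA; congr (_ ∘ _); rewrite [LHS]compA; congr (_ ∘ _).
rewrite -[LHS](lactM (N := ind)) comp1m; congr bhom.
rewrite -[LHS]compA; congr (_ ∘ _); rewrite [LHS]compA -[X in X ∘ _]fhomM iKl.
by rewrite fhom1 comp1m.
Qed.

Lemma Phi_shift_b (A : T) :
  fhom Phi (shift_b A) =
  iinv (coev kappa (Phi A)) ∘
    ((idm V ▷h (pin pM (W ▷ Phi A) ∘ unitor (pob pM (W ▷ Phi A)))) ∘
     phi V (sym1_fun (W ▷ Phi A))).
Proof.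
apply: (iso_mono (f := coev kappa (Phi A))); rewrite (rea2 (iKr _)) comp1m.
rewrite -(pm_coev kappa Phi (A : ind)) -!compA -fhomM.
rewrite [X in fhom Phi X](_ : _ = idm V ▷h (part_in (W ▷ (A : ind)) ∘
  fhom sym1_fun (iinv (phi W A)) : hom (_ : ind) _)); last first.
  exact: (etrans (rea2 (iKr (coev kappa (A : ind))) _) (comp1m _)).
rewrite pmphi_nat [LHS]compA -lactM; congr (_ ∘ _); rewrite comp1m.
congr bhom; rewrite fhomM Phi_part_in.
have -> : fhom Phi (fhom sym1_fun (iinv (phi W A))) =
    idm one ▷h proj_hom pM (iinv (phi W A)).
  exact: Phi_sx.
by rewrite -compA unitor_nat (rea2 (esym (pin_nat pM _))) -compA (rea2 (iKr _)) comp1m.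
Qed.

(** Here [g] need not come from the induced category: every factor in the formula [Phi_shift_b] is
    natural with respect to morphisms of [M]. *)
Lemma Phi_shift_b_nat (A B : T) (g : hom (Phi A) (Phi B)) :
  fhom Phi (shift_b B) ∘ fhom Phi (fhom shift_fun g) = g ∘ fhom Phi (shift_b A).
Proof.
rewrite !Phi_shift_b [RHS]compA -coev_inv_nat -!compA; congr (_ ∘ _).
rewrite /shift_fun; funE; rewrite pmphi_nat [LHS]compA [RHS]compA.
congr (_ ∘ _); rewrite -[LHS]lactM -[RHS]lactM !comp1m; congr bhom.
have -> : fhom Phi (fhom sym1_fun (idm W ▷h g)) =
    idm one ▷h proj_hom pM (idm W ▷h g).
  exact: Phi_sx.
by rewrite -compA unitor_nat [LHS]compA -pin_nat -compA.
Qed.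

End Shift.

End InducedPart.

(** * Projections cut out by a grading *)

Section GradingProjection.
Variables (k : fieldType) (K : klcat k) (I : Type) (deg : I -> K -> Prop).
Hypotheses (gr : is_grading deg) (abK : is_abelian K).

Lemma grading_hom0 i j A B : i <> j -> deg i A -> deg j B ->
  forall f : hom A B, f = 0.
Proof. by have [_ _ H _] := gr; exact: H. Qed.

(** Collects the summands of V with degree in [S]. The last two clauses describe the idempotent by
    its effect on maps from homogeneous objects, without reference to the chosen decomposition. *)
Lemma grading_piece (S : I -> Prop) V :
  exists (U : K) (a : hom U V) (b : hom V U),
  [/\ graded_sum deg S U, b ∘ a = idm U,
      forall i Z (f : hom Z V), deg i Z -> S i -> a ∘ b ∘ f = f
    & forall i Z (f : hom Z V), deg i Z -> ~ S i -> a ∘ b ∘ f = 0].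
Proof.
have [_ _ _ /(_ V)[J [A [dA [inj [prj [pi p0 ip]]]]]]] := gr.
pose d j := projT1 (cid (dA j)).
have dE j : deg (d j) (A j) by have [] := projT2 (cid (dA j)).
(* Deciding [S] classically makes the selected indices a finite type, as biproducts require. *)
pose s := [pred j | `[<S (d j)>]].
have [/(_ {j | j \in s} (fun j => A (val j)))[U bipU] _ _ _ _] := abK.
have [inj' [prj' [pi' p0' ip']]] := bipU.
exists U, (\sum_j (inj (val j) ∘ prj' j)), (\sum_j (inj' j ∘ prj (val j))).
have abE : (\sum_j (inj (val j) ∘ prj' j)) ∘ (\sum_j (inj' j ∘ prj (val j))) =
    \sum_(j in s) (inj j ∘ prj j).
  rewrite (big_sub s) comp_suml; apply: eq_bigr => j _.
  rewrite comp_sumr (bigD1 j) //= big1 ?addr0 => [|l /eqP lj].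
    by rewrite -compA (rea2 (pi' j)) comp1m.
  by rewrite -compA (rea2 (p0' l j lj)) comp0m compm0.
split.
- exists {j | j \in s}, (fun j => A (val j)); split=> //.
  by move=> j; exists (d (val j)); split=> //; exact/asboolP/(valP j).
- rewrite -ip' comp_suml; apply: eq_bigr => j _.
  rewrite comp_sumr (bigD1 j) //= big1 ?addr0 => [|l lj].
    by rewrite -compA (rea2 (pi _)) comp1m.
  rewrite -compA (rea2 (p0 _ _ _)) ?comp0m ?compm0 //.
  by move=> /val_inj lj'; rewrite lj' eqxx in lj.
- move=> i Z f degZ Si; rewrite abE -[RHS]comp1m -ip.
  rewrite [in RHS](bigID (mem s)) /= compDl -[LHS]addr0; congr (_ + _); symmetry.
  rewrite big_mkcond comp_suml big1 // => j _; case: ifP => [|_]; last exact: comp0m.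
  move=> /asboolPn Sj; have ij : i <> d j by move=> ij; rewrite -ij in Sj.
  by rewrite -compA (grading_hom0 ij degZ (dE j) (prj j ∘ f)) compm0.
- move=> i Z f degZ Si; rewrite abE big_mkcond comp_suml big1 // => j _.
  case: ifP => [/asboolP Sj|_]; last exact: comp0m.
  have ij : i <> d j by move=> ij; rewrite -ij in Sj.
  by rewrite -compA (grading_hom0 ij degZ (dE j) (prj j ∘ f)) compm0.
Qed.

Lemma graded_sum_jointly_epi (S : I -> Prop) (V W : K) (f g : hom V W) :
  graded_sum deg S V ->
  (forall i Z (h : hom Z V), S i -> deg i Z -> f ∘ h = g ∘ h) -> f = g.
Proof.
move=> [J [A [dA [inj [prj [_ _ ip]]]]]] fg.
rewrite -[f]compm1 -[g]compm1 -ip !comp_sumr; apply: eq_bigr => j _.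
have [i [Si degi]] := dA j.
by rewrite !compA (fg i _ (inj j)).
Qed.

Lemma grading_sum V : graded_sum deg (fun=> True) V.
Proof. by have [] := gr. Qed.

Section Construction.
Variables (S : I -> Prop) (P : K -> Prop).
Hypothesis SP : forall V, graded_sum deg S V -> P V.

Let U V := projT1 (cid (grading_piece S V)).
Let aP V := projT2 (cid (grading_piece S V)).
Let a V := projT1 (cid (aP V)).
Let bP V := projT2 (cid (aP V)).
Let b V := projT1 (cid (bP V)).
Let abP V : [/\ graded_sum deg S (U V), b V ∘ a V = idm (U V),
      forall i Z (f : hom Z V), deg i Z -> S i -> a V ∘ b V ∘ f = f
    & forall i Z (f : hom Z V), deg i Z -> ~ S i -> a V ∘ b V ∘ f = 0].
Proof. exact: projT2 (cid (bP V)). Qed.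

Definition grading_projection : projection P.
Proof.
exists U a b.
- by move=> V; apply: SP; have [] := abP V.
- by move=> V; have [] := abP V.
(* It suffices to precompose with a homogeneous h. Since h and f ∘ h have the same source, both
   idempotents fix them or both kill them. *)
- move=> V V' f; apply: (graded_sum_jointly_epi (grading_sum V)).
  move=> i Z h _ degZ; rewrite -[LHS]compA -[RHS]compA.
  have [_ _ S1 S0] := abP V; have [_ _ S1' S0'] := abP V'.
  have [Si|Si] := pselect (S i).
    by rewrite (S1' _ _ _ degZ Si) (S1 _ _ _ degZ Si).
  by rewrite (S0' _ _ _ degZ Si) (S0 _ _ _ degZ Si) compm0.
Defined.

Lemma grading_pie1 i V : deg i V -> S i -> pie grading_projection V = idm V.
Proof.
move=> degV Si; have [_ _ S1 _] := abP V.
by have := S1 _ _ (idm V) degV Si; rewrite compm1.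
Qed.

Lemma grading_pie0 i V : deg i V -> ~ S i -> pie grading_projection V = 0.
Proof.
move=> degV Si; have [_ _ _ S0] := abP V.
by have := S0 _ _ (idm V) degV Si; rewrite compm1.
Qed.

End Construction.

Lemma eq_on_homogeneous (L : klcat k) (F G : klfun K L) (S : I -> Prop)
    (th th' : forall V, hom (F V) (G V)) :
  (forall V W (f : hom V W), th W ∘ fhom F f = fhom G f ∘ th V) ->
  (forall V W (f : hom V W), th' W ∘ fhom F f = fhom G f ∘ th' V) ->
  (forall i V, S i -> deg i V -> th V = th' V) ->
  forall V, graded_sum deg S V -> th V = th' V.
Proof.
move=> nat nat' eqth V [J [A [dA [inj [prj [_ _ ip]]]]]].
rewrite -[th V]compm1 -[th' V]compm1 -fhom1 -ip fhom_sum !comp_sumr.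
apply: eq_bigr => j _; have [i [Si degi]] := dA j.
by rewrite fhomM !compA nat nat' (eqth i).
Qed.

End GradingProjection.

Section FiniteSums.
Variables (k : fieldType) (K : klcat k).

Lemma comp_sum_seql (I : Type) (r : seq I) (a b c : K) (f : hom a b)
    (g : I -> hom b c) :
  (\sum_(i <- r) g i) ∘ f = \sum_(i <- r) (g i ∘ f).
Proof.
apply: (big_rec2 (fun x y => x ∘ f = y)); first exact: comp0m.
by move=> i x y _ <-; rewrite compDl.
Qed.

Lemma comp_sum_seqr (I : Type) (r : seq I) (a b c : K) (g : hom b c)
    (f : I -> hom a b) :
  g ∘ (\sum_(i <- r) f i) = \sum_(i <- r) (g ∘ f i).
Proof.
apply: (big_rec2 (fun x y => g ∘ x = y)); first exact: compm0.
by move=> i x y _ <-; rewrite compDr.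
Qed.

(** A Kronecker symbol: its diagonal values are identities transported along the equality of
    indices, so that all pairs are treated uniformly. *)
Definition delta (I : Type) (A : I -> K) (i j : I) : hom (A i) (A j) :=
  match pselect (i = j) with
  | left e => eqhom (congr1 A e)
  | right _ => 0
  end.

Lemma delta_eq (I : Type) (A : I -> K) i : delta A i i = idm (A i).
Proof. by rewrite /delta; case: pselect => // e; exact: eqhom_refl. Qed.

Lemma delta_neq (I : Type) (A : I -> K) i j : i <> j -> delta A i j = 0.
Proof. by rewrite /delta; case: pselect. Qed.

Lemma biproduct_fhom (L : klcat k) (F : klfun K L) (I : finType) (A : I -> K)
    (S : K) : is_biproduct A S -> is_biproduct (fun i => F (A i)) (F S).
Proof.
move=> [i [p [pi p0 ip]]].
exists (fun j => fhom F (i j)), (fun j => fhom F (p j)); split.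
- by move=> j; rewrite -fhomM pi fhom1.
- by move=> j l jl; rewrite -fhomM p0 // fhom0.
- by rewrite -fhom1 -ip fhom_sum; apply: eq_bigr => j _; rewrite fhomM.
Qed.

(** Some idempotent inj ∘ prj is nonzero; being a nonzero scalar, it is the identity. *)
Lemma summand_of_scalar (u : K) (I : finType) (A : I -> K) :
  idm u <> 0 ->
  (forall f : hom u u, exists c : k, f = c *: idm u) -> is_biproduct A u ->
  exists j, isomorphic (A j) u.
Proof.
move=> id0 scal [i [p [pi _ ip]]].
have [j ij0] : exists j, i j ∘ p j <> 0.
  apply: contrapT => /forallNP ij; apply: id0; rewrite -ip big1 // => j _.
  exact: contrapT (ij j).
have [c cE] := scal (i j ∘ p j).
have c0 : c != 0 by apply: contra_notN ij0 => /eqP c0; rewrite cE c0 scale0r.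
have ijK : i j ∘ p j = idm _.
  have : (i j ∘ p j) ∘ (i j ∘ p j) = i j ∘ p j.
    by rewrite compA -(compA (i j)) pi compm1.
  by rewrite {1}cE compZl comp1m [X in _ = X]cE => /(scalerI c0).
by exists j; constructor; exists (i j) (p j).
Qed.

End FiniteSums.

Section BalancedBiproducts.
Variables (k : fieldType) (D : moncat k) (P : rmodcat D) (Q : lmodcat D).
Local Notation T := (balanced_tensor P Q).

Lemma balanced_biproduct (I : finType) (A : I -> T) :
  exists S, is_biproduct A S.
Proof.
(* Formal sums are binary, so the biproduct is built along a list. Structure maps stay indexed by
   all of [I] and vanish off the list, which keeps the induction uniform. *)
suff H (r : seq I) : uniq r -> exists (S : T)
    (inj : forall i, hom (A i) S) (prj : forall i, hom S (A i)),
    [/\ forall i j, i \in r -> prj j ∘ inj i = delta A i j,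
        forall i, i \notin r -> inj i = 0,
        forall i, i \notin r -> prj i = 0
      & \sum_(i <- r) (inj i ∘ prj i) = idm S].
  have [S [inj [prj [pi _ _ ip]]]] := H _ (enum_uniq I).
  exists S, inj, prj; split.
  - by move=> i; rewrite pi ?mem_enum // delta_eq.
  - by move=> i j ij; rewrite pi ?mem_enum // delta_neq.
  - by rewrite -ip -big_enum.
elim: r => [|i r IHr].
  move=> _; exists Zero, (fun=> 0), (fun=> 0); split=> //.
  by rewrite big_nil; apply: esym; exact: (idm_zero P Q).
rewrite cons_uniq => /andP[ir /IHr[S [inj [prj [pi i0 p0 ip]]]]].
exists (Plus (A i) S), (fun j => inl_ _ _ ∘ delta A j i + inr_ _ _ ∘ inj j),
  (fun j => delta A i j ∘ prl_ _ _ + prj j ∘ prr_ _ _).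
have dd j l : j \in i :: r ->
    delta A i l ∘ delta A j i + prj l ∘ inj j = delta A j l.
  rewrite inE => /predU1P[->|jr].
    by rewrite delta_eq compm1 i0 // compm0 addr0.
  rewrite pi // (delta_neq A (i := j) (j := i)) ?compm0 ?add0r // => ji.
  by rewrite -ji jr in ir.
split.
- move=> j l jr; rewrite -(dd j l jr) compDl !compDr -!compA.
  rewrite (rea2 (prl_inl _ _)) (rea2 (prl_inr _ _)) (rea2 (prr_inl _ _)).
  by rewrite (rea2 (prr_inr _ _)) !comp0m !comp1m !compm0 addr0 add0r.
- move=> j; rewrite inE => /norP[/eqP ji jr].
  by rewrite i0 // delta_neq // !compm0 addr0.
- move=> j; rewrite inE => /norP[/eqP ji jr].
  by rewrite p0 // delta_neq ?comp0m ?addr0 // => ij; exact: ji.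
- rewrite big_cons delta_eq i0 // p0 // compm0 comp0m !addr0 compm1 comp1m.
  rewrite -[RHS]inl_prl; congr (_ + _).
  rewrite -[in RHS](compm1 (inr_ _ _)) -ip comp_sum_seqr comp_sum_seql.
  apply: eq_big_seq => j jr.
  have ji : j <> i by move=> ji; rewrite -ji jr in ir.
  rewrite (delta_neq _ ji) (delta_neq A (i := i) (j := j)); last by move=> /esym.
  by rewrite compm0 comp0m !add0r !compA.
Qed.

End BalancedBiproducts.

Section GradedPieces.
Variables (k : fieldType) (K : klcat k) (I : Type) (deg : I -> K -> Prop).
Hypotheses (gr : is_grading deg) (abK : is_abelian K).

Lemma graded_sum_eq i V : graded_sum deg (fun j => j = i) V -> deg i V.
Proof.
move=> [J [A [dA bip]]]; have [repl ab _ _] := gr.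
apply: (abelian_biproduct_closed (repl i) (ab i) _ bip) => j.
by have [_ [-> ]] := dA j.
Qed.

Definition deg_projection i : projection (deg i) :=
  grading_projection gr abK (@graded_sum_eq i).

(** Turns membership in a component into an equation between natural maps, which can then be checked
    on homogeneous pieces or on symbols. *)
Lemma deg_pie i V : deg i V <-> pie (deg_projection i) V = idm V.
Proof.
split=> [degV|pieV]; first exact: (grading_pie1 _ _ _ degV).
have [repl _ _ _] := gr; apply: repl (pobP (deg_projection i) V).
by constructor; exists (pin _ V) (pout _ V); [exact: pout_in | exact: pieV].
Qed.

Lemma deg_pie0 i j V : i <> j -> deg j V -> pie (deg_projection i) V = 0.
Proof. by move=> ij degV; apply: (grading_pie0 _ _ _ degV) => /esym. Qed.

End GradedPieces.

Section FullsubFunctor.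
Variables (k : fieldType) (A B : klcat k) (F : klfun A B).
Variables (P : A -> Prop) (P' : B -> Prop).
Hypothesis FP : forall a, P a -> P' (F a).

Definition fullsub_fun : klfun (fullsub P) (fullsub P').
Proof.
exists (fun a => exist P' (F (sval a)) (FP (svalP a)))
  (fun a b f => fhom F (f : hom (sval a) (sval b))).
- by move=> a b c f g; exact: fhom_lin.
- by move=> a; exact: fhom1.
- by move=> a b c g f; exact: fhomM.
Defined.

End FullsubFunctor.

(** * The equivalence *)

Section GradedFacts.
Variables (k : fieldType) (G : groupType) (C : graded_tensor_category k G).
Variables (X : gset G) (M : graded_module_category C X).

Lemma abelian_gt : is_abelian C.
Proof. by have [] := gt_tensor C. Qed.

Lemma abelian_gm : is_abelian M.
Proof. by have [[]] := gm_axioms M. Qed.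

Lemma biexact_gm : is_biexact (lact M).
Proof. by have [[]] := gm_axioms M. Qed.

Lemma grading_gm : is_grading (gl_deg (g := M)).
Proof. by have [] := gm_axioms M. Qed.

Lemma gm_act s y V A : gt_deg s V -> gl_deg y A ->
  gl_deg (g := M) (gs_act s y) (V ▷ A).
Proof. by have [_ _ H] := gm_axioms M; exact: H. Qed.

Lemma gs_actK s (y : X) : gs_act s^-1%g (gs_act s y) = y.
Proof. by rewrite -gs_actM mulVg gs_act1. Qed.

Lemma strongly_graded_unit (s : G) : is_strongly_graded C ->
  exists V W : C,
    [/\ gt_deg s V, gt_deg s^-1%g W & isomorphic (V ⊗ W) (munit C)].
Proof.
move=> strong; have [_ _ [e [e0 eP]]] := gt_tensor C.
have id0 : idm (munit C) <> 0.
  by move=> id0; apply: e0; rewrite -[e]comp1m id0 comp0m.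
have scal (f : hom (munit C) (munit C)) : exists c : k, f = c *: idm _.
  have [c fE] := eP f; have [d idE] := eP (idm _); exists (c / d).
  rewrite idE scalerA divfK //.
  by apply: contra_notN id0 => /eqP d0; rewrite idE d0 scale0r.
have deg1 : gt_deg (g := C) (s * s^-1)%g (munit C).
  by rewrite mulgV; exact: unit_deg.
have [F [_ [th _]]] := strong s s^-1%g.
pose u : fullsub (gt_deg (g := C) (s * s^-1)%g) := exist _ _ deg1.
have t : iso (sval (sval (F u))) (munit C).
  exact: (@Iso k C _ _ (ihom (th u)) (iinv (th u)) (iKl (th u)) (iKr (th u))).
have [J [V [W [VW bip]]]] := proj2_sig (F u).
have bip1 : is_biproduct (fun j => V j ⊗ W j) (munit C).
  by apply: biproduct_iso bip; constructor.
have [j VWj] := summand_of_scalar id0 scal bip1.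
by exists (V j), (W j); have [] := VW j; split.
Qed.

Variable x : X.

Definition stab_proj : projection (graded_sum (gt_deg (g := C)) (stab x)) :=
  grading_projection (gt_grading C) abelian_gt (S := stab x) (fun V h => h).

Definition point_proj : projection (gl_deg (g := M) x) :=
  deg_projection grading_gm abelian_gm x.

(** For U and V of degrees s and t with t in H, the product st lies in H iff s does, so both sides
    are identities or both vanish; naturality gives the general case. *)
Lemma stab_proj_tensor (U V : C) :
  graded_sum (gt_deg (g := C)) (stab x) V ->
  pie stab_proj (U ⊗ V) = pie stab_proj U ⊗h idm V.
Proof.
move=> SV; move: U; apply: (fun H U => H U (grading_sum (gt_grading C) U)).
apply: (@eq_on_homogeneous _ C _ _ C (bifun_r (mtens C) V)
  (bifun_r (mtens C) V) (fun=> True) (fun U => pie stab_proj (U ⊗ V))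
  (fun U => pie stab_proj U ⊗h idm V)).
- by move=> U U' f; exact: pie_nat.
- by move=> U U' f; funE; rewrite -!bhomM comp1m pie_nat.
move=> s U _ degU; move: V SV.
apply: (@eq_on_homogeneous _ C _ (gt_deg (g := C)) C (bifun_l (mtens C) U)
  (bifun_l (mtens C) U) (stab x) (fun V => pie stab_proj (U ⊗ V))
  (fun V => pie stab_proj U ⊗h idm V)).
- by move=> V V' f; exact: pie_nat.
- by move=> V V' f; funE; rewrite -!bhomM comp1m !compm1 comp1m.
move=> t V tx degV; have degUV := gt_mul degU degV.
have st : stab x (s * t)%g <-> stab x s by rewrite /stab gs_actM tx.
have [sx|sx] := pselect (stab x s).
  rewrite (grading_pie1 _ _ _ degUV) ?(grading_pie1 _ _ _ degU) ?bhom1 //.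
  exact/st.
rewrite (grading_pie0 _ _ _ degUV) ?(grading_pie0 _ _ _ degU) ?bhom0m //.
by move=> /st.
Qed.

Lemma stab_proj_act (U : C) (A : M) : gl_deg x A ->
  pie point_proj (U ▷ A) = pie stab_proj U ▷h idm A.
Proof.
move=> degA; move: U; apply: (fun H U => H U (grading_sum (gt_grading C) U)).
apply: (@eq_on_homogeneous _ C _ _ M (bifun_r (lact M) A)
  (bifun_r (lact M) A) (fun=> True) (fun U => pie point_proj (U ▷ A))
  (fun U => pie stab_proj U ▷h idm A)).
- by move=> U U' f; exact: pie_nat.
- by move=> U U' f; funE; rewrite -!bhomM comp1m pie_nat.
move=> s U _ degU; have degUA := gm_act degU degA.
have [sx|sx] := pselect (stab x s).
  rewrite (grading_pie1 _ _ _ degU) // bhom1.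
  by apply/deg_pie; rewrite -[x in gl_deg x]sx.
rewrite (grading_pie0 _ _ _ degU) // bhom0m.
by apply: (deg_pie0 _ _ _ degUA) => xs; apply: sx.
Qed.

Lemma coset_act s y (U : C) (A : M) :
  gs_act s x = y -> graded_sum (gt_deg (g := C)) (lcoset_stab x s) U -> gl_deg x A ->
  gl_deg y (U ▷ A).
Proof.
move=> sx degU degA; apply/(deg_pie grading_gm abelian_gm).
move: U degU.
apply: (@eq_on_homogeneous _ C _ (gt_deg (g := C)) M (bifun_r (lact M) A)
  (bifun_r (lact M) A) (lcoset_stab x s)
  (fun U => pie (deg_projection grading_gm abelian_gm y) (U ▷ A))
  (fun U => idm (U ▷ A))).
- by move=> U U' f; exact: pie_nat.
- by move=> U U' f; rewrite comp1m compm1.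
move=> t U [h [hx tE]] degU; apply/(deg_pie grading_gm abelian_gm).
by rewrite -sx -[in gs_act s x]hx -gs_actM -tE; exact: gm_act.
Qed.

End GradedFacts.

Section InducedDegree.
Variables (k : fieldType) (G : groupType) (C : graded_tensor_category k G).
Variables (X : gset G) (M N : graded_module_category C X) (x : X).
Variable S : pmodfun (component x M)
  (res_lmodcat (stab_unit C x) (@stab_tensor k G C X x) N).
Hypothesis degS : forall q : component x M, gl_deg x (S q : N).

(** With [deg_pie] the claim is an equation of natural maps, so it passes from symbols, handled by
    [coset_act], to formal sums. *)
Lemma ind_pm_deg y (A : induced x M) :
  gl_deg y A -> gl_deg y (ind_pm S (abelian_gm N) A).
Proof.
move=> [s [sx [B [[t] symB]]]]; have [repl _ _ _] := grading_gm N.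
apply: (repl y (ind_pm S (abelian_gm N) B)).
  by constructor; exact: (iso_sym (fhom_iso (ind_pm S (abelian_gm N)) t)).
change (gl_deg y (ind_fun S (abelian_gm N) B)).
apply/(deg_pie (grading_gm N) (abelian_gm N)).
set Phi := ind_fun S (abelian_gm N); set p := deg_projection _ _ y.
elim: B symB {t} => [U q|_|B1 IH1 B2 IH2].
- move=> degU; apply/(deg_pie (grading_gm N) (abelian_gm N)).
  exact: (coset_act sx degU (degS q)).
- rewrite -[pie p _]compm1 -[RHS]compm1 -(fhom1 Phi) idm_zero fhom0.
  by rewrite !compm0.
- move=> [sym1 sym2].
  have := inl_prl B1 B2.
  move=> /(congr1 (@fhom _ _ _ Phi _ _)); rewrite fhomD !fhomM fhom1 => ip.
  rewrite -[pie p _]compm1 -[RHS]ip -[in LHS]ip compDr !compA !pie_nat.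
  by rewrite IH1 // IH2 // !compm1.
Qed.

End InducedDegree.

Lemma sum_indicator (V : nmodType) (I : eqType) (r : seq I) (z : I) (v : V) :
  uniq r -> z \in r -> \sum_(y <- r) (if y == z then v else 0) = v.
Proof.
move=> ur zr; rewrite (bigD1_seq _ zr ur) /= eqxx big1 ?addr0 // => y yz.
by rewrite (negbTE yz).
Qed.

Section SymbolFunctor.
Variables (k : fieldType) (C : moncat k) (P : C -> Prop).
Variables (P1 : P (munit C)) (PM : forall V W, P V -> P W -> P (V ⊗ W)).
Variables (Q : lmodcat (submoncat P1 PM)) (q : Q).
Local Notation T := (balanced_tensor (regular_rmodcat P1 PM) Q).

Definition sym_fun : klfun C T.
Proof.
exists (fun U => @Sym _ _ (regular_rmodcat P1 PM) Q U q : T)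
  (fun U U' f => sx f (idm q)).
- by move=> A B c f g; exact: sx_linl.
- by move=> A; exact: sx1.
- by move=> A B E g f; exact: sxMl.
Defined.

End SymbolFunctor.

(** * Full faithfulness of Φ and transfer of structure along it *)

Section InducedGraded.
Variables (k : fieldType) (G : groupType) (C : graded_tensor_category k G).
Variables (X : gset G) (M : graded_module_category C X).
Hypotheses (strong : is_strongly_graded C) (trans : is_transitive X).
Variable x : X.

Local Notation degC := (gt_deg (g := C)).
Local Notation Q := (component x M).
Local Notation ind := (induced_lmodcat Q).
Local Notation R := (regular_rmodcat (stab_unit C x) (@stab_tensor k G C X x)).
Local Notation T := (balanced_tensor R Q).
Local Notation pC := (stab_proj C x).
Local Notation pM := (point_proj M x).

Definition ind_to : pmodfun ind M :=
  ind_pm (incl_pm (stab_unit C x) (@stab_tensor k G C X x)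
            (@stab_act k G C X x M)) (abelian_gm M).
Local Notation Phi := ind_to.

Lemma transporter (y : X) :
  {s : G & {V : C & {W : C & {kappa : iso (V ⊗ W) (munit C) |
     [/\ gs_act s x = y, degC s V & degC s^-1%g W]}}}}.
Proof.
have [s sx] := cid (trans x y).
have [V /cid[W [degV degW /inhabited_witness kappa]]] :=
  cid (strongly_graded_unit s strong).
by exists s, V, W, kappa.
Qed.

Definition tr_g y : G := projT1 (transporter y).
Definition tr_V y : C := projT1 (projT2 (transporter y)).
Definition tr_W y : C := projT1 (projT2 (projT2 (transporter y))).
Definition tr_k y : iso (tr_V y ⊗ tr_W y) (munit C) :=
  projT1 (projT2 (projT2 (projT2 (transporter y)))).

Lemma tr_P y :
  [/\ gs_act (tr_g y) x = y, degC (tr_g y) (tr_V y) & degC (tr_g y)^-1%g (tr_W y)].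
Proof. exact: projT2 (projT2 (projT2 (projT2 (transporter y)))). Qed.

Let eact := @stab_proj_act k G C X M x.
Let eten := @stab_proj_tensor k G C X x.

Definition tr_fun y : klfun M T :=
  shift_fun (stab_unit C x) (@stab_tensor k G C X x) (@stab_act k G C X x M) pM
    (tr_V y) (tr_W y).

Definition tr_a y (A : T) : hom A (tr_fun y (Phi A)) :=
  shift_a (abelian_gm M) pC pM (tr_k y) A.

Definition tr_b y (A : T) : hom (tr_fun y (Phi A)) A :=
  shift_b (abelian_gm M) pC pM (tr_k y) A.

Lemma tr_a_nat y (A B : T) (f : hom A B) :
  tr_a y B ∘ f = fhom (tr_fun y) (fhom Phi f) ∘ tr_a y A.
Proof. by apply: shift_a_nat; exact: eten. Qed.

Lemma tr_b_nat y (A B : T) (f : hom A B) :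
  tr_b y B ∘ fhom (tr_fun y) (fhom Phi f) = f ∘ tr_b y A.
Proof. by apply: shift_b_nat; [exact: eact | exact: eten]. Qed.

Lemma Phi_tr_b y (A B : T) (g : hom (Phi A) (Phi B)) :
  fhom Phi (tr_b y B) ∘ fhom Phi (fhom (tr_fun y) g) = g ∘ fhom Phi (tr_b y A).
Proof. by apply: Phi_shift_b_nat; [exact: eact | exact: eten]. Qed.

(** With g carrying x to y, the object [tr_W y ⊗ U] has degree g^-1 t, which lies in H exactly when
    t x = y; so b_y a_y is conjugate to an identity or to 0. *)
Lemma tr_ba_sym y t (U : C) (q : Q) : degC t U ->
  tr_b y (Sym (U : R) q : T) ∘ tr_a y (Sym (U : R) q : T) =
  if `[< gs_act t x = y >] then idm _ else 0.
Proof.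
move=> degU; have [gx _ degW] := tr_P y; have degWU := gt_mul degW degU.
rewrite /tr_a /tr_b shift_ba.
have ipE : part_in (abelian_gm M) pC pM (tr_W y ▷ (Sym (U : R) q : ind)) ∘
    part_out (abelian_gm M) pC pM (tr_W y ▷ (Sym (U : R) q : ind)) =
    sx (pie pC (tr_W y ⊗ U)) (idm q).
  exact: part_in_out.
rewrite [X in idm _ ▷h X]ipE.
case: asboolP => [ty|ty].
  have -> : pie pC (tr_W y ⊗ U) = idm _.
    apply: (grading_pie1 _ _ _ degWU).
    by rewrite /stab gs_actM ty; have := gs_actK (tr_g y) x; rewrite gx.
  rewrite sx1 [X in _ ∘ (X ∘ _)](bhom1 (lact ind)) [X in _ ∘ X]comp1m.
  exact: iKl.
have -> : pie pC (tr_W y ⊗ U) = 0.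
  apply: (grading_pie0 _ _ _ degWU); rewrite /stab gs_actM => ty'.
  by apply: ty; have := congr1 (gs_act (tr_g y)) ty'; rewrite -gs_actM mulgV gs_act1 gx.
have -> : sx (0 : hom (tr_W y ⊗ U) _) (idm q) = 0 := fhom0 (sym_fun q) _ _.
by rewrite [X in _ ∘ (X ∘ _)](bhomm0 (lact ind)) [X in _ ∘ X]comp0m; exact: compm0.
Qed.

(* The classical equality structure on X lets lists of points be compared. *)
Let tr_sum (s : seq {classic X}) (A : T) : hom A A :=
  \sum_(y <- s) (tr_b y A ∘ tr_a y A).

Lemma tr_sum_nat s (A B : T) (f : hom A B) : tr_sum s B ∘ f = f ∘ tr_sum s A.
Proof.
rewrite /tr_sum comp_sum_seql comp_sum_seqr; apply: eq_bigr => y _.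
by rewrite -compA tr_a_nat compA tr_b_nat compA.
Qed.

(** The statement covers every duplicate-free list containing [s], so the lists of two summands can
    be concatenated; surplus points contribute 0. *)
Lemma tr_sum_id (A : T) : exists s : seq {classic X},
  forall s', uniq s' -> {subset s <= s'} -> tr_sum s' A = idm A.
Proof.
elim: A => [U q||A [sA IHA] B [sB IHB]].
- have [J [V [dV [inj [prj [pi p0 ip]]]]]] := grading_sum (gt_grading C) (U : C).
  pose t j := projT1 (cid (dV j)).
  have degV j : degC (t j) (V j) by have [] := projT2 (cid (dV j)).
  exists [seq (gs_act (t j) x : {classic X}) | j <- enum J] => s' us' ss'.
  have idE : idm (Sym (U : R) q : T) =
      \sum_j (sx (inj j) (idm q) ∘ sx (prj j) (idm q)).
    transitivity (fhom (sym_fun q) (\sum_j (inj j ∘ prj j))).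
      by rewrite ip fhom1.
    by rewrite fhom_sum; apply: eq_bigr => j _; exact: sxMl.
  rewrite -[LHS]compm1 [in LHS]idE comp_sumr idE; apply: eq_bigr => j _.
  rewrite compA tr_sum_nat -compA; congr (_ ∘ _).
  rewrite -[RHS]comp1m; congr (_ ∘ _).
  have tjs' : (gs_act (t j) x : {classic X}) \in s'.
    by apply: ss'; apply: map_f; rewrite mem_enum.
  rewrite -[RHS](sum_indicator (idm _) us' tjs'); apply: eq_bigr => y _.
  rewrite (tr_ba_sym y q (degV j)); case: asboolP => [->|ty].
    by rewrite eqxx.
  by case: eqP => // yt; case: ty.
- by exists [::] => s' _ _; exact: from_zero_eq.
- exists (sA ++ sB) => s' us' ss'.
  rewrite -[LHS]compm1 -[RHS]inl_prl -[X in _ ∘ X]inl_prl compDr !compA.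
  rewrite !tr_sum_nat IHA ?IHB ?compm1 // => y ys; apply: ss';
    by rewrite mem_cat ys ?orbT.
Qed.

(** Inserting the sum of the b_y a_y before f and moving f past b_y expresses f through Φ f
    alone. *)
Lemma Phi_faithful : is_faithful Phi.
Proof.
move=> A B f f' ff'; have [s sid] := tr_sum_id A.
have us := undup_uniq s; have ss : {subset s <= undup s}.
  by move=> y; rewrite mem_undup.
rewrite -[f]compm1 -[f']compm1 -(sid _ us ss) !comp_sum_seqr.
by apply: eq_bigr => y _; rewrite (compA f) (compA f') -!tr_b_nat ff'.
Qed.

Lemma Phi_full : is_full Phi.
Proof.
move=> A B g; have [s sid] := tr_sum_id A.
have us := undup_uniq s; have ss : {subset s <= undup s}.
  by move=> y; rewrite mem_undup.
(* The expression of f through Φ f from the proof of faithfulness, with [g] in place of Φ f. *)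
exists (\sum_(y <- undup s) (tr_b y B ∘ fhom (tr_fun y) g ∘ tr_a y A)).
rewrite -[RHS]compm1 -fhom1 -(sid _ us ss) !fhom_sum comp_sum_seqr.
apply: eq_bigr => y _.
by rewrite fhomM (fhomM Phi (tr_b y B)) Phi_tr_b (fhomM Phi (tr_b y A)) compA.
Qed.

Lemma tr_W_deg y (A : M) : gl_deg y A -> gl_deg x (tr_W y ▷ A).
Proof.
move=> degA; have [gx _ degW] := tr_P y.
by have := gm_act degW degA; rewrite -[y in gs_act _ y]gx gs_actK.
Qed.

Definition tr_sym y (A : M) (degA : gl_deg y A) : T :=
  Sym (tr_V y : R) (exist _ _ (tr_W_deg degA) : Q).

Lemma tr_symP y (A : M) (degA : gl_deg y A) :
  isomorphic (Phi (tr_sym degA)) A.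
Proof. by constructor; exact: (iso_sym (coev (tr_k y) A)). Qed.

Lemma Phi_esurj : is_esurj Phi.
Proof.
move=> B; have [J [A [dA bip]]] := grading_sum (grading_gm M) B.
pose y j := projT1 (cid (dA j)).
have degA j : gl_deg (y j) (A j) by have [] := projT2 (cid (dA j)).
have [S bipS] := balanced_biproduct (fun j => tr_sym (degA j)).
exists S; have [inj [prj [pi p0 ip]]] := biproduct_fhom Phi bipS.
pose t j := @inhabited_witness _ (tr_symP (degA j)).
apply: (biproduct_isomorphic (A := A)) bip.
exists (fun j => inj j ∘ iinv (t j)), (fun j => t j ∘ prj j); split.
- by move=> j; rewrite -compA (rea2 (pi j)) comp1m iKr.
- by move=> j l jl; rewrite -compA (rea2 (p0 j l jl)) comp0m compm0.
- rewrite -ip; apply: eq_bigr => j _.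
  by rewrite -compA (rea2 (iKl _)) comp1m.
Qed.

(** For the converse, A is isomorphic to the single symbol [tr_sym degA]: their images under Φ are
    isomorphic and Φ reflects isomorphism. *)
Lemma Phi_deg y (A : induced x M) : gl_deg y A <-> gl_deg y (Phi A).
Proof.
split=> [degA|degA].
  by apply: ind_pm_deg degA => q; exact: svalP q.
have [gx degV _] := tr_P y; exists (tr_g y); split=> //.
exists (tr_sym degA); split.
  apply: isomorphic_sym.
  exact: (isomorphic_reflect Phi_full Phi_faithful (tr_symP degA)).
(* [tr_V y] is homogeneous of degree [tr_g y], the element of its coset with h = 1. *)
apply: (graded_sum1 (i := tr_g y) _ degV); exists 1%g; split.
  exact: gs_act1.
by rewrite mulg1.
Qed.

Lemma Phi_exact : is_exact Phi.
Proof. exact: (equiv_exact Phi_full Phi_faithful Phi_esurj). Qed.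

Lemma ind_module : is_module_category ind.
Proof.
split.
  exact: (abelian_transfer Phi_full Phi_faithful Phi_esurj (abelian_gm M)).
have [exl exr] := biexact_gm M; split=> [U|A].
  apply: (exact_reflect Phi_full Phi_faithful).
  apply: (@exact_natural_iso _ _ _ (comp_fun (bifun_l (lact M) U) Phi)).
    exists (fun A => iso_sym (pmphi Phi U A)) => A B f; funE.
    apply: (iso_mono (f := pmphi Phi U B)); apply: (iso_epi (f := pmphi Phi U A)).
    rewrite !compA [X in _ = X ∘ _ ∘ _](pmphi_nat Phi (idm U) f) iKr comp1m.
    by rewrite -!compA iKl compm1.
  exact: comp_exact Phi_exact (exl U).
apply: (exact_reflect Phi_full Phi_faithful).
apply: (@exact_natural_iso _ _ _ (bifun_r (lact M) (Phi A))); last exact: exr.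
exists (fun U => iso_sym (pmphi Phi U A)) => U V f; funE.
apply: (iso_mono (f := pmphi Phi V A)); apply: (iso_epi (f := pmphi Phi U A)).
rewrite !compA [X in _ = X ∘ _ ∘ _](pmphi_nat Phi f (idm (A : ind))) iKr comp1m.
by rewrite -!compA iKl compm1 fhom1.
Qed.

Lemma ind_graded : is_graded_module_category (induced x M).
Proof.
have [repl _ hom0 dec] := grading_gm M.
split; first exact: ind_module.
- split.
  + move=> y A B [t] /Phi_deg degA; apply/Phi_deg; apply: repl degA.
    by constructor; exact: (fhom_iso Phi t).
  + move=> y; have [_ ab _ _] := grading_gm M.
    pose F := @fullsub_fun k _ _ Phi _ _ (fun A => (Phi_deg y A).1).
    apply: (@abelian_transfer _ _ _ F _ _ _ (ab y)).
    * by move=> A B g; exact: Phi_full.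
    * by move=> A B f f'; exact: Phi_faithful.
    * move=> [B degB]; have [A [t]] := Phi_esurj B.
      have degA : gl_deg y (A : induced x M).
        apply/Phi_deg; apply: repl degB; constructor; exact: iso_sym.
      exists (exist _ A degA); constructor.
      exact: (@fullsub_iso k M _ (F (exist _ A degA)) (exist _ B degB) t).
  + move=> y z A B yz /Phi_deg degA /Phi_deg degB f; apply: Phi_faithful.
    by rewrite fhom0; exact: (hom0 _ _ _ _ yz degA degB).
  + move=> A; have [J [B [dB bip]]] := dec (Phi A).
    pose E j := projT1 (cid (Phi_esurj (B j))).
    have EP j : isomorphic (Phi (E j)) (B j) := projT2 (cid (Phi_esurj (B j))).
    exists J, E; split.
      move=> j; have [y [_ degB]] := dB j; exists y; split=> //.
      by apply/Phi_deg; apply: repl degB; exact: isomorphic_sym.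
    apply: (biproduct_reflect Phi_full Phi_faithful).
    pose t j := @inhabited_witness _ (EP j).
    have [inj [prj [pi p0 ip]]] := bip.
    exists (fun j => inj j ∘ t j), (fun j => iinv (t j) ∘ prj j); split.
    * by move=> j; rewrite -compA (rea2 (pi j)) comp1m iKl.
    * by move=> j l jl; rewrite -compA (rea2 (p0 j l jl)) comp0m compm0.
    * rewrite -ip; apply: eq_bigr => j _.
      by rewrite -compA (rea2 (iKr _)) comp1m.
- move=> s y U A degU /Phi_deg degA; apply/Phi_deg.
  apply: repl (gm_act degU degA); constructor.
  exact: (iso_sym (pmphi Phi U (A : ind))).
Qed.

Definition ind_from : pmodfun M ind := inv_pm Phi_full Phi_faithful Phi_esurj.

Lemma ind_from_equivalence : is_equivalence ind_from.
Proof. exact: inv_equivalence. Qed.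

Lemma ind_from_r : pm_iso (pm_comp Phi ind_from) (pm_id M).
Proof. exact: inv_pm_r. Qed.

Lemma ind_from_deg y (A : M) : gl_deg y A ->
  gl_deg (g := induced x M) y (ind_from A).
Proof.
move=> degA; apply/Phi_deg; have [repl _ _ _] := grading_gm M.
have [t _] := ind_from_r; apply: repl degA.
by constructor; exact: (iso_sym (t A)).
Qed.

Lemma ind_from_exact : is_exact ind_from.
Proof.
apply: (exact_reflect Phi_full Phi_faithful).
apply: (@exact_natural_iso _ _ _ (id_fun M)); last by move=> ? ? ? ? ?.
have [t [nat _]] := ind_from_r; exists (fun A => iso_sym (t A)) => A B f.
apply: (iso_mono (f := t B)); apply: (iso_epi (f := t A)).
rewrite (rea2 (iKr (t B))) comp1m -!compA iKl compm1.
exact: esym (nat _ _ f).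
Qed.

Lemma ind_equivalent : graded_equivalent M (induced x M).
Proof.
exists (@GradedModFun _ _ _ _ M (induced x M) (mf_of_pm ind_from_exact) ind_from_deg).
exact: ind_from_equivalence.
Qed.

End InducedGraded.

(** * The correspondence of functors *)

Section ComponentDetermines.
Variables (k : fieldType) (C : moncat k) (P : C -> Prop).
Variables (P1 : P (munit C)) (PM : forall V W, P V -> P W -> P (V ⊗ W)).
Variables (M : lmodcat C) (PMd : M -> Prop).
Hypothesis PQ : forall V A, P V -> PMd A -> PMd (V ▷ A).
Local Notation D := (submoncat P1 PM).
Local Notation R := (regular_rmodcat P1 PM).
Local Notation Q := (sublmodcat P1 PM PQ).
Local Notation T := (balanced_tensor R Q).
Local Notation ind := (induced_lmodcat Q).
Local Notation one := (munit C).
Hypothesis abM : is_abelian M.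
Local Notation Phi := (ind_pm (incl_pm P1 PM PQ) abM).

Section Uniqueness.
Variables (N : lmodcat C) (F F' : pmodfun M N).
Variable theta : forall q : Q, iso (F (sval q)) (F' (sval q)).
Hypotheses
  (theta_nat : forall (q q' : Q) (f : hom (sval q) (sval q')),
     theta q' ∘ fhom F f = fhom F' f ∘ theta q)
  (theta_phi : forall (V : D) (q : Q),
     pmphi F' (sval V) (sval q) ∘ theta (V ▷ q) =
     (idm (sval V) ▷h theta q) ∘ pmphi F (sval V) (sval q)).

Let t0 (U : R) (q : Q) : iso (F (Phi (Sym U q : T))) (F' (Phi (Sym U q : T))) :=
  iso_comp (iso_sym (pmphi F' (U : C) (sval q)))
    (iso_comp (bhom_iso (lact N) (iso_id (U : C)) (theta q))
              (pmphi F (U : C) (sval q))).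

Let t0E (U : C) (q : Q) :
  pmphi F' U (sval q) ∘ t0 U q =
  (idm U ▷h theta q) ∘ pmphi F U (sval q).
Proof. by rewrite /= (rea2 (iKr _)) comp1m. Qed.

(** Serves twice: with U from D it gives compatibility with alpha, and with arbitrary X and U
    compatibility with the module constraints. *)
Lemma t0_assoc (X U : C) (q : Q) :
  (idm X ▷h (pmphi F' U (sval q) ∘ t0 U q)) ∘
    (pmphi F X (U ▷ sval q) ∘ fhom F (lassoc X U (sval q))) =
  (idm X ▷h pmphi F' U (sval q)) ∘
    (pmphi F' X (U ▷ sval q) ∘ (fhom F' (lassoc X U (sval q)) ∘ t0 (X ⊗ U) q)).
Proof.
have aF := pmphi_assoc F X U (sval q); have aF' := pmphi_assoc F' X U (sval q).
rewrite -!compA in aF aF'.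
rewrite t0E lact_compr -compA -aF (rea3 (esym aF')) -compA t0E.
by rewrite -(bhom1 (mtens C)) [RHS]compA lassoc_nat -compA.
Qed.

Lemma component_symbols : pm_iso (pm_comp F Phi) (pm_comp F' Phi).
Proof.
have [||t [tnat tsym]] := @sym_iso k D R Q N (comp_fun F Phi) (comp_fun F' Phi) t0.
- move=> U U' q q' f g; funE.
  have Ef : fhom Phi (sy f g) =
      (f : hom (U : C) U') ▷h (g : hom (sval q) (sval q')).
    exact: Phi_sx.
  rewrite Ef; apply: (iso_mono (f := pmphi F' (U' : C) (sval q'))).
  rewrite compA [X in X ∘ _]t0E [RHS]compA pmphi_nat -!compA.
  rewrite [X in _ = _ ∘ X]t0E [X in _ ∘ X]pmphi_nat !compA -!lactM.
  by rewrite comp1m compm1 theta_nat.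
- move=> U V q; funE.
  have Ef : fhom Phi (al U V q) = lassoc (U : C) (sval V) (sval q).
    exact: Phi_ax.
  rewrite Ef; apply: (iso_mono (f := pmphi F' (U : C) (sval V ▷ sval q))).
  apply: (iso_mono (f := bhom_iso (lact N) (iso_id (U : C))
    (pmphi F' (sval V) (sval q)))).
  rewrite [RHS](_ : _ = (idm (U : C) ▷h pmphi F' (sval V) (sval q)) ∘
    (pmphi F' (U : C) (sval V ▷ sval q) ∘
      (fhom F' (lassoc (U : C) (sval V) (sval q)) ∘ t0 (U ⊗ sval V : C) q))) //.
  rewrite -t0_assoc t0E -theta_phi lact_compr -!compA.
  rewrite [X in _ = _ ∘ X](rea2 (esym (t0E (U : C) (V ▷ q)))) -compA.
  by rewrite /= -!compA.
exists t; split; first exact: tnat.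
move=> X A.
apply: (@eq_on_symbols k D R Q N
  (comp_fun (pm_comp F Phi) (bifun_l (lact ind) X : klfun T T))
  (comp_fun (bifun_l (lact N) X) (pm_comp F' Phi))
  (fun A => pmphi (pm_comp F' Phi) X (A : ind) ∘ t (X ▷ (A : ind)))
  (fun A => (idm X ▷h t A) ∘ pmphi (pm_comp F Phi) X (A : ind))) => {A}.
- move=> A B f; rewrite -[LHS]compA.
  transitivity (pmphi (pm_comp F' Phi) X (B : ind) ∘
    (fhom (pm_comp F' Phi) (idm X ▷h (f : hom (A : ind) B)) ∘
      t (X ▷ (A : ind)))).
    congr (_ ∘ _).
    exact: (tnat (X ▷ (A : ind)) (X ▷ (B : ind))
      (idm X ▷h (f : hom (A : ind) B))).
  rewrite [LHS]compA [RHS]compA; congr (_ ∘ _).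
  exact: (pmphi_nat (pm_comp F' Phi) (idm X) f).
- move=> A B f; rewrite -[LHS]compA.
  transitivity ((idm X ▷h t B) ∘ ((idm X ▷h fhom (pm_comp F Phi) f) ∘
    pmphi (pm_comp F Phi) X (A : ind))).
    by congr (_ ∘ _); exact: (pmphi_nat (pm_comp F Phi) (idm X) f).
  rewrite [LHS]compA [RHS]compA; congr (_ ∘ _).
  by rewrite -[LHS]lactM -[RHS]lactM tnat.
- move=> U q.
  have phiE : ihom (pmphi Phi X (Sym U q : ind)) = lassoc X (U : C) (sval q).
    exact: (ind_phi_sym (incl_pm P1 PM PQ)).
  have L (H : pmodfun M N) : ihom (pmphi (pm_comp H Phi) X (Sym U q : ind)) =
      pmphi H X (U ▷ sval q) ∘ fhom H (lassoc X (U : C) (sval q)).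
    by rewrite -phiE.
  have tX : ihom (t (X ▷ (Sym U q : ind))) = t0 (X ⊗ (U : C) : R) q.
    exact: (tsym (X ⊗ (U : C) : R) q).
  rewrite !L tsym tX.
  apply: (iso_mono (f := bhom_iso (lact N) (iso_id X)
    (pmphi F' (U : C) (sval q)))).
  rewrite -!(compA (ihom (pmphi F' X _))) -[LHS]t0_assoc.
  by rewrite [RHS]compA -lact_compr.
Qed.

End Uniqueness.

Section Extension.
Variables (N : lmodcat C) (S : pmodfun Q (res_lmodcat P1 PM N)).
Hypothesis abN : is_abelian N.
Local Notation Psi := (ind_pm S abN).
Variable E : pmodfun M ind.
Variable e : forall A : M, iso (Phi (E A)) A.
Hypotheses
  (e_nat : forall (A B : M) (f : hom A B),
     e B ∘ fhom Phi (fhom E f) = f ∘ e A)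
  (e_phi : forall (X : C) (A : M),
     ihom (e (X ▷ A)) = (idm X ▷h e A) ∘ (pmphi Phi X (E A) ∘ fhom Phi (pmphi E X A)))
  (full : is_full Phi) (faith : is_faithful Phi).

Let J (q : Q) : ind := Sym (one : R) q : T.

(** E q is identified with the symbol [1, q], since Φ [1, q] = 1 ▷ q ≅ q. *)
Let j_data (q : Q) : exists t : iso (E (sval q)) (J q),
  fhom Phi t = iinv (unitor (sval q)) ∘ e (sval q).
Proof.
exact: (@fhom_iso_lift _ _ _ Phi (E (sval q)) (J q)
  (iso_comp (iso_sym (unitor (sval q))) (e (sval q))) full faith).
Qed.

Let j q := projT1 (cid (j_data q)).

Let jE q : unitor (sval q) ∘ fhom Phi (j q) = e (sval q).
Proof. by rewrite (projT2 (cid (j_data q))) (rea2 (iKr _)) comp1m. Qed.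

Let Jh (q q' : Q) (f : hom q q') : hom (J q) (J q') := sx (idm one) f.

Let j_nat (q q' : Q) (f : hom q q') :
  j q' ∘ fhom E (f : hom (sval q) (sval q')) = Jh f ∘ j q.
Proof.
apply: faith; apply: (iso_mono (f := unitor (sval q'))).
rewrite !fhomM (compA (ihom (unitor _))) jE e_nat.
have -> : fhom Phi (Jh f) = idm one ▷h (f : hom (sval q) (sval q')).
  exact: Phi_sx.
rewrite [RHS]compA [X in _ = X ∘ _]unitor_nat -compA jE.
by [].
Qed.

(** The map V ▷ [1, q] = [V ⊗ 1, q] = [1 ⊗ V, q] → [1, V ▷ q]. By [kh_j] it corresponds to the
    constraint of [E], and it can be evaluated under both Φ and Ψ. *)
Let kh (V : D) (q : Q) : hom (sval V ▷ J q) (J (V ▷ q)) :=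
  ax one V q ∘
    sx (eqhom (esym (munitl (sval V))) ∘ eqhom (munitr (sval V))) (idm q).

Let lamK (V : C) :
  eqhom (munitl V) ∘ (eqhom (esym (munitl V)) ∘ eqhom (munitr V)) =
  eqhom (munitr V).
Proof. by rewrite compA eqhom_symKr comp1m. Qed.

Let Phi_kh (V : D) (q : Q) :
  unitor (sval V ▷ sval q) ∘ fhom Phi (kh V q) =
  (idm (sval V) ▷h unitor (sval q)) ∘ pmphi Phi (sval V) (J q).
Proof.
have -> : fhom Phi (kh V q) = lassoc one (sval V) (sval q) ∘
    ((eqhom (esym (munitl (sval V))) ∘ eqhom (munitr (sval V))) ▷h
       idm (sval q)).
  by rewrite [LHS]fhomM Phi_ax; congr (_ ∘ _); exact: Phi_sx.
have -> : ihom (pmphi Phi (sval V) (J q)) = lassoc (sval V) one (sval q).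
  exact: (ind_phi_sym (incl_pm P1 PM PQ)).
by rewrite compA unitor_lact -lact_compl lamK unitor_triangle.
Qed.

Let phiS (V : D) (q : Q) : iso (S (V ▷ q) : N) (sval V ▷ (S q : N)) :=
  @Iso k N _ _ (pmphi S V q) (iinv (pmphi S V q))
    (iKl (pmphi S V q)) (iKr (pmphi S V q)).

Let Psi_kh (V : D) (q : Q) :
  phiS V q ∘ (unitor (S (V ▷ q) : N) ∘ fhom Psi (kh V q)) =
  (idm (sval V) ▷h unitor (S q : N)) ∘ pmphi Psi (sval V) (J q).
Proof.
have -> : fhom Psi (kh V q) = (idm one ▷h iinv (phiS V q)) ∘
    lassoc one (sval V) (S q : N) ∘
    ((eqhom (esym (munitl (sval V))) ∘ eqhom (munitr (sval V))) ▷h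
       idm (S q : N)).
  rewrite [LHS]fhomM; congr (_ ∘ _); first exact: ind_ax.
  by rewrite -[idm (S q : N)](fhom1 S); exact: ind_sx.
have -> : ihom (pmphi Psi (sval V) (J q)) = lassoc (sval V) one (S q : N).
  exact: ind_phi_sym.
rewrite -!compA (rea2 (unitor_nat _)) -compA (rea2 (iKr _)) comp1m.
by rewrite compA unitor_lact -lact_compl lamK unitor_triangle.
Qed.

Let kh_j (V : D) (q : Q) :
  kh V q ∘ ((idm (sval V) ▷h j q) ∘ pmphi E (sval V) (sval q)) =
  j (V ▷ q).
Proof.
apply: faith; apply: (iso_mono (f := unitor (sval V ▷ sval q))).
transitivity (ihom (e (sval V ▷ sval q))); last exact: esym (jE (V ▷ q)).
transitivity (unitor (sval V ▷ sval q) ∘ fhom Phi (kh V q) ∘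
  (fhom Phi (idm (sval V) ▷h (j q : hom (_ : ind) _)) ∘
   fhom Phi (pmphi E (sval V) (sval q)))).
  rewrite -[RHS]compA -!(fhomM Phi); congr (_ ∘ _).
  exact (fhomM Phi (kh V q : hom (_ : ind) (_ : ind)) _).
rewrite e_phi Phi_kh -[LHS]compA (compA (ihom (pmphi Phi _ _))).
rewrite pmphi_nat -compA [LHS]compA; congr (_ ∘ _).
by rewrite -[LHS]lact_compr jE.
Qed.

(** The isomorphism is Ψ E q ≅ Ψ [1, q] = 1 ▷ S q ≅ S q. *)
Lemma ind_extends : exists theta : forall q : Q,
    iso (Psi (E (sval q))) (S q : N),
  (forall (q q' : Q) (f : hom q q'),
     theta q' ∘ fhom Psi (fhom E (f : hom (sval q) (sval q'))) =
     (fhom S f : hom (S q : N) (S q' : N)) ∘ theta q) /\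
  (forall (V : D) (q : Q),
     (ihom (pmphi S V q) : hom (S (V ▷ q) : N) (sval V ▷ (S q : N))) ∘
       theta (V ▷ q) =
     (idm (sval V) ▷h theta q) ∘ pmphi (pm_comp Psi E) (sval V) (sval q)).
Proof.
exists (fun q => iso_comp (unitor (S q : N)) (fhom_iso Psi (j q))); split.
- move=> q q' f.
  have H : fhom Psi (j q') ∘ fhom Psi (fhom E (f : hom (sval q) (sval q'))) =
      (idm one ▷h (fhom S f : hom (S q : N) (S q'))) ∘ fhom Psi (j q).
    transitivity (fhom Psi (Jh f) ∘ fhom Psi (j q)).
      by rewrite -[LHS](fhomM Psi) j_nat; exact: (fhomM Psi (Jh f)).
    by congr (_ ∘ _); exact: ind_sx.
  rewrite -[LHS]compA.
  transitivity (unitor (S q' : N) ∘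
    ((idm one ▷h (fhom S f : hom (S q : N) (S q'))) ∘ fhom Psi (j q))).
    by congr (_ ∘ _); exact: H.
  by rewrite compA unitor_nat -compA.
- move=> V q; rewrite -[ihom (pmphi S V q)]/(ihom (phiS V q)).
  transitivity (phiS V q ∘ (unitor (S (V ▷ q) : N) ∘ fhom Psi (kh V q)) ∘
    (fhom Psi (idm (sval V) ▷h (j q : hom (_ : ind) _)) ∘
     fhom Psi (pmphi E (sval V) (sval q)))).
    rewrite -[RHS]compA -[in RHS](compA (ihom (unitor _))) -!(fhomM Psi).
    transitivity (phiS V q ∘ (unitor (S (V ▷ q) : N) ∘ fhom Psi (j (V ▷ q)))).
      by [].
    rewrite -kh_j; congr (_ ∘ (_ ∘ _)).
    exact (fhomM Psi (kh V q : hom (_ : ind) (_ : ind)) _).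
  rewrite Psi_kh -[LHS]compA (compA (ihom (pmphi Psi _ _))).
  rewrite pmphi_nat -(compA (idm (sval V) ▷h fhom Psi _)) [LHS]compA.
  by congr (_ ∘ _); exact: (esym (lact_compr _ _ _)).
Qed.

End Extension.

End ComponentDetermines.

(** A factorization through F f is assembled from factorizations through the K_i f, by the finite
    sum at [y]; its uniqueness uses the sum at [x]. The index set may be infinite. *)
Lemma retract_kernel (k : fieldType) (A B : klcat k) (F : klfun A B)
    (I : Type) (K : I -> klfun A B)
    (a : forall i x, hom (F x) (K i x)) (b : forall i x, hom (K i x) (F x))
    (x y z : A) (f : hom x y) (p : hom y z) :
  (forall i x y (f : hom x y), a i y ∘ fhom F f = fhom (K i) f ∘ a i x) ->
  (forall i x y (f : hom x y), b i y ∘ fhom (K i) f = fhom F f ∘ b i x) ->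
  (forall x, exists r : seq I, \sum_(i <- r) (b i x ∘ a i x) = idm (F x)) ->
  is_kernel p f ->
  (forall i, is_kernel (fhom (K i) p) (fhom (K i) f)) ->
  is_kernel (fhom F p) (fhom F f).
Proof.
move=> anat bnat ba kerpf kerK; split.
  by have [pf _] := kerpf; rewrite -fhomM pf fhom0.
move=> w g pg.
have K_uni i := (kerK i).2.
have uP i : exists u : hom w (K i x), fhom (K i) f ∘ u = a i y ∘ g.
  have [|u [fu _]] := K_uni i w (a i y ∘ g); last by exists u.
  by rewrite compA -anat -compA pg compm0.
pose u i := projT1 (cid (uP i)).
have uE i : fhom (K i) f ∘ u i = a i y ∘ g := projT2 (cid (uP i)).
have inj (v v' : hom w (F x)) : fhom F f ∘ v = fhom F f ∘ v' -> v = v'.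
  move=> fv; have [r ri] := ba x.
  rewrite -[v]comp1m -[v']comp1m -ri !comp_sum_seql; apply: eq_bigr => i _.
  rewrite -!compA; congr (_ ∘ _).
  have [|c [_ cu]] := K_uni i w (a i y ∘ (fhom F f ∘ v)).
    rewrite compA -anat -compA (compA (fhom F p)) -fhomM.
    by have [-> _] := kerpf; rewrite fhom0 comp0m compm0.
  rewrite -(cu (a i x ∘ v)); last by rewrite compA -anat compA.
  by apply: cu; rewrite fv compA -anat compA.
have [r ri] := ba y.
exists (\sum_(i <- r) (b i x ∘ u i)); split=> [|v fv].
  rewrite comp_sum_seqr -[g]comp1m -ri comp_sum_seql; apply: eq_bigr => i _.
  by rewrite compA -bnat -compA uE compA.
apply: inj; rewrite fv comp_sum_seqr -[RHS]comp1m -ri comp_sum_seql.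
by apply: eq_bigr => i _; rewrite compA -bnat -compA uE compA.
Qed.

Lemma retract_exact (k : fieldType) (A B : klcat k) (F : klfun A B)
    (I : Type) (K : I -> klfun A B)
    (a : forall i x, hom (F x) (K i x)) (b : forall i x, hom (K i x) (F x)) :
  (forall i x y (f : hom x y), a i y ∘ fhom F f = fhom (K i) f ∘ a i x) ->
  (forall i x y (f : hom x y), b i y ∘ fhom (K i) f = fhom F f ∘ b i x) ->
  (forall x, exists r : seq I, \sum_(i <- r) (b i x ∘ a i x) = idm (F x)) ->
  (forall i, is_exact (K i)) -> is_exact F.
Proof.
move=> anat bnat ba exK x y z f p ker coker; split.
  apply: (retract_kernel anat bnat ba ker) => i.
  by have [] := exK i _ _ _ _ _ ker coker.
(* Passing to opposite categories exchanges the section [a] and the retraction [b]. *)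
apply: (@retract_kernel k (opcat A) (opcat B) (opfun F) I (fun i => opfun (K i))
  (fun i x => b i x) (fun i x => a i x) z y x p f) => //.
- by move=> i u v g; exact: esym (bnat i v u g).
- by move=> i u v g; exact: esym (anat i v u g).
- by move=> i; have [] := exK i _ _ _ _ _ ker coker.
Qed.

(** Classes are predicates, so extensionality turns equivalent representatives into equal classes;
    both directions of the bijection choose representatives. *)
Lemma isoclasses_bijection (T T' : Type) (R : T -> T -> Prop)
    (R' : T' -> T' -> Prop) (f : T -> T') :
  (forall a, R a a) -> (forall a b, R a b -> R b a) ->
  (forall a b c, R a b -> R b c -> R a c) ->
  (forall a, R' a a) -> (forall a b, R' a b -> R' b a) ->
  (forall a b c, R' a b -> R' b c -> R' a c) ->
  (forall a b, R a b <-> R' (f a) (f b)) ->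
  (forall b, exists a, R' (f a) b) ->
  exists Phi : isoclasses R -> isoclasses R', bijective Phi.
Proof.
move=> r1 r2 r3 s1 s2 s3 fR fsurj.
have eqR a b : R a = R b <-> R a b.
  split=> [->|ab]; first exact: r1.
  by apply/funext => c; apply/propext; split=> ?; [apply: r3 (r2 _ _ ab) _ | apply: r3 ab _].
have eqR' a b : R' a = R' b <-> R' a b.
  split=> [->|ab]; first exact: s1.
  by apply/funext => c; apply/propext; split=> ?; [apply: s3 (s2 _ _ ab) _ | apply: s3 ab _].
pose rep (S : isoclasses R) := projT1 (cid (svalP S)).
have repE (S : isoclasses R) : sval S = R (rep S) := projT2 (cid (svalP S)).
pose rep' (S : isoclasses R') := projT1 (cid (svalP S)).
have rep'E (S : isoclasses R') : sval S = R' (rep' S) := projT2 (cid (svalP S)).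
pose g b := projT1 (cid (fsurj b)).
have gE b : R' (f (g b)) b := projT2 (cid (fsurj b)).
pose c (a : T) : isoclasses R := exist _ (R a) (ex_intro _ a erefl).
pose c' (a : T') : isoclasses R' := exist _ (R' a) (ex_intro _ a erefl).
have ext (U : Type) (H : U -> Prop) (S S' : {u | H u}) :
    sval S = sval S' -> S = S'.
  by case: S S' => [u p] [u' p'] /= e; exact: eq_exist.
exists (fun S => c' (f (rep S))); exists (fun S => c (g (rep' S))) => S.
  apply: ext; rewrite (repE S); apply/eqR/fR.
  apply: s3 (gE _) _; apply/eqR'.
  by rewrite -(rep'E (c' (f (rep S)))).
apply: ext; rewrite (rep'E S); apply/eqR'.
apply: s3 (gE _); apply/fR/eqR.
by rewrite -(repE (c (g (rep' S)))).
Qed.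

Lemma modfun_iso_refl (k : fieldType) (D : moncat k) (M N : lmodcat D)
    (F : modfun M N) : modfun_isomorphic F F.
Proof.
exists (fun A => iso_id (F A)); split=> [A B f|X A] /=.
  by rewrite comp1m compm1.
by rewrite bhom1 comp1m compm1.
Qed.

Lemma modfun_iso_sym (k : fieldType) (D : moncat k) (M N : lmodcat D)
    (F F' : modfun M N) : modfun_isomorphic F F' -> modfun_isomorphic F' F.
Proof.
move=> [t [tn tp]]; exists (fun A => iso_sym (t A)); split=> [A B f|X A].
  apply: (iso_mono (f := t B)); apply: (iso_epi (f := t A)).
  rewrite (rea2 (iKr (t B))) comp1m -!compA iKl compm1.
  exact: esym (tn _ _ f).
apply: (iso_mono (f := bhom_iso (lact N) (iso_id X) (t A))).
apply: (iso_epi (f := t (X ▷ A))).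
have K := iKr (bhom_iso (lact N) (iso_id X) (t A)); rewrite /= in K *.
by rewrite -!compA iKl compm1 -(tp X A) (rea2 K) comp1m.
Qed.

Lemma modfun_iso_trans (k : fieldType) (D : moncat k) (M N : lmodcat D)
    (F F' F'' : modfun M N) :
  modfun_isomorphic F F' -> modfun_isomorphic F' F'' -> modfun_isomorphic F F''.
Proof.
move=> [t [tn tp]] [u [un up]]; exists (fun A => iso_comp (u A) (t A)).
split=> [A B f|X A] /=; first by rewrite -compA tn compA un compA.
by rewrite compA up -compA tp compA -lact_compr.
Qed.

Section Restriction.
Variables (k : fieldType) (G : groupType) (C : graded_tensor_category k G).
Variables (X : gset G) (M N : graded_module_category C X) (x : X).

Lemma component_exact (L : graded_module_category C X) :
  is_exact (fullsub_incl (gl_deg (g := L) x)).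
Proof.
apply: (@fullsub_incl_exact _ _ _ (point_proj L x)) => V degV.
exact: (deg_pie (grading_gm L) (abelian_gm L) x V).1.
Qed.

Lemma fullsub_incl_full (K : klcat k) (P : K -> Prop) : is_full (fullsub_incl P).
Proof. by move=> a b g; exists g. Qed.

Lemma fullsub_incl_faithful (K : klcat k) (P : K -> Prop) :
  is_faithful (fullsub_incl P).
Proof. by move=> a b f f'. Qed.

Definition res_mf (F : graded_modfun M N) :
  modfun (component x M) (component x N).
Proof.
exists (fullsub_fun (@gf_deg _ _ _ _ _ _ F x) : klfun (component x M) (component x N))
  (fun (V : stab_cat C x) (A : component x M) =>
     @fullsub_iso k N (gl_deg (g := N) x)
       (fullsub_fun (@gf_deg _ _ _ _ _ _ F x) (V ▷ A))
       ((V : stab_cat C x) ▷ (fullsub_fun (@gf_deg _ _ _ _ _ _ F x) A : component x N))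
       (mfphi F (sval V) (sval A))).
- apply: (exact_reflect (@fullsub_incl_full N _) (@fullsub_incl_faithful N _)).
  exact: (comp_exact (@component_exact M) (@mfexact _ _ _ _ F)).
- move=> V V' A A' f g.
  exact: (@mfphi_nat _ _ _ _ F (sval V) (sval V') (sval A) (sval A') f g).
- move=> U V A; exact: (mfphi_assoc F (sval U) (sval V) (sval A)).
Defined.

Lemma res_mf_iso (F F' : graded_modfun M N) :
  modfun_isomorphic F F' -> modfun_isomorphic (res_mf F) (res_mf F').
Proof.
move=> [t [tn tp]].
exists (fun A => @fullsub_iso k N _ (res_mf F A) (res_mf F' A) (t (sval A))).
split=> [A B f|V A].
  exact: (tn (sval A) (sval B) f).
exact: (tp (sval V) (sval A)).
Qed.

(** The same functor regarded as landing in [N] with scalars restricted to C_H, the form that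
    [ind_pm] extends. *)
Definition component_pm (T : modfun (component x M) (component x N)) :
  pmodfun (component x M)
    (res_lmodcat (stab_unit C x) (@stab_tensor k G C X x) N).
Proof.
exists (comp_fun (fullsub_incl (gl_deg (g := N) x))
          (mffun T : klfun (component x M) (fullsub (gl_deg (g := N) x)))
        : klfun (component x M) (res_lmodcat _ _ N))
  (fun V A => @Iso k N _ _ (mfphi T V A) (iinv (mfphi T V A))
     (iKl (mfphi T V A)) (iKr (mfphi T V A))).
- by move=> V V' A A' f g; exact: (mfphi_nat T f g).
- by move=> U V A; exact: (mfphi_assoc T U V A).
Defined.

Lemma res_mf_iso_of (F : graded_modfun M N)
    (S : modfun (component x M) (component x N))
    (t : forall q, iso (F (sval q)) (component_pm S q : N)) :
  (forall (q q' : component x M) (f : hom q q'),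
     t q' ∘ fhom F (f : hom (sval q) (sval q')) =
     (fhom (component_pm S) f : hom (_ : N) _) ∘ t q) ->
  (forall (V : stab_cat C x) (q : component x M),
     (ihom (pmphi (component_pm S) V q) :
       hom (component_pm S (V ▷ q) : N) (sval V ▷ (component_pm S q : N))) ∘
       t (V ▷ q) =
     (idm (sval V) ▷h t q) ∘ mfphi F (sval V) (sval q)) ->
  modfun_isomorphic (res_mf F) S.
Proof.
move=> tn tp.
exists (fun q => @fullsub_iso k N _ (res_mf F q) (S q) (t q)).
by split=> [q q' f|V q]; [exact: tn | exact: tp].
Qed.

End Restriction.

Section Correspondence.
Variables (k : fieldType) (G : groupType) (C : graded_tensor_category k G).
Variables (X : gset G) (M N : graded_module_category C X).
Hypotheses (strong : is_strongly_graded C) (trans : is_transitive X).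
Variable x : X.

Local Notation Q := (component x M).
Local Notation ind := (induced_lmodcat Q).
Local Notation R := (regular_rmodcat (stab_unit C x) (@stab_tensor k G C X x)).
Local Notation T := (balanced_tensor R Q).
Local Notation Phi := (ind_to M x).
Local Notation E := (ind_from M strong trans x).

Lemma res_mf_inj (F F' : graded_modfun M N) :
  modfun_isomorphic (res_mf x F) (res_mf x F') -> modfun_isomorphic F F'.
Proof.
move=> [t [tn tp]].
pose th (q : Q) : iso (F (sval q)) (F' (sval q)) :=
  @Iso k N _ _ (ihom (t q)) (iinv (t q)) (iKl (t q)) (iKr (t q)).
apply: (pm_iso_cancel (F := pm_of_mf F) (F' := pm_of_mf F')
  (ind_from_r M strong trans x)).
apply: (@component_symbols k C _ (stab_unit C x) (@stab_tensor k G C X x) M _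
  (@stab_act k G C X x M) (abelian_gm M) N (pm_of_mf F) (pm_of_mf F') th).
- by move=> q q' f; exact: (tn q q' f).
- by move=> V q; exact: (tp V q).
Qed.

Variable S : modfun (component x M) (component x N).
Local Notation Psi := (ind_pm (component_pm S) (abelian_gm N)).

(** By computation the composite sends A to (V ⊗ 1) ▷ S(π(W ▷ A)), a composite of exact functors;
    hence the identity components of the comparison. *)
Lemma Psi_tr_exact y :
  is_exact (comp_fun Psi (tr_fun M strong trans x y)).
Proof.
have [exl exr] := biexact_gm N; have [exlM _] := biexact_gm M.
pose K1 : klfun M Q :=
  comp_fun (proj_fun (point_proj M x)) (bifun_l (lact M) (tr_W strong trans x y)).
pose K2 : klfun M N := comp_fun (fullsub_incl (gl_deg (g := N) x))
  (comp_fun (mffun S : klfun Q (fullsub (gl_deg (g := N) x))) K1).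
apply: (@exact_natural_iso _ _ _
  (comp_fun (bifun_l (lact N) (tr_V strong trans x y ⊗ munit C)) K2)).
  exists (fun A => iso_id _) => A B f.
  rewrite [LHS]comp1m [RHS]compm1.
  pose g : hom (K1 A) (K1 B) := fhom K1 f.
  have trE : fhom (tr_fun M strong trans x y) f =
      sx (idm (tr_V strong trans x y) ⊗h idm (munit C)) g.
    by rewrite -act_sx -ind_actE.
  transitivity (fhom Psi (sx (idm (tr_V strong trans x y) ⊗h idm (munit C)) g)).
    by apply: esym; rewrite [LHS]ind_sx bhom1.
  by rewrite -trE.
apply: comp_exact (exl _).
apply: comp_exact (@component_exact k G C X x N).
apply: (@comp_exact _ _ _ _ (mffun S) K1); last exact: mfexact.
apply: comp_exact (exlM _) _.
apply: (exact_reflect (@fullsub_incl_full k M _) (@fullsub_incl_faithful k M _)).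
exact: proj_fun_exact.
Qed.

(** Conjugating a_y and b_y by Φ E ≅ id makes E a locally finite retract of the functors [tr_fun y];
    applying Ψ allows [retract_exact] to conclude. *)
Lemma extension_exact : is_exact (pm_comp Psi E).
Proof.
have [e [e_nat _]] := ind_from_r M strong trans x.
pose K y := comp_fun Psi (tr_fun M strong trans x y).
pose W y := tr_fun M strong trans x y.
pose a y (A : M) : hom (E A : T) (W y A) :=
  fhom (W y) (e A) ∘ tr_a strong trans y (E A : T).
pose b y (A : M) : hom (W y A) (E A : T) :=
  tr_b strong trans y (E A : T) ∘ fhom (W y) (iinv (e A)).
have a_nat y (A B : M) (f : hom A B) :
    a y B ∘ (fhom E f : hom (E A : T) (E B)) = fhom (W y) f ∘ a y A.
  rewrite -[LHS]compA tr_a_nat [LHS]compA [RHS]compA; congr (_ ∘ _).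
  by rewrite -[LHS]fhomM -[RHS]fhomM; congr fhom; exact: e_nat.
have b_nat y (A B : M) (f : hom A B) :
    b y B ∘ fhom (W y) f = (fhom E f : hom (E A : T) (E B)) ∘ b y A.
  rewrite -[LHS]compA [RHS]compA -tr_b_nat -[RHS]compA; congr (_ ∘ _).
  rewrite -[LHS]fhomM -[RHS]fhomM; congr fhom.
  apply: (iso_mono (f := e B)); apply: (iso_epi (f := e A)).
  rewrite (rea2 (iKr (e B))) comp1m -!compA iKl compm1.
  exact: esym (e_nat _ _ f).
apply: (@retract_exact k M N (pm_comp Psi E) X K
  (fun y A => fhom Psi (a y A : hom (_ : ind) _))
  (fun y A => fhom Psi (b y A : hom (_ : ind) _))).
- move=> y A B f.
  transitivity (fhom Psi (a y B ∘ (fhom E f : hom (E A : T) (E B)) :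
    hom (_ : ind) _)).
    exact: esym (fhomM Psi _ _).
  rewrite a_nat; exact: (fhomM Psi).
- move=> y A B f; transitivity (fhom Psi (b y B ∘ fhom (W y) f : hom (_ : ind) _)).
    exact: esym (fhomM Psi _ _).
  rewrite b_nat; exact: (fhomM Psi).
- move=> A; have [s sid] := tr_sum_id strong trans (E A : T).
  exists (undup s); transitivity (fhom Psi (idm (E A : ind))); last exact: (fhom1 Psi (E A)).
  have ss : {subset s <= undup s} by move=> y; rewrite mem_undup.
  rewrite -[in RHS](sid _ (undup_uniq s) ss).
  transitivity (\sum_(y <- undup s) fhom Psi (tr_b strong trans y (E A : T) ∘
    tr_a strong trans y (E A : T) : hom (_ : ind) _)); last exact: esym (fhom_sum Psi _ _).
  apply: eq_bigr => y _.
  have <- : b y A ∘ a y A =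
      tr_b strong trans y (E A : T) ∘ tr_a strong trans y (E A : T).
    rewrite -[LHS]compA [X in _ ∘ X]compA -[X in _ ∘ (X ∘ _)]fhomM iKl fhom1.
    by rewrite comp1m.
  exact: esym (fhomM Psi _ _).
- exact: Psi_tr_exact.
Qed.

Lemma extension_deg y (A : M) : gl_deg y A -> gl_deg y (pm_comp Psi E A).
Proof.
move=> degA; have degE := ind_from_deg strong trans x degA.
by apply: ind_pm_deg degE => q; exact: svalP (S q).
Qed.

Definition extension : graded_modfun M N :=
  @GradedModFun _ _ _ _ M N (mf_of_pm extension_exact) extension_deg.

Lemma res_extension : modfun_isomorphic (res_mf x extension) S.
Proof.
have [e [e_nat e_phi]] := ind_from_r M strong trans x.
have [] := @ind_extends k C _ (stab_unit C x) (@stab_tensor k G C X x) M _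
  (@stab_act k G C X x M) (abelian_gm M) N (component_pm S) (abelian_gm N)
  E e e_nat.
- by move=> V A; have := e_phi V A; rewrite [LHS]comp1m.
- exact: Phi_full.
- exact: Phi_faithful.
by move=> t [tn tp]; exact: (@res_mf_iso_of k G C X M N x extension S t tn tp).
Qed.

End Correspondence.

Theorem theorem3p8 (k : fieldType) (G : groupType)
    (C : graded_tensor_category k G) (X : gset G)
    (M N : graded_module_category C X) :
  is_strongly_graded C ->
  is_transitive X ->
  is_nonzero M ->
  is_nonzero N ->
  forall x : X,
    (is_graded_module_category (induced x M) /\
     graded_equivalent M (induced x M)) /\
    (exists Phi : isoclasses (fun F F' : graded_modfun M N =>
                                modfun_isomorphic F F') ->
                  isoclasses (@modfun_isomorphic k (stab_cat C x)
                                (component x M) (component x N)),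
       bijective Phi).
Proof.
move=> strong trans _ _ x; split.
  by split; [exact: ind_graded | exact: ind_equivalent].
apply: (isoclasses_bijection (f := res_mf x)).
- by move=> F; exact: modfun_iso_refl.
- by move=> F F'; exact: modfun_iso_sym.
- by move=> F F' F''; exact: modfun_iso_trans.
- exact: modfun_iso_refl.
- exact: modfun_iso_sym.
- exact: modfun_iso_trans.
- by move=> F F'; split; [exact: res_mf_iso | exact: res_mf_inj].
- by move=> S; exists (extension strong trans S); exact: res_extension.
Qed.
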